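(* Let $(E,\lVert\cdot\rVert_E)$ be a Banach space, let $1<p<\infty$, and let $T:L^p(\mathbb{R}^d\to E)\to L^p(\mathbb{R}^d\to E)$ be a vector-valued Calderón-Zygmund operator with Hölder exponent $\alpha\in(0,1]$. There is a constant $C$, depending only on the dimension $d$ and on the constants implicit in the definition of a vector-valued Calderón-Zygmund operator, such that the following holds. Let $f:\mathbb{R}^d\to E$ be strongly measurable, bounded, and compactly supported, and let $Q^0$ be a cube that contains the support of $f$. Then for each $u\in\{0,\frac13,\frac23\}^d$ and each $k\in\mathbb{N}=\{0,1,2,\dots\}$ there exists a collection $\mathcal{S}^u_k$ of dyadic cubes of the translated dyadic system $\mathcal{D}^u$ (the collection is allowed to depend on $T$ and $f$) such that $\mathcal{S}^u_k$ is pairwise nearly disjoint and, for almost every $x\in\mathbb{R}^d$, $$1_{Q^0}(x)\,\lVert (Tf)(x)\rVert_E\le C\sum_{u\in\{0,\frac13,\frac23\}^d}\ \sum_{k=0}^\infty 2^{-\alpha k}\,\bigl(A_{\mathcal{S}^u_k,k}\lVert f\rVert_E\bigr)(x).$$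
   Context: Notation. $|\cdot|$ is Lebesgue measure on $\mathbb{R}^d$ (and the Euclidean norm of vectors); cubes are axis-parallel; $\fint_Q g=\frac1{|Q|}\int_Q g$; $\lVert f\rVert_E$ denotes the function $x\mapsto\lVert f(x)\rVert_E$. $B(E\to E)$ is the space of bounded linear operators on $E$ with operator norm $\lVert\cdot\rVert_{B(E\to E)}$. Strong measurability. $f:\mathbb{R}^d\to E$ is strongly (Bochner) measurable if $f^{-1}(B)$ is Lebesgue measurable for every Borel set $B\subset E$ and there is a null set $N$ such that $f(\mathbb{R}^d\setminus N)$ is separable. $L^p(\mathbb{R}^d\to E)$ is the space of strongly measurable $f$ with $\lVert f\rVert_{L^p(\mathbb{R}^d\to E)}=(\int\lVert f(x)\rVert_E^p\,dx)^{1/p}<\infty$. Singular kernel with Hölder exponent $\alpha\in(0,1]$: a function $K:\mathbb{R}^d\times\mathbb{R}^d\setminus\{(x,x):x\in\mathbb{R}^d\}\to B(E\to E)$ for which there is a constant $C_K$ such that (i) $\lVert K(x,y)\rVert_{B(E\to E)}\le C_K|x-y|^{-d}$ whenever $x\ne y$; (ii) $\lVert K(x,y)-K(x',y)\rVert_{B(E\to E)}\le C_K\bigl(\frac{|x-x'|}{|x-y|}\bigr)^\alpha|x-y|^{-d}$ whenever $0<|x-x'|<\frac12|x-y|$, and $\lVert K(x,y)-K(x,y')\rVert_{B(E\to E)}\le C_K\bigl(\frac{|y-y'|}{|x-y|}\bigr)^\alpha|x-y|^{-d}$ whenever $0<|y-y'|<\frac12|x-y|$. Vector-valued Calderón-Zygmund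 operator with Hölder exponent $\alpha$ ($1<p<\infty$): a linear operator $T:L^p(\mathbb{R}^d\to E)\to L^p(\mathbb{R}^d\to E)$ that is bounded and for which there is a singular kernel $K$ with Hölder exponent $\alpha$ such that $Tf(x)=\int K(x,y)f(y)\,dy$ for every strongly measurable, bounded, compactly supported $f:\mathbb{R}^d\to E$ and every $x$ outside the support of $f$. The constants implicit in this definition are $p$, the operator norm of $T$ on $L^p(\mathbb{R}^d\to E)$, $C_K$, and $\alpha$. Pairwise nearly disjoint. For $0<\nu<1$, a collection $\mathcal{S}$ of measurable sets is pairwise nearly disjoint with the parameter $\nu$ if for every $Q\in\mathcal{S}$ there is a measurable subset $E(Q)\subset Q$ with $|E(Q)|\ge\nu|Q|$, and $E(Q)\cap E(Q')=\emptyset$ for all $Q,Q'\in\mathcal{S}$ with $Q\ne Q'$. It is called pairwise nearly disjoint if this holds with some parameter $\nu\in(0,1)$. Translated dyadic systems. For $u\in\{0,\frac13,\frac23\}^d$, $\mathcal{D}^u=\{2^{-j}([0,1)^d+m+(-1)^ju): j\in\mathbb{Z},\,m\in\mathbb{Z}^d\}$. Dyadic model operator. For a collection $\mathcal{S}$ of dyadic cubes (of one dyadic system) and $k\in\mathbb{N}$, and for measurable $g:\mathbb{R}^d\to[0,\infty)$, $A_{\mathcal{S},k}g=\sum_{Q\in\mathcal{S}}1_Q\fint_{Q^{(k)}}g$, where $Q^{(k)}$ is the $k$-th dyadic ancestor of $Q$ in that system. *)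

(* Defs.v *)
From HB Require Import structures.
From mathcomp Require Import all_boot all_order all_algebra.
From mathcomp Require Import all_classical all_reals all_analysis.

Set Implicit Arguments.
Unset Strict Implicit.
Unset Printing Implicit Defensive.
Import Order.TTheory GRing.Theory Num.Theory.
Import numFieldNormedType.Exports.
Local Open Scope classical_set_scope.
Local Open Scope ring_scope.

(** R^d is ['rV[R]_d]. Its library topology is the usual one, but its library
    norm is the sup norm, hence the separate Euclidean norm. *)
Definition enorm (R : realType) (d : nat) (x : 'rV[R]_d) : R :=
  Num.sqrt (\sum_(i < d) x ord0 i ^+ 2).

(** The library has Lebesgue measure only for d = 1. On R^d it is taken here to
    be the Caratheodory measure of the outer measure obtained from countable
    covers by half-open boxes, so that "measurable" means Lebesgue (not just
    Borel) measurable. *)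

Definition box (R : realType) (d : nat) (c : 'rV[R]_d * 'rV[R]_d) :
    set 'rV[R]_d :=
  [set x | forall i, c.1 ord0 i <= x ord0 i < c.2 ord0 i].

Definition box_volume (R : realType) (d : nat) (c : 'rV[R]_d * 'rV[R]_d) : R :=
  \prod_(i < d) Num.max 0 (c.2 ord0 i - c.1 ord0 i).

Definition box_cover (R : realType) (d : nat) (A : set 'rV[R]_d) :
    set (set ('rV[R]_d * 'rV[R]_d)) :=
  [set C | countable C /\ A `<=` \bigcup_(c in C) box c].

Definition lebesgue_outer (R : realType) (d : nat) (A : set 'rV[R]_d) : \bar R :=
  ereal_inf [set (\esum_(c in C) (box_volume c)%:E)%E | C in box_cover A].

Section lebesgue_outer.
Context (R : realType) (d : nat).
Local Open Scope ereal_scope.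

Lemma box_volume_ge0 (c : 'rV[R]_d * 'rV[R]_d) : 0 <= (box_volume c)%:E.
Proof. by rewrite lee_fin prodr_ge0// => i _; rewrite le_max lexx. Qed.

Lemma lebesgue_outer_ge0 (A : set 'rV[R]_d) : 0 <= lebesgue_outer A.
Proof.
apply: le_ereal_inf_tmp => _ [C _ <-].
by apply: esum_ge0 => c _; exact: box_volume_ge0.
Qed.

Lemma lebesgue_outer0 : lebesgue_outer (set0 : set 'rV[R]_d) = 0.
Proof.
apply/eqP; rewrite eq_le lebesgue_outer_ge0 andbT.
apply: ereal_inf_lbound; exists set0; last by rewrite esum_set0.
by split; [exact: countable0|exact: sub0set].
Qed.

Lemma le_lebesgue_outer :
  {homo @lebesgue_outer R d : A B / A `<=` B >-> A <= B}.
Proof.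
move=> A B AB; apply: ereal_inf_le_tmp => _ [C [cC BC] <-].
by exists C => //; split => //; exact: subset_trans BC.
Qed.

Lemma esum_bigcup_le (T : choiceType) (C : (set T)^nat) (a : T -> \bar R) :
  (forall x, 0 <= a x) ->
  \esum_(x in \bigcup_n C n) a x <= \sum_(n <oo) \esum_(x in C n) a x.
Proof.
move=> a0; rewrite seqDU_bigcup_eq nneseries_sum_bigcup//.
apply: lee_nneseries => n _; first by move=> _; exact: esum_ge0.
rewrite esum_mkcond [leRHS]esum_mkcond; apply: le_esum => x _.
case: ifPn => [|_]; last by case: ifPn.
by move=> /set_mem Cx; rewrite mem_set//; exact: (subset_seqDU Cx).
Qed.

Lemma lebesgue_outer_sigma_subadditive :
  sigma_subadditive (@lebesgue_outer R d).
Proof.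
move=> A; have [[i ioo]|] := pselect (exists i, lebesgue_outer (A i) = +oo).
  rewrite (eseries_pinfty _ _ ioo) ?leey// => n _.
  by rewrite -ltNye (lt_le_trans _ (lebesgue_outer_ge0 _)).
rewrite -forallNE => Aoo.
apply/lee_addgt0Pr => e e0.
rewrite (le_trans _ (epsilon_trick _ _ (ltW e0)))//; last first.
  by move=> n; exact: lebesgue_outer_ge0.
have /choice[C CP] n : exists C, box_cover (A n) C /\
    \esum_(c in C) (box_volume c)%:E <=
    lebesgue_outer (A n) + (e / (2 ^ n.+1)%:R)%:E.
  have en : (0 < e / (2 ^ n.+1)%:R)%R by rewrite divr_gt0// ltr0n expn_gt0.
  have fA : lebesgue_outer (A n) \is a fin_num.
    by rewrite ge0_fin_numE ?lebesgue_outer_ge0// ltey; apply/eqP; exact: Aoo.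
  have [_ [C AC <-] /ltW ?] := lb_ereal_inf_adherent en fA.
  by exists C.
apply: (@le_trans _ _ (\esum_(c in \bigcup_n C n) (box_volume c)%:E)).
  apply: ereal_inf_lbound; exists (\bigcup_n C n) => //; split.
    by apply: bigcup_countable => // n _; exact: (CP n).1.1.
  move=> x [n _ /(CP n).1.2[c Cc xc]]; exists c => //.
  by exists n.
apply: (le_trans (esum_bigcup_le _ _)) => [c|]; first exact: box_volume_ge0.
apply: lee_nneseries => n _; last exact: (CP n).2.
by move=> _; apply: esum_ge0 => c _; exact: box_volume_ge0.
Qed.

HB.instance Definition _ := isOuterMeasure.Build R 'rV[R]_d
  (@lebesgue_outer R d) lebesgue_outer0 lebesgue_outer_ge0 le_lebesgue_outer
  lebesgue_outer_sigma_subadditive.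

End lebesgue_outer.

Notation lebesgue_type R d := (caratheodory_type (@lebesgue_outer R d)).

Definition lebesgue_rV (R : realType) (d : nat) :
    set (lebesgue_type R d) -> \bar R := @lebesgue_outer R d.
Arguments lebesgue_rV : clear implicits.

HB.instance Definition _ (R : realType) (d : nat) :=
  isMeasure.Build _ (lebesgue_type R d) R (lebesgue_rV R d)
    (@caratheodory_measure0 R 'rV[R]_d (@lebesgue_outer R d))
    (@caratheodory_measure_ge0 R 'rV[R]_d (@lebesgue_outer R d))
    (@caratheodory_measure_sigma_additive R 'rV[R]_d (@lebesgue_outer R d)).

Definition separable_set (E : topologicalType) (A : set E) : Prop :=
  exists D : set E, [/\ countable D, D `<=` A & A `<=` closure D].

Section vector_valued.
Context (R : realType) (d : nat) (E : normedModType R).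
Implicit Types (f : 'rV[R]_d -> E).
Local Notation mu := (lebesgue_rV R d).

Definition strongly_measurable f : Prop :=
  (forall B : set E, <<s open >> B ->
     measurable (f @^-1` B : set (lebesgue_type R d))) /\
  (exists2 N : set 'rV[R]_d, mu.-negligible N & separable_set (f @` (~` N))).

Definition closed_support f : set 'rV[R]_d := closure [set x | f x != 0].

Definition Lpnorm (p : R) f : \bar R :=
  Lnorm mu p%:E (fun x => `|f x|%:E).

Definition Lp (p : R) : set ('rV[R]_d -> E) :=
  [set f | strongly_measurable f /\ (Lpnorm p f < +oo)%E].

(** A list of pairs [(A, v)] stands for the simple function
    [\sum_(A, v) \1_A *: v]. *)
Definition simple_val (s : seq (set 'rV[R]_d * E)) (x : 'rV[R]_d) : E :=
  \sum_(c <- s) (\1_(c.1) x : R) *: c.2.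

Definition simple_integral (s : seq (set 'rV[R]_d * E)) : E :=
  \sum_(c <- s) fine (mu c.1) *: c.2.

Definition is_simple (s : seq (set 'rV[R]_d * E)) : Prop :=
  forall c, c \in s ->
    measurable (c.1 : set (lebesgue_type R d)) /\ (mu c.1 < +oo)%E.

Definition has_bochner_integral f (v : E) : Prop :=
  strongly_measurable f /\
  exists s : nat -> seq (set 'rV[R]_d * E),
    [/\ forall n, is_simple (s n),
        (fun n => (\int[mu]_x `|f x - simple_val (s n) x|%:E)%E) @ \oo --> 0%E &
        (fun n => simple_integral (s n)) @ \oo --> v].

End vector_valued.

(** Extended-real valued: it is [+oo] on unbounded linear maps. *)
Definition opnorm (R : realType) (E : normedModType R) (A : E -> E) : \bar R :=
  ereal_sup [set (`|A v|%:E)%E | v in [set v : E | `|v| <= 1]].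

(** The values [K x x] on the diagonal are irrelevant. *)
Definition singular_kernel (R : realType) (d : nat) (E : normedModType R)
    (alpha CK : R) (K : 'rV[R]_d -> 'rV[R]_d -> {linear E -> E}) : Prop :=
  [/\ forall x y, x != y -> continuous (K x y),
      forall x y, x != y -> (opnorm (K x y) <= (CK * enorm (x - y) ^- d)%:E)%E,
      forall x x' y, 0 < enorm (x - x') < 2^-1 * enorm (x - y) ->
        (opnorm (fun v => K x y v - K x' y v)%R <=
          (CK * (enorm (x - x') / enorm (x - y)) `^ alpha
             * enorm (x - y) ^- d)%:E)%E &
      forall x y y', 0 < enorm (y - y') < 2^-1 * enorm (x - y) ->
        (opnorm (fun v => K x y v - K x y' v)%R <=
          (CK * (enorm (y - y') / enorm (x - y)) `^ alpha
             * enorm (x - y) ^- d)%:E)%E].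

Section cz_operator.
Context (R : realType) (d : nat) (E : normedModType R).
Implicit Types (T : ('rV[R]_d -> E) -> ('rV[R]_d -> E)).
Local Notation mu := (lebesgue_rV R d).

(** Elements of L^p are functions, with equality in L^p being equality almost
    everywhere. The values of [T] outside [Lp p] are irrelevant. *)
Definition Lp_linear (p : R) T : Prop :=
  (forall f, Lp p f -> Lp p (T f)) /\
  (forall (a : R) f g, Lp p f -> Lp p g ->
     {ae mu, forall x, T (fun y => a *: f y + g y) x = a *: T f x + T g x}).

Definition Lp_opnorm (p : R) T : \bar R :=
  ereal_sup [set Lpnorm p (T f) | f in
    [set f : 'rV[R]_d -> E | Lp p f /\ (Lpnorm p f <= 1)%E]].

Definition cz_operator (p alpha N CK : R) T : Prop :=
  [/\ Lp_linear p T,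
      Lp_opnorm p T = N%:E &
      exists K : 'rV[R]_d -> 'rV[R]_d -> {linear E -> E},
        singular_kernel alpha CK K /\
        forall f, strongly_measurable f -> bounded_fun f ->
          compact (closed_support f) ->
          forall x, ~ closed_support f x ->
            has_bochner_integral (fun y => K x y (f y)) (T f x)].

End cz_operator.

Section dyadic.
Context (R : realType) (d : nat).
Implicit Types (Q : set 'rV[R]_d) (S : set (set 'rV[R]_d)) (u : 'rV['I_3]_d).
Local Notation mu := (lebesgue_rV R d).

(** A product of intervals of equal length; each face may or may not belong to
    the cube ([BSide true] closes a left endpoint and opens a right one). *)
Definition is_cube Q : Prop :=
  exists (a : 'rV[R]_d) (l : R) (bl br : 'I_d -> bool), 0 < l /\
    Q = [set x | forall i, x ord0 i \in
          Interval (BSide (bl i) (a ord0 i)) (BSide (br i) (a ord0 i + l))].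

(** [u : 'rV['I_3]_d] encodes the point [u / 3] of {0, 1/3, 2/3}^d. *)
Definition dyadic_shift u : 'rV[R]_d := \row_i ((u ord0 i)%:R / 3).

Definition unit_cube : set 'rV[R]_d := [set y | forall i, 0 <= y ord0 i < 1].

Definition dyadic_cube u (j : int) (m : 'rV[int]_d) : set 'rV[R]_d :=
  [set (2 : R) ^ (- j) *: (y + map_mx intr m + (-1 : R) ^ j *: dyadic_shift u)
     | y in unit_cube].

Definition dyadic_system u : set (set 'rV[R]_d) :=
  [set Q | exists j m, Q = dyadic_cube u j m].

(** For [0 < d], a cube [Q] of the system determines [j] and [m], and exactly
    one [P] qualifies. *)
Definition dyadic_ancestor u (k : nat) Q : set 'rV[R]_d :=
  xget set0 [set P | exists j m m',
    [/\ Q = dyadic_cube u j m, P = dyadic_cube u (j - k%:Z) m' & Q `<=` P]].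

Definition pairwise_nearly_disjoint_with (nu : R) S : Prop :=
  (forall Q, S Q -> measurable (Q : set (lebesgue_type R d))) /\
  exists F : set 'rV[R]_d -> set 'rV[R]_d,
    (forall Q, S Q -> [/\ measurable (F Q : set (lebesgue_type R d)),
       F Q `<=` Q & (nu%:E * mu Q <= mu (F Q))%E]) /\
    (forall Q Q', S Q -> S Q' -> Q <> Q' -> F Q `&` F Q' = set0).

Definition pairwise_nearly_disjoint S : Prop :=
  exists nu : R, 0 < nu < 1 /\ pairwise_nearly_disjoint_with nu S.

Definition average Q (g : 'rV[R]_d -> R) : \bar R :=
  ((fine (mu Q))^-1%:E * \int[mu]_(y in Q) (g y)%:E)%E.

Definition model_operator u S (k : nat) (g : 'rV[R]_d -> R) (x : 'rV[R]_d) :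
    \bar R :=
  (\esum_(Q in S) ((\1_Q x)%:E * average (dyadic_ancestor u k Q) g))%E.

End dyadic.

(* Main.v *)
Require Import Defs.
From mathcomp Require Import all_boot all_order all_algebra.
From mathcomp Require Import all_classical all_reals all_analysis.
From mathcomp Require Import measurable_realfun.
From mathcomp Require Import lra ring zify.
Import Order.TTheory GRing.Theory Num.Theory.
Import numFieldNormedType.Exports.
Local Open Scope classical_set_scope.
Local Open Scope ring_scope.
Set Implicit Arguments.
Unset Strict Implicit.
Unset Printing Implicit Defensive.

(** The theorem iterates one local estimate along a dyadic tree.

    The local estimate is [local_oscillation]. For a cube [P] of side [l] let
    [B_P] be the sum over [k] of [2 ^ (- alpha k) (2 ^ k l) ^ (- d)] times the
    integral of [|f|] over the [k]-th dilate of [P]. Then [T f] is within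
    [Lam * B_P] of a constant vector [c_P], except on a part of [P] of measure at
    most [eps * |P|]; here [eps] is arbitrary and [Lam] depends only on [eps] and
    on the constants of [T]. To see this, cut [f] at the tripled cube. The
    regularity of the kernel bounds the variation over [P] of the image of the
    far part ([kernel_oscillation], [far_part_oscillation]), and the image of the
    near part is small off a small set by the weak-type (1, 1) bound
    ([weak_type]). If [f] vanishes off the tripled cube, then [c_P = 0].

    Now start from top cubes of side at least that of [Q0] and descend. A
    descendant [P'] of the last stopping cube [P] becomes a stopping cube when
    the exceptional set of [P] fills more than the fraction [2 ^ (- d - 2)] of
    it. With [eps] half that fraction, the next stopping cubes cover at most half
    of [P], so the rest of [P] is a disjoint major part ([mu_final_part]). The
    dyadic parent of [P'] did not stop, so the exceptional sets of [P] and [P']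
    leave a common good point of [P'], and [|c_P - c_P'|] is at most
    [Lam * (B_P + B_P')]. Almost every point has finitely many stopping cubes
    around it, and the last of them controls [T f] there. Telescoping bounds
    [|T f|] by twice the sum of [Lam * B_P] over the stopping cubes around the
    point ([stopping_bound]); the top constant is zero on [Q0], because the
    triple of a top cube that meets [Q0] contains the support of [f].

    Finally [shifted_cover] finds, for each stopping cube [P] and each [k], one
    of the translated systems with a cube [R] that contains [P], has measure
    [16 ^ d * |P|], and whose [k]-th ancestor contains the [k]-th dilate of [P].
    Hence the [k]-th term of [B_P] is at most [16 ^ d * 2 ^ (- alpha k)] times
    the mean of [|f|] over that ancestor. The cubes [R] form the sparse families,
    and the disjoint major part of [P] serves for [R].

    The analysis below the weak-type bound is arranged around half-open cubes
    and step functions. Lebesgue differentiation takes the form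
    [sparse_everywhere_null]; a bounded function is a step function up to a small
    error ([step_approximation]), and for a step function the
    Calderon-Zygmund decomposition is a finite sum of simple functions. Of the
    Bochner integral only [bochner_dist_le] is used: two integrals are as close
    as a scalar majorant of the distance of the integrands allows. *)

(** * Lebesgue measure of boxes *)

Section box_measure.
Context (R : realType) (d' : nat).
Local Notation d := d'.+1.
Local Notation pt := 'rV[R]_d.
Implicit Types (c : pt * pt) (A : set pt).

Definition null_box : pt * pt := (0, 0).

Lemma box_volume_null : box_volume null_box = 0.
Proof.
by rewrite /box_volume (bigD1 ord0)//= !mxE subrr maxxx mul0r.
Qed.

Lemma box_cover_sequence A C : box_cover A C ->
  exists2 s : nat -> pt * pt, A `<=` \bigcup_n box (s n) &
    (\sum_(n <oo) (box_volume (s n))%:E = \esum_(c in C) (box_volume c)%:E)%E.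
Proof.
move=> [/countable_bijP[B]]; rewrite card_eq_sym => /card_set_bijP[e eBC] AC.
pose s n := if n \in B then e n else null_box.
have [_ eB eC] := eBC.
exists s.
  move=> x /AC[c Cc xc]; have [n Bn en] := eC _ Cc.
  by exists n => //; rewrite /s mem_set// en.
rewrite (reindex_esum _ _ _ _ eBC).
transitivity (\sum_(n <oo | n \in B) (box_volume (e n))%:E)%E.
  rewrite [RHS]eseries_mkcond; apply: eq_eseriesr => n _; rewrite /s.
  by case: ifP => _ //; rewrite box_volume_null.
rewrite nneseries_esum; last by move=> n _; exact: box_volume_ge0.
by congr esum; rewrite set_mem_set.
Qed.

Lemma lebesgue_outer_le_sequence A (s : nat -> pt * pt) :
  A `<=` \bigcup_n box (s n) ->
  (lebesgue_outer A <= \sum_(n <oo) (box_volume (s n))%:E)%E.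
Proof.
move=> As; apply: (le_trans (le_lebesgue_outer As)).
apply: (le_trans (lebesgue_outer_sigma_subadditive _)).
apply: lee_nneseries => n _; first by move=> _; exact: lebesgue_outer_ge0.
apply: ereal_inf_lbound; exists [set s n].
  by split; [exact: countable1|move=> x sx; exists (s n)].
by rewrite esum_set1// box_volume_ge0.
Qed.

Definition lower_halfspace (i : 'I_d) (a : R) : set pt :=
  [set x | x ord0 i < a].

Definition set_coord (x : pt) (i : 'I_d) (t : R) : pt :=
  \row_j (if j == i then t else x ord0 j).

(** A hyperplane cuts a box into two boxes whose volumes add up, so a cover
    of a set splits into covers of its two halves with the same total volume. *)
Lemma halfspace_measurable i a :
  measurable (lower_halfspace i a : set (lebesgue_type R d)).
Proof.
apply: (@le_caratheodory_measurable R _ (@lebesgue_outer R d)) => X.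
apply: le_ereal_inf_tmp => _ [C XC <-].
have [s Xs <-] := box_cover_sequence XC.
pose sl n := ((s n).1, set_coord (s n).2 i (Num.min a ((s n).2 ord0 i))).
pose sr n := (set_coord (s n).1 i (Num.max a ((s n).1 ord0 i)), (s n).2).
have -> : (\sum_(n <oo) (box_volume (s n))%:E =
  \sum_(n <oo) (box_volume (sl n))%:E + \sum_(n <oo) (box_volume (sr n))%:E)%E.
  rewrite -nneseriesD; [|by move=> n _ _; exact: box_volume_ge0..].
  apply: eq_eseriesr => n _; rewrite -EFinD; congr (_%:E).
  rewrite /box_volume (bigD1 i)//= [X in _ = X + _](bigD1 i)//=.
  rewrite [X in _ = _ + X](bigD1 i)//= !mxE eqxx.
  rewrite [X in _ = _ * X + _](eq_bigr
    (fun j => Num.max 0 ((s n).2 ord0 j - (s n).1 ord0 j))); last first.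
    by move=> j ji; rewrite !mxE (negbTE ji).
  rewrite [X in _ = _ + _ * X](eq_bigr
    (fun j => Num.max 0 ((s n).2 ord0 j - (s n).1 ord0 j))); last first.
    by move=> j ji; rewrite !mxE (negbTE ji).
  rewrite -mulrDl; congr (_ * _); move: ((s n).1 _ _) ((s n).2 _ _) => u v.
  rewrite /Num.min /Num.max; repeat case: ifPn; rewrite -?leNgt; lra.
apply: leeD; apply: lebesgue_outer_le_sequence => x [/Xs[n _ sx] xa]; exists n => //= j;
  have /andP[h1 h2] := sx j; rewrite ?h1 ?h2 ?andbT/= !mxE; case: eqP => // ji; subst j.
  by rewrite lt_min h2 andbT; exact: xa.
by rewrite ge_max h1 andbT leNgt; apply/negP.
Qed.

Lemma box_halfspaces c : box c =
  \bigcap_(i in [set: 'I_d])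
    (~` lower_halfspace i (c.1 ord0 i) `&` lower_halfspace i (c.2 ord0 i)).
Proof.
apply/seteqP; split => [x cx i _|x cx i].
  by have /andP[h1 h2] := cx i; split => //; apply/negP; rewrite -leNgt.
by have [/negP + h] := cx i I; rewrite -leNgt => ->; exact: h.
Qed.

Lemma box_measurable c : measurable (box c : set (lebesgue_type R d)).
Proof.
rewrite box_halfspaces; apply: fin_bigcap_measurable => // i _.
apply: measurableI; last exact: halfspace_measurable.
by apply: measurableC; exact: halfspace_measurable.
Qed.

(** Interpolates between the indicator of the box ([k = 0]) and its volume
    ([k = d]): the first [k] factors have been integrated out. *)
Let mixed (k : nat) (c : pt * pt) (x : pt) : R :=
  \prod_(i < d) (if (i < k)%N then Num.max 0 (c.2 ord0 i - c.1 ord0 i)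
                 else \1_`[c.1 ord0 i, c.2 ord0 i[ (x ord0 i)).

Let integral_itv_indic (a b : R) :
  (\int[lebesgue_measure]_t (\1_`[a, b[ t)%:E = (Num.max 0 (b - a))%:E)%E.
Proof.
rewrite integral_indic// setIT.
transitivity (lebesgue_measure (`[a, b[%classic : set R)); first by [].
rewrite lebesgue_measure_itv/= lte_fin.
rewrite /Num.max; case: ifPn => ab; case: ifPn => // h; rewrite ?EFinB //.
  by move: h; rewrite subr_gt0 ab.
by move: h; rewrite subr_gt0 (negbTE ab).
Qed.

Let mixedS (k : 'I_d) c x : exists2 g, 0 <= g &
  (forall t, mixed k c (set_coord x k t) =
     g * \1_`[c.1 ord0 k, c.2 ord0 k[ t) /\
  mixed k.+1 c x = g * Num.max 0 (c.2 ord0 k - c.1 ord0 k).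
Proof.
exists (\prod_(i < d | i != k)
  (if (i < k)%N then Num.max 0 (c.2 ord0 i - c.1 ord0 i)
                 else \1_`[c.1 ord0 i, c.2 ord0 i[ (x ord0 i))).
  by apply: prodr_ge0 => i _; case: ifP => _; rewrite ?le_max ?lexx//.
split.
  move=> t; rewrite /mixed (bigD1 k)//= ltnn mxE eqxx mulrC; congr (_ * _).
  by apply: eq_bigr => j jk; rewrite mxE (negbTE jk).
rewrite /mixed (bigD1 k)//= ltnSn mulrC; congr (_ * _).
apply: eq_bigr => j jk; rewrite ltnS leq_eqVlt.
by have /negbTE -> : (j : nat) != k by apply: contra jk => /eqP/val_inj ->.
Qed.

(** Integrating the inequality [1_box <= sum_n 1_(box n)] in one variable after
    another turns indicators into side lengths: countable subadditivity of the
    volume then follows from that of the integral on the line. *)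
Lemma box_volume_le_cover c (s : nat -> pt * pt) :
  box c `<=` \bigcup_n box (s n) ->
  ((box_volume c)%:E <= \sum_(n <oo) (box_volume (s n))%:E)%E.
Proof.
move=> cs.
have mixed_ge0 k b x : 0 <= mixed k b x.
  by apply: prodr_ge0 => i _; case: ifP => _; rewrite ?le_max ?lexx//.
suff H k : (k <= d)%N -> forall x,
    ((mixed k c x)%:E <= \sum_(n <oo) (mixed k (s n) x)%:E)%E.
  have volE b : box_volume b = mixed d b 0.
    by apply: eq_bigr => i _; rewrite ltn_ord.
  rewrite volE; apply: (le_trans (H d (leqnn _) 0)).
  by apply: lee_nneseries => n _; rewrite ?lee_fin// volE.
elim: k => [_ x|k IH kd x].
  have mixed0 b y : mixed 0 b y = \1_(box b) y.
    rewrite /mixed /= [RHS]indicE; case: (boolP (y \in box b)) => yb.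
      rewrite big1// => i _; rewrite indicE.
      have yi : y ord0 i \in `[b.1 ord0 i, b.2 ord0 i[.
        by move: yb; rewrite inE => /(_ i); rewrite in_itv.
      by rewrite mem_set.
    have [i yi] : exists i, ~ (b.1 ord0 i <= y ord0 i < b.2 ord0 i).
      by apply/existsNP => yb'; move: yb; rewrite mem_set.
    rewrite (bigD1 i)//= indicE memNset ?mul0r//.
  rewrite mixed0 indicE; case: (boolP (x \in box c)) => xc; last first.
    by apply: nneseries_ge0 => n _ _; rewrite lee_fin.
  have /cs[m _ xm] := set_mem xc.
  rewrite (@nneseriesD1 _ _ m)//; last by move=> n; rewrite lee_fin.
  rewrite mixed0 indicE mem_set//= leeDl//.
  by apply: nneseries_ge0 => n _ _; rewrite lee_fin.
pose k0 := Ordinal kd.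
have [g g0 [gE gE']] := mixedS k0 c x.
have /choice[h hP] n : exists h, 0 <= h /\
    (forall t, mixed k (s n) (set_coord x k0 t) =
     h * \1_`[(s n).1 ord0 k0, (s n).2 ord0 k0[ t) /\
  mixed k.+1 (s n) x = h * Num.max 0 ((s n).2 ord0 k0 - (s n).1 ord0 k0).
  by have [h ? ?] := mixedS k0 (s n) x; exists h.
have gm (b : pt * pt) (r : R) : measurable_fun [set: R]
    (EFin \o (fun t : R => r * \1_`[b.1 ord0 k0, b.2 ord0 k0[ t)).
  by apply/measurable_EFinP; apply: measurable_funM => //.
have intE (b : pt * pt) (r : R) : 0 <= r -> (\int[lebesgue_measure]_t
     (r * \1_`[b.1 ord0 k0, b.2 ord0 k0[ t)%:E =
     (r * Num.max 0 (b.2 ord0 k0 - b.1 ord0 k0))%:E)%E.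
  move=> r0; under eq_integral do rewrite EFinM.
  rewrite ge0_integralZl_EFin//; first by rewrite integral_itv_indic EFinM.
  by apply/measurable_EFinP.
have -> : (\sum_(n <oo) (mixed k.+1 (s n) x)%:E =
    \int[lebesgue_measure]_t \sum_(n <oo) (mixed k (s n) (set_coord x k0 t))%:E)%E.
  rewrite integral_nneseries//.
  - apply: eq_eseriesr => n _; have [h0 [hE hE']] := hP n.
    rewrite hE' -intE//; apply: eq_integral => t _; by rewrite hE.
  - by move=> n; have [h0 [hE hE']] := hP n; under eq_fun do rewrite hE; exact: gm.
  - by move=> n t _; rewrite lee_fin.
rewrite gE' -intE//; apply: ge0_le_integral => //.
- by move=> t _; rewrite lee_fin -gE.
- exact: gm.
- apply: ge0_emeasurable_sum => [n t _ _|n _]; first by rewrite lee_fin.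
  by have [h0 [hE hE']] := hP n; under eq_fun do rewrite hE; exact: gm.
- by move=> t _; rewrite -gE; apply: IH; exact: ltnW.
Qed.

Lemma lebesgue_box c : lebesgue_rV R d (box c) = (box_volume c)%:E.
Proof.
apply/eqP; rewrite eq_le; apply/andP; split.
  apply: ereal_inf_lbound; exists [set c].
    by split; [exact: countable1|move=> x sx; exists c].
  by rewrite esum_set1// box_volume_ge0.
apply: le_ereal_inf_tmp => _ [C cC <-].
by have [s cs <-] := box_cover_sequence cC; exact: box_volume_le_cover.
Qed.

Local Notation mu := (lebesgue_rV R d).

Lemma mu_le A B : A `<=` B -> (mu A <= mu B)%E.
Proof. exact: le_lebesgue_outer. Qed.

Lemma mu_fin_num A : (mu A < +oo)%E -> mu A \is a fin_num.
Proof. by rewrite ge0_fin_numE// lebesgue_outer_ge0. Qed.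

Lemma mu_lty_sub A B : A `<=` B -> (mu B < +oo)%E -> (mu A < +oo)%E.
Proof. by move=> AB; exact: le_lt_trans (mu_le AB). Qed.

Lemma muU_le A B : (mu (A `|` B) <= mu A + mu B)%E.
Proof. exact: outer_measureU2. Qed.

Lemma mu_bigcup_le (F : nat -> set pt) :
  (mu (\bigcup_n F n) <= \sum_(n <oo) mu (F n))%E.
Proof. exact: lebesgue_outer_sigma_subadditive. Qed.

Lemma mu_splitD A B : measurable (B : set (lebesgue_type R d)) ->
  mu A = (mu (A `\` B) + mu (A `&` B))%E.
Proof. by move=> mB; rewrite addeC; exact: mB. Qed.

Lemma negligible_mu0 A : mu.-negligible A -> mu A = 0%E.
Proof.
move=> [N [mN N0 AN]]; apply/eqP; rewrite eq_le lebesgue_outer_ge0 andbT -N0.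
exact: mu_le.
Qed.

Lemma mu0_measurable A : mu A = 0%E -> measurable (A : set (lebesgue_type R d)).
Proof.
move=> A0; apply: (@le_caratheodory_measurable R _ (@lebesgue_outer R d)) => X.
rewrite -[leRHS]add0e; apply: leeD; last exact: (mu_le (@subIsetl _ _ _)).
by rewrite -A0; apply: (mu_le (@subIsetr _ _ _)).
Qed.

Lemma mu0_negligible A : mu A = 0%E -> mu.-negligible A.
Proof. by move=> A0; exists A; split => //; exact: mu0_measurable. Qed.

End box_measure.

(** * The dyadic grid below a given top side *)

Section grid.
Context (R : realType) (d' : nat).
Local Notation d := d'.+1.
Local Notation pt := 'rV[R]_d.
Local Notation mu := (lebesgue_rV R d).
Implicit Types (x y : pt) (m : 'rV[int]_d) (A : set pt) (L : R).

Definition side L (n : nat) : R := L / 2 ^+ n.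

(** Cells are fibres of [idx], so that being in the same cell is an equality
    of labels and the cells of one generation partition the space by
    construction. *)
Definition idx L n x : 'rV[int]_d := \row_i Num.floor (x ord0 i / side L n).

Definition cube L n m : set pt := [set x | idx L n x = m].

Definition cell L n x : set pt := cube L n (idx L n x).

Definition corner L n m : pt := \row_i ((m ord0 i)%:~R * side L n).

Lemma side_gt0 L n : 0 < L -> 0 < side L n.
Proof. by move=> L0; rewrite divr_gt0// exprn_gt0. Qed.

Lemma sideS L n : side L n = 2 * side L n.+1.
Proof. by rewrite /side exprS; field; rewrite expf_neq0//=. Qed.

Lemma cubeP L n m x : 0 < L -> cube L n m x <->
  forall i, corner L n m ord0 i <= x ord0 i < corner L n m ord0 i + side L n.
Proof.
move=> L0; have s0 := side_gt0 n L0; split.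
  move=> <- i; rewrite !mxE; have /andP[h1 h2] := floor_itv (x ord0 i / side L n).
  move: h1 h2; rewrite ler_pdivlMr// ltr_pdivrMr// => -> h2.
  by apply: (lt_le_trans h2); rewrite intrD mulrDl mul1r.
move=> h; apply/rowP => i; rewrite mxE; apply: floor_def.
rewrite ler_pdivlMr// ltr_pdivrMr//; move: (h i); rewrite !mxE.
by rewrite intrD mulrDl mul1r.
Qed.

Definition cube_box L n m : pt * pt :=
  (corner L n m, \row_i (corner L n m ord0 i + side L n)).

Lemma cube_boxE L n m : 0 < L -> cube L n m = box (cube_box L n m).
Proof.
move=> L0; apply/seteqP; split => x.
  by move=> /(cubeP _ _ _ L0) h i; rewrite [X in _ < X]mxE; exact: h.
by move=> h; apply/(cubeP _ _ _ L0) => i; have := h i; rewrite [X in _ < X]mxE.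
Qed.

Lemma cube_measurable L n m : 0 < L ->
  measurable (cube L n m : set (lebesgue_type R d)).
Proof. by move=> L0; rewrite cube_boxE//; exact: box_measurable. Qed.

Lemma lebesgue_cube L n m : 0 < L -> mu (cube L n m) = (side L n ^+ d)%:E.
Proof.
move=> L0; rewrite cube_boxE// lebesgue_box; congr (_%:E).
rewrite /box_volume -[d in RHS]card_ord -prodr_const; apply: eq_bigr => i _.
rewrite mxE addrC addKr /Num.max side_gt0//.
Qed.

Lemma corner_cube L n m : 0 < L -> cube L n m (corner L n m).
Proof.
move=> L0; apply/(cubeP _ _ _ L0) => i.
by rewrite lexx ltrDl side_gt0.
Qed.

Lemma cell_refl L n x : cell L n x x. Proof. by []. Qed.

Lemma idx_le L n k x y : 0 < L -> (k <= n)%N ->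
  idx L n x = idx L n y -> idx L k x = idx L k y.
Proof.
move=> L0; elim: n k => [|n IH] k; first by rewrite leqn0 => /eqP ->.
rewrite leq_eqVlt => /predU1P[-> //|]; rewrite ltnS => kn xy.
apply: IH kn _; apply/rowP => i; move/rowP: xy => /(_ i); rewrite !mxE.
have s0 := side_gt0 n.+1 L0.
have half z : z / side L n = (z / side L n.+1) / 2.
  by rewrite sideS; field; rewrite lt0r_neq0.
rewrite !half; move: (x ord0 i / _) (y ord0 i / _) => a b ab.
suff H u v : Num.floor u = Num.floor v ->
    Num.floor (v / 2 : R) <= Num.floor (u / 2 : R).
  by apply/eqP; rewrite eq_le !H.
move=> uv; rewrite floor_ge_int ler_pdivlMr// -(intrM _ _ 2) -floor_ge_int uv.
by rewrite floor_ge_int intrM -ler_pdivlMr// floor_le.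
Qed.

Lemma cell_subset L n k x : 0 < L -> (k <= n)%N -> cell L n x `<=` cell L k x.
Proof. by move=> L0 kn y; exact: idx_le. Qed.

Lemma cell_dist L n x y i : 0 < L -> cell L n x y ->
  `|y ord0 i - x ord0 i| < side L n.
Proof.
move=> L0 /(cubeP _ _ _ L0)/(_ i) h1.
have /(cubeP _ _ _ L0)/(_ i) h2 := cell_refl L n x.
rewrite ltr_norml; lra.
Qed.

Lemma side_small L (e : R) : 0 < L -> 0 < e ->
  exists n0, forall n, (n0 <= n)%N -> side L n < e.
Proof.
move=> L0 e0; exists (Num.Def.truncn (L / e)).+1 => n n0.
rewrite /side ltr_pdivrMr ?exprn_gt0// mulrC -ltr_pdivrMr//.
apply: (lt_le_trans (truncnS_gt _)).
rewrite -natrX ler_nat; apply: (leq_trans n0).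
by apply: ltnW; rewrite ltn_expl.
Qed.

Lemma box_volume_grow (c : pt * pt) (e : R) : 0 < e ->
  exists2 t, 0 < t &
    box_volume (\row_i (c.1 ord0 i - t), c.2) <= box_volume c + e.
Proof.
move=> e0; pose u (i : 'I_d) := Num.max 0 (c.2 ord0 i - c.1 ord0 i).
have cvg_u (r : seq 'I_d) :
    (fun t : R => \prod_(i <- r) (u i + t)) @ (0 : R)^'+ --> \prod_(i <- r) u i.
  elim: r => [|i r IH].
    by under eq_fun do rewrite big_nil; rewrite big_nil; exact: cvg_cst.
  under eq_fun do rewrite big_cons; rewrite big_cons; apply: cvgM => //.
  rewrite -[X in _ --> X]addr0; apply: cvgD; first exact: cvg_cst.
  exact: cvg_within.
have volE : \prod_i u i < box_volume c + e by rewrite ltrDl.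
have H := cvgr_le _ (cvg_u (index_enum 'I_d)) _ volE.
near (0 : R)^'+ => t.
have t0 : 0 < t by near: t; exact: nbhs_right_gt.
exists t => //; apply: (@le_trans _ _ (\prod_i (u i + t))).
  apply: ler_prod => i _; rewrite /= !mxE /u le_max lexx/=.
  rewrite ge_max; apply/andP; split.
    by apply: addr_ge0; [rewrite le_max lexx|exact: ltW].
  have : c.2 ord0 i - c.1 ord0 i <= Num.max 0 (c.2 ord0 i - c.1 ord0 i).
    by rewrite le_max lexx orbT.
  lra.
by near: t; exact: H.
Unshelve. all: by end_near. Qed.

(** Half-open boxes are only enlarged to the left: they already contain all
    small cells around each of their points on the other side. *)
Lemma outer_regular L A (eta : R) : 0 < L -> (mu A < +oo)%E -> 0 < eta ->
  exists U, [/\ measurable (U : set (lebesgue_type R d)), A `<=` U,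
    (mu U <= mu A + eta%:E)%E &
    forall x, A x -> exists n0, forall n, (n0 <= n)%N -> cell L n x `<=` U].
Proof.
move=> L0 Afin eta0; have e20 : 0 < eta / 2 by rewrite divr_gt0.
have fA : mu A \is a fin_num by rewrite ge0_fin_numE// lebesgue_outer_ge0.
have [_ [C /box_cover_sequence[s As <-] <-] /ltW sA] :=
  lb_ereal_inf_adherent e20 fA.
have /choice[t tP] n : exists t, 0 < t /\
    box_volume (\row_i ((s n).1 ord0 i - t), (s n).2) <=
    box_volume (s n) + eta / 2 / (2 ^ n.+1)%:R.
  have en : 0 < eta / 2 / (2 ^ n.+1)%:R by rewrite divr_gt0// ltr0n expn_gt0.
  by have [t t0 tP] := box_volume_grow (s n) en; exists t.
pose grown n : pt * pt := (\row_i ((s n).1 ord0 i - t n), (s n).2).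
exists (\bigcup_n box (grown n)); split.
- by apply: bigcupT_measurable => n; exact: box_measurable.
- move=> x /As[n _ xn]; exists n => // i; have /andP[h1 h2] := xn i.
  by rewrite h2 andbT mxE; have [t0 _] := tP n; lra.
- apply: (le_trans (lebesgue_outer_le_sequence (fun x => id))).
  apply: (@le_trans _ _ (\sum_(n <oo)
      ((box_volume (s n))%:E + (eta / 2 / (2 ^ n.+1)%:R)%:E))%E).
    apply: lee_nneseries => n _; first by move=> _; exact: box_volume_ge0.
    by rewrite -EFinD lee_fin; have [_] := tP n.
  apply: (le_trans (epsilon_trick _ _ (ltW e20))).
    by move=> n; exact: box_volume_ge0.
  rewrite [X in (_ <= _ + X)%E](_ : _ = (eta / 2)%:E + (eta / 2)%:E)%E; last first.
    by rewrite -EFinD; congr (_%:E); lra.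
  by rewrite addeA leeD2r.
- move=> x /As[n _ xn].
  have [t0 _] := tP n.
  have /choice[k kP] i : exists k, forall n1, (k <= n1)%N ->
      side L n1 < (s n).2 ord0 i - x ord0 i.
    by apply: side_small => //; have /andP[_] := xn i; rewrite subr_gt0.
  have [k0 k0P] := side_small L0 t0.
  exists (maxn k0 (\max_i k i)) => n1; rewrite geq_max => /andP[h0 h1].
  move=> y xy; exists n => // i; have := cell_dist i L0 xy.
  have := k0P _ h0; have := kP i _ (leq_trans (leq_bigmax i) h1).
  rewrite ltr_norml mxE; have /andP := xn i.
  move: (x ord0 i) (y ord0 i) => a b; rewrite /=; lra.
Qed.

Definition cells_union L (F : set (nat * 'rV[int]_d)) : set pt :=
  \bigcup_(t in F) cube L t.1 t.2.

(** Coarser cells have smaller generation, so a maximal cell of [F] is one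
    with no coarser member of [F] around its points. *)
Definition maximal_cells L (F : set (nat * 'rV[int]_d)) :
    set (nat * 'rV[int]_d) :=
  [set t | F t /\ forall x k, cube L t.1 t.2 x -> (k < t.1)%N ->
     ~ F (k, idx L k x)].

Lemma maximal_cells_cover L F x : 0 < L -> cells_union L F x ->
  exists2 t, maximal_cells L F t & cube L t.1 t.2 x.
Proof.
move=> L0 [[n m]] /= Fnm xnm.
have ex : exists k, `[< F (k, idx L k x) >] by exists n; apply/asboolP; rewrite xnm.
exists (ex_minn ex, idx L (ex_minn ex) x) => //.
case: ex_minnP => k /asboolP Fk kmin; split => //= y j yx jk Fj.
have : (k <= j)%N.
  by apply: kmin; apply/asboolP; rewrite -(idx_le L0 (ltnW jk) yx).
by rewrite leqNgt jk.
Qed.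

Lemma maximal_cells_disjoint L F t t' x :
  maximal_cells L F t -> maximal_cells L F t' ->
  cube L t.1 t.2 x -> cube L t'.1 t'.2 x -> t = t'.
Proof.
case: t t' => [n m] [n' m'] [/= Ft tmax] [Ft' tmax'] /= xt xt'.
have nn' : n = n'.
  have [nn'|nn'|//] := ltngtP n n'.
    by case: (tmax' x n xt' nn'); rewrite xt.
  by case: (tmax x n' xt nn'); rewrite xt'.
by subst n'; rewrite -xt -xt'.
Qed.

(** A disjoint sequence with the same union: countable additivity then turns
    estimates on the single cells of a family into estimates on their union. *)
Lemma maximal_cells_sequence L F : 0 < L ->
  exists E : nat -> set pt, [/\ forall k, measurable (E k : set (lebesgue_type R d)),
    forall k, E k = set0 \/
      exists2 t, maximal_cells L F t & E k = cube L t.1 t.2,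
    trivIset setT E & \bigcup_k E k = cells_union L F].
Proof.
move=> L0.
pose E k := if pickle_inv k is Some t then
  if t \in maximal_cells L F then cube L t.1 t.2 else set0 else set0.
have EP k x : E k x -> exists t, [/\ pickle t = k,
    maximal_cells L F t & cube L t.1 t.2 x].
  rewrite /E; case ut : (pickle_inv k) => [t|//]; case: ifPn => // /set_mem Ft xt.
  exists t; split => //.
  by have := @pickle_invK (nat * 'rV[int]_d)%type k; rewrite ut.
exists E; split.
- move=> k; rewrite /E; case: pickle_inv => [t|]; last exact: measurable0.
  by case: ifP => _; [exact: cube_measurable|exact: measurable0].
- move=> k; rewrite /E; case: pickle_inv => [t|]; last by left.
  by case: ifPn => [/set_mem Ft|_]; [right; exists t|left].
- move=> k k' _ _ [x [/EP[t [<- tF xt]] /EP[t' [<- tF' xt']]]].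
  by rewrite (maximal_cells_disjoint tF tF' xt xt').
- apply/seteqP; split => [x [k _ /EP[t [_ [tF _] xt]]]|x]; first by exists t.
  move=> /(maximal_cells_cover L0)[t tF xt]; exists (pickle t) => //.
  by rewrite /E pickleK_inv mem_set.
Qed.

Lemma cells_union_measurable L F : 0 < L ->
  measurable (cells_union L F : set (lebesgue_type R d)).
Proof.
move=> L0; have [E [mE _ _ <-]] := maximal_cells_sequence F L0.
exact: bigcupT_measurable.
Qed.

Lemma mu_cells_union_le L F A (theta : R) : 0 < L -> 0 <= theta ->
  (forall t, maximal_cells L F t ->
    mu (A `&` cube L t.1 t.2) <= theta%:E * mu (cube L t.1 t.2))%E ->
  (mu (A `&` cells_union L F) <= theta%:E * mu (cells_union L F))%E.
Proof.
move=> L0 theta0 Fle; have [E [mE EF tE EU]] := maximal_cells_sequence F L0.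
rewrite -EU measure_semi_bigcup//; last exact: bigcupT_measurable.
rewrite setI_bigcupr -nneseriesZl//.
apply: (le_trans (mu_bigcup_le _)).
apply: lee_nneseries => k _; first by move=> _; exact: lebesgue_outer_ge0.
have [->|[t Ft ->]] := EF k; last exact: Fle.
by rewrite setI0 !measure0 mule0.
Qed.

Lemma mu_cells_union_ge L F A (delta : R) : 0 < L -> 0 <= delta ->
  measurable (A : set (lebesgue_type R d)) ->
  (forall t, F t -> delta%:E * mu (cube L t.1 t.2) <= mu (A `&` cube L t.1 t.2))%E ->
  (delta%:E * mu (cells_union L F) <= mu A)%E.
Proof.
move=> L0 delta0 mA Fge; have [E [mE EF tE EU]] := maximal_cells_sequence F L0.
apply: (@le_trans _ _ (mu (A `&` \bigcup_k E k))); last first.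
  by apply: mu_le; exact: subIsetl.
rewrite -EU measure_semi_bigcup//; last exact: bigcupT_measurable.
have mAE k : measurable (A `&` E k : set (lebesgue_type R d)).
  exact: measurableI.
rewrite setI_bigcupr measure_semi_bigcup//; last 2 first.
- exact: trivIset_setIl.
- exact: bigcupT_measurable.
rewrite -nneseriesZl//.
apply: lee_nneseries => k _.
  by move=> _; rewrite mule_ge0.
have [->|[t [Ft _] ->]] := EF k; last exact: Fge.
by rewrite setI0 !measure0 mule0.
Qed.

(** Density at cells, in the contrapositive. By [outer_regular], [A] lies in
    a set [U] of measure at most [mu A + eta] that contains the small cells
    around the points of [A]. The cells inside [U] on which [A] is sparse
    cover [A], so [mu A <= theta * (mu A + eta)]. *)
Lemma sparse_everywhere_null L A (theta : R) : 0 < L -> theta < 1 ->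
  (forall x n0, A x -> exists2 n, (n0 <= n)%N &
     (mu (A `&` cell L n x) <= theta%:E * mu (cell L n x))%E) ->
  mu A = 0%E.
Proof.
move=> L0 theta1 Asp; pose sparse_at (B : set pt) := forall x n0, B x ->
  exists2 n, (n0 <= n)%N &
     (mu (B `&` cell L n x) <= (Num.max 0 theta)%:E * mu (cell L n x))%E.
have {theta1} : Num.max 0 theta < 1 by rewrite gt_max ltr01.
have {Asp} : sparse_at A.
  move=> x n0 /Asp-/(_ n0)[n n0n /le_trans h]; exists n => //; apply: h.
  by rewrite lee_wpmul2r// lee_fin le_max lexx orbT.
have : 0 <= Num.max 0 theta by rewrite le_max lexx.
rewrite {}/sparse_at; move: (Num.max 0 theta) => th th0 Asp th1.
have fin B : B `<=` A -> (mu B < +oo)%E -> mu B = 0%E.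
  move=> BA Bfin.
  have fB : mu B \is a fin_num by rewrite ge0_fin_numE// lebesgue_outer_ge0.
  have : (0 <= mu B)%E by exact: lebesgue_outer_ge0.
  rewrite le_eqVlt => /predU1P[//|B0].
  have [b bE] : exists b, mu B = b%:E by exists (fine (mu B)); rewrite fineK.
  have b0 : 0 < b by rewrite -lte_fin -bE.
  have e0 : 0 < b * (1 - th) / 2 by rewrite divr_gt0// mulr_gt0 ?subr_gt0.
  have [U [mU BU Ule cU]] := outer_regular L0 Bfin e0.
  pose F := [set t : nat * 'rV[int]_d | cube L t.1 t.2 `<=` U /\
    (mu (B `&` cube L t.1 t.2) <= th%:E * mu (cube L t.1 t.2))%E].
  have BF : B `<=` cells_union L F.
    move=> x Bx; have [n0 n0P] := cU _ Bx.
    have [n n0n nP] := Asp x n0 (BA _ Bx).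
    exists (n, idx L n x) => //; split => /=; first exact: n0P.
    apply: le_trans nP; apply: mu_le; exact: setSI.
  have : (mu B <= th%:E * (mu B + (b * (1 - th) / 2)%:E))%E.
    rewrite -{1}(setIidl BF).
    apply: (@le_trans _ _ (th%:E * mu (cells_union L F))%E).
      by apply: mu_cells_union_le => // t [[]].
    rewrite lee_wpmul2l ?lee_fin//; apply: le_trans Ule.
    by apply: mu_le => x [t [tU _] /tU].
  rewrite bE -EFinD -EFinM lee_fin => h.
  have le_e : th * (b * (1 - th) / 2) <= b * (1 - th) / 2.
    by apply: ler_piMl; exact: ltW.
  by exfalso; move: h b0 e0 le_e; clear; lra.
(* A set of infinite measure is treated one top cube at a time. *)
pose E k := if pickle_inv k is Some m then A `&` cube L 0 m else set0.
apply/eqP; rewrite eq_le; apply/andP; split; last exact: lebesgue_outer_ge0.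
have AE : A `<=` \bigcup_k E k.
  by move=> x Ax; exists (pickle (idx L 0 x)) => //; rewrite /E pickleK_inv.
apply: (le_trans (mu_le AE)).
apply: (le_trans (mu_bigcup_le _)).
rewrite eseries0// => k _ _; rewrite /E; case: pickle_inv => [m|]; last first.
  by rewrite measure0.
apply: fin; first exact: subIsetl.
apply: (@le_lt_trans _ _ (mu (cube L 0 m))).
  by apply: mu_le; exact: subIsetr.
by rewrite lebesgue_cube// ltry.
Qed.

Lemma cell_in_cube L n m x : 0 < L -> cube L 0 m x -> cell L n x `<=` cube L 0 m.
Proof.
by move=> L0 <-; exact: cell_subset.
Qed.

End grid.

(** * Strongly measurable functions *)

Section strong_measurability.
Context (R : realType) (d' : nat) (E : normedModType R).
Local Notation d := d'.+1.
Local Notation pt := 'rV[R]_d.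
Local Notation mu := (lebesgue_rV R d).
Local Notation msets := (measurable : set (set (lebesgue_type R d))).
Implicit Types (f g h : pt -> E).

Lemma closure_distP (D : set E) (a : E) :
  closure D a <-> forall e : R, 0 < e -> exists2 c, D c & `|a - c| < e.
Proof.
split=> [cD e e0|H B /nbhs_ballP[e /= e0 eB]].
  by have [c [Dc ac]] := cD _ (nbhsx_ballx a e e0); exists c => //; rewrite -ball_normE in ac.
by have [c Dc ac] := H e e0; exists c; split => //; apply: eB; rewrite -ball_normE.
Qed.

(** A countable set whose closure contains [A] can be moved into [A]: replace
    its points by points of [A] nearby, one for each precision. *)
Lemma separable_setP (A : set E) :
  separable_set A <-> exists2 D, countable D & A `<=` closure D.
Proof.
split=> [[D [cD _ AD]]|[D cD AD]]; first by exists D.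
have inv0 k : 0 < (k.+1%:R : R)^-1 by rewrite invr_gt0 ltr0n.
pose near_pt (s : E * nat) : E :=
  if pselect (exists2 a, A a & `|a - s.1| < s.2.+1%:R^-1) is left P
  then projT1 (cid2 P) else 0.
pose D' := (near_pt @` (D `*` [set: nat])) `&` A.
exists D'; split.
- apply: (sub_countable (subset_card_le (@subIsetl _ _ _))).
  apply: (card_le_trans (card_image_le _ _)).
  by apply: countableX => //; exact: countableP.
- exact: subIsetr.
- move=> a Aa; apply/closure_distP => e e0.
  have [k _ ke] : exists2 k, True & 2 * (k.+1%:R : R)^-1 < e.
    have [k ke] := ltr_add_invr (divr_gt0 e0 (ltr0n _ 2)).
    exists k => //; move: ke; rewrite add0r => ke; rewrite mulrC -ltr_pdivlMr//.
  have [c Dc ac] := (closure_distP _ _).1 (AD _ Aa) _ (inv0 k).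
  have [Ab bc] : A (near_pt (c, k)) /\ `|near_pt (c, k) - c| < k.+1%:R^-1.
    rewrite /near_pt; case: pselect => [P|[]]; last by exists a.
    by case: cid2.
  exists (near_pt (c, k)); first by split => //; exists (c, k).
  apply: (le_lt_trans (ler_distD c _ _)); rewrite [X in _ + X]distrC.
  apply: (lt_trans (ltrD ac bc)).
  have -> : (k.+1%:R^-1 + k.+1%:R^-1 : R) = 2 / k.+1%:R.
    by rewrite (mulr_natl _ 2) mulr2n.
  exact: ke.
Qed.

Lemma borel_preimage f : (forall U : set E, open U -> msets (f @^-1` U)) ->
  forall B : set E, <<s open >> B -> msets (f @^-1` B).
Proof.
move=> fo B; apply: (@smallest_sub _ _ _ [set B | msets (f @^-1` B)]) => //.
split => [|A mA|F mF] /=; first by rewrite preimage_set0; exact: measurable0.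
  by rewrite setTD preimage_setC; exact: measurableC.
by rewrite preimage_bigcup; exact: bigcupT_measurable.
Qed.

Lemma strongly_measurableP f : strongly_measurable f <->
  (forall U : set E, open U -> msets (f @^-1` U)) /\
  (exists2 N : set pt, mu.-negligible N &
     exists2 D : set E, countable D & forall x, ~ N x -> closure D (f x)).
Proof.
split=> [[fB [N N0 /separable_setP[D cD ND]]]|[fo [N N0 [D cD ND]]]].
  split; first by move=> U oU; apply: fB; exact: sub_sigma_algebra.
  by exists N => //; exists D => // x Nx; apply: ND; exists x.
split; first exact: borel_preimage.
exists N => //; apply/separable_setP; exists D => // _ [x Nx <-]; exact: ND.
Qed.

(** The source of all measurability below: a cutoff, a step function, or a
    combination with a step function is given on each piece of a countable
    cover by a function already known to be strongly measurable. *)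
Lemma strongly_measurable_glue (A : nat -> set pt) (g : nat -> pt -> E) f :
  (forall n, msets (A n)) -> \bigcup_n A n = setT ->
  (forall n, strongly_measurable (g n)) ->
  (forall n x, A n x -> f x = g n x) -> strongly_measurable f.
Proof.
move=> mA AT /(_ _)/strongly_measurableP gm fg; apply/strongly_measurableP; split.
  move=> U oU; rewrite (_ : f @^-1` U = \bigcup_n (A n `&` g n @^-1` U)).
    by apply: bigcupT_measurable => n; apply: measurableI => //; apply: (gm n).1.
  apply/seteqP; split => [x Ux|x [n _ [Anx gx]]]; last by rewrite /= (fg n).
  have : (\bigcup_n A n) x by rewrite AT.
  by case=> n _ Anx; exists n => //; split => //=; rewrite -(fg n).
have /choice[N NP] n : exists N, mu.-negligible N /\
     exists2 D : set E, countable D & forall x, ~ N x -> closure D (g n x).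
  by have [_ [N]] := gm n; exists N.
have /choice[D DP] n : exists D, countable D /\ forall x, ~ N n x -> closure D (g n x).
  by have [_ [D]] := NP n; exists D.
exists (\bigcup_n N n); first by apply: negligible_bigcup => n; exact: (NP n).1.
exists (\bigcup_n D n); first by apply: bigcup_countable => // n _; exact: (DP n).1.
move=> x Nx; have : (\bigcup_n A n) x by rewrite AT.
case=> n _ Anx; rewrite (fg n)//.
apply: (closure_subset (A := D n)); first by move=> y; exists n.
by apply: (DP n).2 => Nnx; apply: Nx; exists n.
Qed.

Lemma strongly_measurable_comp (phi : E -> E) f :
  continuous phi -> strongly_measurable f -> strongly_measurable (phi \o f).
Proof.
move=> cphi /strongly_measurableP[fo [N N0 [D cD ND]]].
apply/strongly_measurableP; split.
  by move=> U oU; rewrite comp_preimage; apply: fo; exact: open_comp.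
exists N => //; exists (phi @` D).
  exact: card_le_trans (card_image_le _ _) cD.
move=> x /ND cx B /cphi /cx[y [Dy By]]; by exists (phi y); split => //; exists y.
Qed.

Lemma strongly_measurable_cst (v : E) : strongly_measurable (fun _ : pt => v).
Proof.
apply/strongly_measurableP; split.
  move=> U oU; have [Uv|Uv] := pselect (U v).
    by rewrite (_ : _ @^-1` _ = setT); [exact: measurableT|apply/seteqP; split].
  by rewrite (_ : _ @^-1` _ = set0); [exact: measurable0|apply/seteqP; split].
exists set0; first exact: negligible_set0.
exists [set v]; first exact: countable1.
by move=> x _; apply: subset_closure.
Qed.

Definition cutoff (A : set pt) f : pt -> E := fun x => if x \in A then f x else 0.

Lemma strongly_measurable_if (A : set pt) f g h : msets A ->
  strongly_measurable f -> strongly_measurable g ->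
  (forall x, A x -> h x = f x) -> (forall x, ~ A x -> h x = g x) ->
  strongly_measurable h.
Proof.
move=> mA mf mg hf hg.
apply: (@strongly_measurable_glue (fun n => if n == 0%N then A else ~` A)
  (fun n => if n == 0%N then f else g)).
- by case=> [|n] //=; exact: measurableC.
- apply/seteqP; split => // x _; have [Ax|nAx] := pselect (A x).
    by exists 0%N.
  by exists 1%N.
- by case.
- by case=> [|n] x /=; [exact: hf|exact: hg].
Qed.

Lemma strongly_measurable_cutoff A f : msets A ->
  strongly_measurable f -> strongly_measurable (cutoff A f).
Proof.
move=> mA mf; apply: (strongly_measurable_if mA mf (strongly_measurable_cst 0)).
  by move=> x Ax; rewrite /cutoff mem_set.
by move=> x Ax; rewrite /cutoff memNset.
Qed.

Definition step (X : Type) (L : R) (n : nat) (g : pt -> X) :=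
  forall x y, idx L n x = idx L n y -> g x = g y.

(** In a space that need not be separable a sum of Borel functions is
    delicate; with a step function as one argument it reduces on every cell
    to a continuous map of the other. *)
Lemma strongly_measurable_step_comb (X : Type) (L : R) n f (g : pt -> X)
    (phi : X -> E -> E) : 0 < L ->
  (forall v, continuous (phi v)) -> step L n g ->
  strongly_measurable f -> strongly_measurable (fun x => phi (g x) (f x)).
Proof.
move=> L0 cphi sg mf.
pose A k : set pt := if pickle_inv k is Some m then cube L n m else set0.
pose v k := if pickle_inv k is Some m then g (corner L n m) else g 0.
apply: (@strongly_measurable_glue A (fun k => phi (v k) \o f)).
- move=> k; rewrite /A; case: pickle_inv => [m|]; last exact: measurable0.
  exact: cube_measurable.
- apply/seteqP; split => // x _; exists (pickle (idx L n x)) => //.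
  by rewrite /A pickleK_inv.
- by move=> k; exact: strongly_measurable_comp.
- move=> k x; rewrite /A /v; case: pickle_inv => [m|] //= xm.
  by congr (phi _ _); apply: sg; rewrite xm (corner_cube n m L0).
Qed.

Lemma strongly_measurable_step (L : R) n g : 0 < L -> step L n g ->
  strongly_measurable g.
Proof.
move=> L0 sg; apply: (@strongly_measurable_step_comb E L n (fun=> 0) g (fun v _ => v)) => //.
  by move=> v; exact: cst_continuous.
exact: strongly_measurable_cst.
Qed.

Lemma measurable_norm_sub f (v : E) : strongly_measurable f ->
  measurable_fun [set: lebesgue_type R d] (fun x => `|f x - v|).
Proof.
move=> /strongly_measurableP[fo _].
move=> mT; apply: (measurability _ (RGenOInfty.measurableE R)) => //.
move=> _ [_ [a ->] <-]; rewrite setTI.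
have -> : (fun x => `|f x - v|) @^-1` `]a, +oo[%classic =
    f @^-1` [set w | a < `|w - v|].
  by apply/seteqP; split => x /=; rewrite in_itv/= andbT.
apply: fo.
have -> : [set w : E | a < `|w - v|] = (fun w => `|w - v|) @^-1` [set t | a < t].
  by [].
apply: open_comp; last exact: open_gt.
move=> w _; apply: cvg_norm.
by apply: cvgB; [exact: cvg_id|exact: cvg_cst].
Qed.

Lemma measurable_norm f : strongly_measurable f ->
  measurable_fun [set: lebesgue_type R d] (fun x => `|f x|).
Proof.
move=> /(measurable_norm_sub 0); apply: eq_measurable_fun => x _.
by rewrite subr0.
Qed.

End strong_measurability.

(** * Approximation by step functions *)

Section step_approximation.
Context (R : realType) (d' : nat) (E : normedModType R).
Local Notation d := d'.+1.
Local Notation pt := 'rV[R]_d.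
Local Notation mu := (lebesgue_rV R d).
Local Notation msets := (measurable : set (set (lebesgue_type R d))).
Implicit Types (f g h : pt -> E).

Lemma countable_range (D : set E) : countable D ->
  exists e : nat -> E, D `<=` range e.
Proof.
move=> /countable_bijP[B]; rewrite card_eq_sym => /card_set_bijP[e [_ _ eD]].
by exists e => x /eD[n _ <-]; exists n.
Qed.

Lemma lebesgue_cube_gt0 L n m : 0 < L -> (0 < mu (cube L n m))%E.
Proof. by move=> L0; rewrite lebesgue_cube// lte_fin exprn_gt0// side_gt0. Qed.

(** At almost every point of the cube, [h] is within [eta] of some fixed vector
    on most of a small cell around the point; finitely many generations of such
    cells already exhaust the cube up to measure [eta]. *)
Lemma step_approximation L (m0 : 'rV[int]_d) h (B eta : R) : 0 < L ->
  strongly_measurable h -> (forall x, `|h x| <= B) -> 0 < eta -> eta < 1 ->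
  exists n g, [/\ step L n g, forall x, ~ cube L 0 m0 x -> g x = 0,
    forall x, `|g x| <= B + eta &
    (mu [set x | cube L 0 m0 x /\ (eta < `|h x - g x|)%R]
       <= (2 * eta)%:E * mu (cube L 0 m0))%E].
Proof.
move=> L0 mh hB eta0 eta1; set Q := cube L 0 m0.
have B0 : 0 <= B := le_trans (normr_ge0 (h 0)) (hB 0).
have [_ [N N0 [D /countable_range[e De] ND]]] := (strongly_measurableP h).1 mh.
(* The balls around a dense sequence of values; a cell is good if one of them
   takes almost all of it. *)
pose A i : set pt := [set x | `|h x - e i| < eta].
have mA i : msets (A i).
  have -> : A i = (fun x => `|h x - e i|) @^-1` [set` `]-oo, eta[].
    by apply/seteqP; split => x; rewrite /A /= in_itv.
  rewrite -[X in measurable X]setTI.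
  exact: (measurable_norm_sub (e i) mh measurableT (measurable_itv _)).
pose good (t : nat * 'rV[int]_d) i :=
  (mu (cube L t.1 t.2 `\` A i) <= eta%:E * mu (cube L t.1 t.2))%E.
pose F := [set t | cube L t.1 t.2 `<=` Q /\ exists i, good t i].
have mQ : msets Q by exact: cube_measurable.
have QF : mu (Q `\` cells_union L F) = 0%E.
  pose Z i := (Q `\` cells_union L F) `&` A i.
  have QZ : Q `\` cells_union L F `<=` N `|` \bigcup_i Z i.
    move=> x QFx; have [Nx|/ND xD] := pselect (N x); first by left.
    have [_ /De[i _ <-] xi] := (closure_distP _ _).1 xD eta eta0.
    by right; exists i.
  apply/eqP; rewrite eq_le lebesgue_outer_ge0 andbT.
  apply: (le_trans (mu_le QZ)).
  apply: (le_trans (muU_le _ _)).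
  rewrite (negligible_mu0 N0) add0e.
  apply: (le_trans (mu_bigcup_le _)).
  rewrite eseries0// => i _ _.
  (* The value at [x] lies in the [i]-th ball, but no cell around [x] is
     good: the values in that ball take up at most [1 - eta] of each of these
     cells. *)
  apply: (@sparse_everywhere_null _ _ L _ (1 - eta)) => //; first by lra.
  move=> x n [[Qx nFx] Ax]; exists n => //; set P := cell L n x.
  have PQ : P `<=` Q.
    by move: (@cell_subset _ _ L n 0 x L0 (leq0n n)); rewrite /cell (Qx : idx L 0 x = m0).
  have nP : ~ good (n, idx L n x) i.
    by move=> xi; apply: nFx; exists (n, idx L n x) => //; split => //; exists i.
  move/negP: nP; rewrite -ltNge /= -/(cell L n x) -/P => nP.
  apply: (@le_trans _ _ (mu (P `&` A i))).
    by apply: mu_le => y [[_ ?] ?].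
  have mP : msets P by exact: cube_measurable.
  have := mu_splitD P (mA i).
  have finD : mu (P `\` A i) \is a fin_num.
    rewrite ge0_fin_numE//; apply: (le_lt_trans (mu_le (@subDsetl _ _ _))).
    by rewrite [X in (X < _)%E]lebesgue_cube// ltry.
  have finI : mu (P `&` A i) \is a fin_num.
    rewrite ge0_fin_numE//; apply: (le_lt_trans (mu_le (@subIsetl _ _ _))).
    by rewrite [X in (X < _)%E]lebesgue_cube// ltry.
  move: nP; rewrite -(fineK finD) -(fineK finI) [mu P]lebesgue_cube//.
  rewrite -EFinM -EFinD -EFinM lte_fin lee_fin => nP [].
  by move: nP; clear; lra.
have /choice[v vP] t : exists i, F t -> good t i.
  have [[_ [i it]]|nFt] := pselect (F t); first by exists i.
  by exists 0%N.
pose Fn n := F `&` [set t | (t.1 <= n)%N].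
have [n nP] : exists n, (mu (Q `\` cells_union L (Fn n)) <= eta%:E * mu Q)%E.
  apply: contrapT => /forallNP H.
  pose G n := Q `\` cells_union L (Fn n).
  have mG n : msets (G n) by apply: measurableD => //; exact: cells_union_measurable.
  have GE : \bigcap_n G n = Q `\` cells_union L F.
    apply/seteqP; split => [x Gx|x [Qx Fx] n _].
      split; first by have [] := Gx 0%N I.
      by move=> [t Ft tx]; have [_] := Gx t.1 I; apply; exists t => //; split => //=.
    by split => // -[t [Ft _] tx]; apply: Fx; exists t.
  have cG : mu (G n) @[n --> \oo] --> mu (\bigcap_n G n).
    apply: nonincreasing_cvg_mu => //.
    - apply: (le_lt_trans (mu_le (@subDsetl _ _ _))).
      by rewrite [X in (X < _)%E]lebesgue_cube// ltry.
    - by apply: bigcapT_measurable.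
    - move=> i j ij; apply/subsetPset => x [Qx Fx]; split => // -[t [Ft ti] tx].
      by apply: Fx; exists t => //; split => //; exact: leq_trans ij.
  have /negP[] : ~~ (eta%:E * mu Q <= mu (\bigcap_n G n))%E.
    rewrite GE QF -ltNge mule_gt0//; exact: lebesgue_cube_gt0.
  rewrite -(cvg_lim _ cG)//; apply: lime_ge; first by apply/cvg_ex; eexists; exact: cG.
  by apply: nearW => n; apply/ltW; rewrite ltNge; apply/negP; exact: H.
(* The value of [g] is read off the coarsest good cell around the point. *)
pose first x := find (fun k => `[< F (k, idx L k x) >]) (iota 0 n.+1).
pose g x := if (first x <= n)%N then e (v (first x, idx L (first x) x)) else 0.
have firstP x : (first x <= n)%N -> F (first x, idx L (first x) x).
  move=> xn; apply/asboolP; have : (first x < size (iota 0 n.+1))%N.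
    by rewrite size_iota.
  by rewrite -has_find => /(nth_find 0%N); rewrite nth_iota.
have first_step x y : idx L n x = idx L n y -> first x = first y.
  move=> xy; apply: eq_in_find => k; rewrite mem_iota /= add0n ltnS => kn.
  by rewrite (idx_le L0 kn xy).
have first_max x t : maximal_cells L (Fn n) t -> cube L t.1 t.2 x ->
    (first x <= n)%N /\ (first x, idx L (first x) x) = t.
  case: t => k m [[/= Fkm kn] kmax] /= xm.
  suff -> : first x = k by rewrite xm.
  apply/eqP; rewrite eqn_leq; apply/andP; split; rewrite leqNgt; apply/negP => kf.
    have := before_find 0%N kf; rewrite nth_iota// add0n xm.
    by move/negP; apply; apply/asboolP.
  have fn : (first x <= n)%N by exact: leq_trans (ltnW kf) kn.
  by case: (kmax x _ xm kf); split; [exact: firstP|].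
exists n, g; split.
- move=> x y xy; rewrite /g (first_step _ _ xy); case: ifP => // yn.
  by rewrite (idx_le L0 yn xy).
- move=> x nQx; rewrite /g; case: ifP => // /firstP[sub _].
  by exfalso; apply: nQx; apply: sub.
- move=> x; rewrite /g; case: ifP => [/firstP|_]; last first.
    by rewrite normr0 addr_ge0// ltW.
  set t := (_, _) => Ft.
  (* As [eta < 1], the cell contains a point where [h] is within [eta] of the
     value of [g], which bounds that value. *)
  have [y [_ Ay]] : (cube L t.1 t.2 `&` A (v t)) !=set0.
    apply/set0P/negP => /eqP tA0; have := vP _ Ft; rewrite /good.
    rewrite setDE (_ : _ `&` _ = cube L t.1 t.2); last first.
      apply/seteqP; split => [y []//|y ty]; split => // Ay.
      by have : (cube L t.1 t.2 `&` A (v t)) y by []; rewrite tA0.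
    rewrite lebesgue_cube// -EFinM lee_fin leNgt => /negP; apply.
    by rewrite gtr_pMl// exprn_gt0// side_gt0.
  rewrite -(subrK (h y) (e _)); apply: (le_trans (ler_normD _ _)).
  by rewrite addrC lerD// distrC ltW.
- set Z := [set x | _].
  have ZU : Z `<=` (Q `\` cells_union L (Fn n)) `|` (Z `&` cells_union L (Fn n)).
    move=> x [Qx zx]; have [Fx|Fx] := pselect (cells_union L (Fn n) x).
      by right.
    by left.
  apply: (le_trans (mu_le ZU)).
  apply: (le_trans (muU_le _ _)).
  rewrite mulrDl mul1r EFinD ge0_muleDl ?lee_fin ?(ltW eta0)//.
  apply: leeD; first exact: nP.
  apply: (@le_trans _ _ (eta%:E * mu (cells_union L (Fn n)))%E).
    apply: mu_cells_union_le => //; first exact: ltW.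
    move=> t tmax; apply: (le_trans _ (vP t _)).
      apply: mu_le => x [[Qx zx] tx]; split => //.
      have [xn xt] := first_max _ _ tmax tx.
      by move=> Ax; move: zx; rewrite /g xn xt ltNge ltW.
    by have [[]] := tmax.
  rewrite lee_wpmul2l ?lee_fin ?(ltW eta0)//.
  by apply: mu_le => x [t [[tQ _] _] /tQ].
Qed.

End step_approximation.

(** * Distances between Bochner integrals *)

Section bochner.
Context (R : realType) (d' : nat) (E : normedModType R).
Local Notation d := d'.+1.
Local Notation pt := 'rV[R]_d.
Local Notation mu := (lebesgue_rV R d).
Local Notation T := (lebesgue_type R d).
Local Notation msets := (measurable : set (set (lebesgue_type R d))).
Implicit Types (f g h : pt -> E) (s : seq (set pt * E)).

Lemma simple_val_cons (c : set pt * E) s x :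
  simple_val (c :: s) x = \1_(c.1) x *: c.2 + simple_val s x.
Proof. by rewrite /simple_val big_cons. Qed.

Lemma is_simple_cons (c : set pt * E) s : is_simple (c :: s) ->
  [/\ msets c.1, (mu c.1 < +oo)%E & is_simple s].
Proof.
move=> cs; have [mc cfin] := cs c (mem_head _ _).
by split => // c' c's; apply: cs; rewrite inE c's orbT.
Qed.

Lemma strongly_measurable_translate f (v : E) : strongly_measurable f ->
  strongly_measurable (fun x => f x + v).
Proof.
apply: (strongly_measurable_comp (phi := fun w => w + v)) => w.
by apply: cvgD; [exact: cvg_id|exact: cvg_cst].
Qed.

Lemma strongly_measurable_sub_simple f s : strongly_measurable f ->
  is_simple s -> strongly_measurable (fun x => f x - simple_val s x).
Proof.
elim: s f => [|c s IH] f mf.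
  move=> _; rewrite (_ : (fun x => _) = f)//; apply/funext => x.
  by rewrite /simple_val big_nil subr0.
move=> /is_simple_cons[mc _ ss].
rewrite (_ : (fun x => _) = (fun x => (f x - \1_(c.1) x *: c.2) - simple_val s x)).
  apply: IH => //; apply: (strongly_measurable_if mc
    (strongly_measurable_translate (- c.2) mf) mf) => x cx.
    by rewrite indicE mem_set//= scale1r.
  by rewrite indicE memNset//= scale0r subr0.
by apply/funext => x; rewrite simple_val_cons opprD addrA.
Qed.

Lemma strongly_measurable_simple s : is_simple s ->
  strongly_measurable (simple_val s).
Proof.
move=> ss; have := strongly_measurable_sub_simple (@strongly_measurable_cst R d' E 0) ss.
move/(strongly_measurable_comp (phi := -%R)) => H.
rewrite (_ : simple_val s = -%R \o (fun x => 0 - simple_val s x)).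
  by apply: H => v; exact: opp_continuous.
by apply/funext => x /=; rewrite sub0r opprK.
Qed.

Lemma measurable_norm_EFin f : strongly_measurable f ->
  measurable_fun [set: T] (fun x => `|f x|%:E).
Proof. by move=> mf; apply/measurable_EFinP; exact: measurable_norm. Qed.

Lemma fine_mu_splitD (A B : set pt) : msets A -> msets B -> (mu A < +oo)%E ->
  fine (mu A) = fine (mu (A `&` B)) + fine (mu (A `\` B)).
Proof.
move=> mA mB Afin; rewrite (mu_splitD A mB) addrC fineD//.
  by apply: mu_fin_num; exact: mu_lty_sub (@subIsetl _ _ _) Afin.
by apply: mu_fin_num; exact: mu_lty_sub (@subDsetl _ _ _) Afin.
Qed.

(** Induction on the list, cutting the domain by the first set: this reaches
    the atoms of the simple function without naming them. [w] is the sum of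
    the vectors of the sets that contain [D]. *)
Lemma norm_simple_integral_on s (w : E) (D : set pt) : is_simple s -> msets D ->
  (mu D < +oo)%E ->
  (`|fine (mu D) *: w + \sum_(c <- s) fine (mu (D `&` c.1)) *: c.2|%:E <=
   \int[mu]_(x in D) `|w + simple_val s x|%:E)%E.
Proof.
elim: s w D => [|c s IH] w D ss mD Dfin.
  rewrite big_nil addr0 normrZ ger0_norm ?fine_ge0//.
  under eq_integral do rewrite /simple_val big_nil addr0.
  rewrite integral_cst// EFinM fineK ?ge0_fin_numE//.
  by rewrite muleC.
have [mc cfin ss'] := is_simple_cons ss.
set D1 := D `&` c.1; set D2 := D `\` c.1.
have mD1 : msets D1 by exact: measurableI.
have mD2 : msets D2 by exact: measurableD.
have D1fin : (mu D1 < +oo)%E by exact: mu_lty_sub (@subIsetl _ _ _) Dfin.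
have D2fin : (mu D2 < +oo)%E by exact: mu_lty_sub (@subDsetl _ _ _) Dfin.
have -> : fine (mu D) *: w + \sum_(b <- c :: s) fine (mu (D `&` b.1)) *: b.2 =
    (fine (mu D1) *: (w + c.2) + \sum_(b <- s) fine (mu (D1 `&` b.1)) *: b.2) +
    (fine (mu D2) *: w + \sum_(b <- s) fine (mu (D2 `&` b.1)) *: b.2).
  rewrite big_cons -/D1 (fine_mu_splitD mD mc Dfin) -/D1 -/D2.
  have -> : \sum_(b <- s) fine (mu (D `&` b.1)) *: b.2 =
     \sum_(b <- s) fine (mu (D1 `&` b.1)) *: b.2 +
     \sum_(b <- s) fine (mu (D2 `&` b.1)) *: b.2.
    rewrite -big_split/= big_seq [RHS]big_seq; apply: eq_bigr => b bs.
    have [mb bfin] := ss' b bs.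
    rewrite -scalerDl -(setIAC D) -(_ : (D `&` b.1) `\` c.1 = D2 `&` b.1).
      rewrite -fine_mu_splitD//; first exact: measurableI.
      exact: mu_lty_sub (@subIsetl _ _ _) Dfin.
    by rewrite /D2 !setDE setIAC.
  rewrite scalerDl scalerDr -!addrA; congr (_ + _).
  rewrite [LHS]addrCA; congr (_ + _); rewrite addrCA; congr (_ + _).
apply: (@le_trans _ _ (\int[mu]_(x in D1) `|(w + c.2) + simple_val s x|%:E +
    \int[mu]_(x in D2) `|w + simple_val s x|%:E)%E).
  apply: (le_trans _ (leeD (IH _ _ ss' mD1 D1fin) (IH _ _ ss' mD2 D2fin))).
  by rewrite -EFinD lee_fin ler_normD.
rewrite -[X in (_ <= \int[_]_(x in X) _)%E](setUIDK D c.1) -/D1 -/D2.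
rewrite (ge0_integral_setU mu mD1 mD2) => [|| // |]; last 2 first.
- apply: measurable_funTS; apply: measurable_norm_EFin.
  under eq_fun do rewrite addrC.
  by apply: strongly_measurable_translate; exact: strongly_measurable_simple.
- by apply/disj_setPS => x [[_ ?] [_]].
rewrite le_eqVlt; apply/orP; left; apply/eqP; congr (_ + _)%E.
  apply: eq_integral => x; rewrite inE => -[_ cx].
  by rewrite simple_val_cons indicE mem_set//= scale1r addrA.
apply: eq_integral => x; rewrite inE => -[_ cx].
by rewrite simple_val_cons indicE memNset//= scale0r add0r.
Qed.

Lemma norm_simple_integral s : is_simple s ->
  (`|simple_integral s|%:E <= \int[mu]_x `|simple_val s x|%:E)%E.
Proof.
move=> ss.
have [D [mD Dfin sD]] : exists D, [/\ msets D, (mu D < +oo)%E &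
    forall c, c \in s -> c.1 `<=` D].
  elim: s ss => [_|c s IH /is_simple_cons[mc cfin /IH[D [mD Dfin sD]]]].
    by exists set0; split => //; rewrite measure0.
  exists (c.1 `|` D); split; first exact: measurableU.
    by apply: (le_lt_trans (muU_le _ _)); exact: lte_add_pinfty.
  by move=> b; rewrite inE => /predU1P[-> x|/sD bD x /bD]; [left|right].
apply: (@le_trans _ _ (\int[mu]_(x in D) `|0 + simple_val s x|%:E)%E).
  apply: le_trans (norm_simple_integral_on 0 ss mD Dfin).
  rewrite scaler0 add0r le_eqVlt; apply/orP; left; apply/eqP.
  congr (`|_|%:E); rewrite /simple_integral big_seq [RHS]big_seq.
  by apply: eq_bigr => c /sD cD; rewrite setIidr.
under eq_integral do rewrite add0r.
apply: (ge0_subset_integral mu mD measurableT) => [|x _|x _].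
- by apply: measurable_norm_EFin; exact: strongly_measurable_simple.
- by rewrite lee_fin.
- by [].
Qed.

(** What [bochner_dist_le] takes from a Bochner integral: simple integrals
    converge to it, and the distances to the simple functions are measurable
    with integrals tending to zero. *)
Definition bochner_approx f (v : E) := exists s : nat -> seq (set pt * E),
  [/\ forall n, is_simple (s n),
      forall n, measurable_fun [set: T] (fun x => `|f x - simple_val (s n) x|%:E),
      (fun n => (\int[mu]_x `|f x - simple_val (s n) x|%:E)%E) @ \oo --> 0%E &
      (fun n => simple_integral (s n)) @ \oo --> v].

Lemma bochner_approx_integral f v : has_bochner_integral f v -> bochner_approx f v.
Proof.
move=> [mf [s [ss s0 sv]]]; exists s; split; [exact: ss| |exact: s0|exact: sv].
move=> n.
by apply: measurable_norm_EFin; exact: strongly_measurable_sub_simple.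
Qed.

Lemma bochner_approx_simple s : is_simple s ->
  bochner_approx (simple_val s) (simple_integral s).
Proof.
move=> ss; exists (fun=> s); split; [by []| | |exact: cvg_cst].
  by move=> _; under eq_fun do rewrite subrr normr0; exact: measurable_cst.
apply: cvg_near_cst; apply: nearW => _.
by under eq_integral do rewrite subrr normr0; exact: integral0.
Qed.

(** The approximating simple functions are subtracted, as lists, and
    [norm_simple_integral] applies to the difference: the estimate is one for
    finite sums. *)
Lemma bochner_dist_le f g v w (G : pt -> \bar R) :
  bochner_approx f v -> bochner_approx g w -> measurable_fun [set: T] G ->
  (forall x, `|f x - g x|%:E <= G x)%E ->
  (`|v - w|%:E <= \int[mu]_x G x)%E.
Proof.
move=> [s [ss ms s0 sv]] [t [st mt t0 tw]] mG fgG.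
have G0 x : (0 <= G x)%E by apply: le_trans (fgG x); rewrite lee_fin.
have H n : (`|simple_integral (s n) - simple_integral (t n)|%:E <=
    \int[mu]_x `|f x - simple_val (s n) x|%:E +
    \int[mu]_x `|g x - simple_val (t n) x|%:E + \int[mu]_x G x)%E.
  pose r := s n ++ [seq (c.1, - c.2) | c <- t n].
  have sr : is_simple r.
    move=> c; rewrite mem_cat => /orP[/ss//|/mapP[b /st bt ->]//].
  have rv x : simple_val r x = simple_val (s n) x - simple_val (t n) x.
    rewrite /simple_val big_cat big_map/= -sumrN; congr (_ + _).
    by apply: eq_bigr => c _; rewrite scalerN.
  have -> : simple_integral (s n) - simple_integral (t n) = simple_integral r.
    rewrite /simple_integral big_cat big_map/= -sumrN; congr (_ + _).
    by apply: eq_bigr => c _; rewrite scalerN.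
  apply: (le_trans (norm_simple_integral sr)).
  have n0 (u : pt -> E) x : [set: T] x -> (0 <= `|u x|%:E)%E by rewrite lee_fin.
  rewrite -(ge0_integralD mu measurableT (n0 _) (ms n) (n0 _) (mt n)).
  have mst := emeasurable_funD (ms n) (mt n).
  rewrite -(ge0_integralD mu measurableT _ mst (fun x _ => G0 x) mG); last first.
    by move=> x _; rewrite adde_ge0 ?lee_fin.
  apply: (ge0_le_integral mu measurableT (n0 _)).
  - by apply: measurable_norm_EFin; exact: strongly_measurable_simple.
  - exact: emeasurable_funD.
  move=> x _; rewrite rv.
  apply: (@le_trans _ _ ((`|f x - simple_val (s n) x| +
     `|g x - simple_val (t n) x|)%:E + `|f x - g x|%:E)%E).
    rewrite -EFinD lee_fin.
    have -> : simple_val (s n) x - simple_val (t n) x =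
      - (f x - simple_val (s n) x) + (g x - simple_val (t n) x) + (f x - g x).
      by rewrite opprB [X in _ = X + _]addrC -[RHS]addrA subrKA [RHS]addrC subrKA.
    apply: (le_trans (ler_normD _ _)); rewrite lerD2r.
    by apply: (le_trans (ler_normD _ _)); rewrite normrN.
  by rewrite EFinD leeD2l.
have cl : (fun n => `|simple_integral (s n) - simple_integral (t n)|%:E) @ \oo
    --> `|v - w|%:E.
  by apply: cvg_EFin; [exact: nearW|]; apply: cvg_norm; apply: cvgB.
have cr : (fun n => \int[mu]_x `|f x - simple_val (s n) x|%:E +
    \int[mu]_x `|g x - simple_val (t n) x|%:E + \int[mu]_x G x)%E @ \oo
    --> (0 + 0 + \int[mu]_x G x)%E.
  apply: cvgeD; first by rewrite add0e; apply: fin_num_adde_defr.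
    by apply: cvgeD.
  exact: cvg_cst.
rewrite -[leRHS]add0e -{1}(adde0 0%E).
by apply: (lee_cvg_to cl cr); exact: nearW.
Qed.

End bochner.

(** * Dilates of a cube *)

Section euclidean_norm.
Context (R : realType) (d : nat).
Implicit Types z : 'rV[R]_d.

Lemma enormN z : enorm (- z) = enorm z.
Proof.
by rewrite /enorm; congr Num.sqrt; apply: eq_bigr => i _; rewrite mxE sqrrN.
Qed.

Lemma enorm_distC (x y : 'rV[R]_d) : enorm (x - y) = enorm (y - x).
Proof. by rewrite -enormN opprB. Qed.

Lemma enorm_ge_coord z i : `|z ord0 i| <= enorm z.
Proof.
rewrite /enorm -sqrtr_sqr; apply: ler_wsqrtr.
rewrite (bigD1 i)//= lerDl; apply: sumr_ge0 => j _; exact: sqr_ge0.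
Qed.

Lemma enorm_le_sum z : enorm z <= \sum_(i < d) `|z ord0 i|.
Proof.
have s0 : 0 <= \sum_(i < d) `|z ord0 i| by apply: sumr_ge0.
rewrite -[leRHS](ger0_norm s0) -sqrtr_sqr; apply: ler_wsqrtr.
rewrite expr2 mulr_suml; apply: ler_sum => i _.
rewrite -real_normK ?num_real// expr2; apply: ler_wpM2l => //.
by rewrite (bigD1 i)//= lerDl; apply: sumr_ge0.
Qed.

Lemma enorm_le_coord z (c : R) : (forall i, `|z ord0 i| <= c) ->
  enorm z <= d%:R * c.
Proof.
move=> zc; apply: (le_trans (enorm_le_sum z)).
apply: (@le_trans _ _ (\sum_(i < d) c)); first by apply: ler_sum => i _.
by rewrite sumr_const card_ord mulr_natl.
Qed.

Lemma enorm_gt0 z : z != 0 -> 0 < enorm z.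
Proof.
move=> z0; have [i zi] : exists i, z ord0 i != 0.
  apply/existsP; apply: contraNT z0; rewrite negb_exists => /forallP h.
  by apply/eqP/rowP => i; rewrite mxE; apply/eqP; have := h i; rewrite negbK.
by apply: lt_le_trans (enorm_ge_coord z i); rewrite normr_gt0.
Qed.

End euclidean_norm.

Section dilates.
Context (R : realType) (d' : nat).
Local Notation d := d'.+1.
Local Notation pt := 'rV[R]_d.
Local Notation mu := (lebesgue_rV R d).
Local Notation msets := (measurable : set (set (lebesgue_type R d))).
Implicit Types (a x y : pt) (l : R).

(** With [r = 0] this is the half-open cube itself, so cubes of all grids and
    their dilates are measured once. *)
Definition fattened a l (r : R) : set pt :=
  [set y | forall i, a ord0 i - r <= y ord0 i < a ord0 i + l + r].

(** The dilates have side [(1 + 2 ^+ k.+1) * l]: the tripled cube for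
    [k = 0], and comparable to [2 ^+ k * l] in general. *)
Definition dilate a l (k : nat) : set pt := fattened a l (2 ^+ k * l).

Lemma fattened_box a l r : fattened a l r =
  box (\row_i (a ord0 i - r), \row_i (a ord0 i + l + r)).
Proof. by apply/seteqP; split => y h i; have := h i; rewrite !mxE. Qed.

Lemma fattened_measurable a l r : msets (fattened a l r).
Proof. by rewrite fattened_box; exact: box_measurable. Qed.

Lemma lebesgue_fattened a l r : 0 <= l + r + r ->
  mu (fattened a l r) = ((l + r + r) ^+ d)%:E.
Proof.
move=> lr0; rewrite fattened_box lebesgue_box; congr (_%:E).
rewrite /box_volume -[d in RHS]card_ord -prodr_const; apply: eq_bigr => i _.
rewrite !mxE (_ : _ - _ = l + r + r); last by lra.
by rewrite /Num.max; case: ltgtP lr0.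
Qed.

Lemma cube_fattened L n m : 0 < L -> cube L n m = fattened (corner L n m) (side L n) 0.
Proof.
move=> L0; apply/seteqP; split => [x /(cubeP _ _ _ L0) h i|x h].
  by rewrite subr0 addr0; exact: h.
by apply/(cubeP _ _ _ L0) => i; have := h i; rewrite subr0 addr0.
Qed.

Lemma fattened_sub a l r r' : r <= r' -> fattened a l r `<=` fattened a l r'.
Proof.
move=> rr' y h i; have /andP[h1 h2] := h i; apply/andP; split.
  by apply: le_trans h1; rewrite lerD2l lerN2.
by apply: (lt_le_trans h2); rewrite lerD2l.
Qed.

Lemma lebesgue_dilate_le a l k : 0 < l ->
  (mu (dilate a l k) <= ((3 * (2 ^+ k * l)) ^+ d)%:E)%E.
Proof.
move=> l0; have e1 : 1 <= 2 ^+ k :> R by apply: exprn_ege1; rewrite ler1n.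
have le : l <= 2 ^+ k * l by rewrite ler_peMl// ltW.
rewrite lebesgue_fattened; last by lra.
rewrite lee_fin lerXn2r ?nnegrE//; lra.
Qed.

Definition decay (alpha : R) : R := 2 `^ (- alpha).

Lemma decayX (alpha : R) (k : nat) : 2 `^ (- (alpha * k%:R)) = decay alpha ^+ k.
Proof. by rewrite /decay -powR_mulrn ?powR_ge0// -powRrM mulNr. Qed.

Definition dilate_weight (alpha l : R) (k : nat) : R :=
  decay alpha ^+ k * (2 ^+ k * l) ^- d.

(** Majorant, up to a constant, of the variation over the cube of a singular
    kernel; its value is comparable to the decay of the Hoelder bound,
    because the dilates that contain [y] begin at its distance from the cube. *)
Definition weighted_dilates (alpha : R) a l (y : pt) : \bar R :=
  (\sum_(k <oo) (dilate_weight alpha l k * \1_(dilate a l k) y)%:E)%E.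

Lemma dilate_weight_ge0 alpha l k : 0 < l -> 0 <= dilate_weight alpha l k.
Proof.
move=> l0; rewrite mulr_ge0// ?exprn_ge0 ?powR_ge0// invr_ge0 exprn_ge0//.
by rewrite mulr_ge0 ?exprn_ge0 ?ltW.
Qed.

Lemma weighted_term_ge0 alpha a l k y : 0 < l ->
  (0 <= (dilate_weight alpha l k * \1_(dilate a l k) y)%:E)%E.
Proof. by move=> l0; rewrite lee_fin mulr_ge0// dilate_weight_ge0. Qed.

Lemma weighted_term_measurable alpha a l k : measurable_fun [set: lebesgue_type R d]
  (fun y => (dilate_weight alpha l k * \1_(dilate a l k) y)%:E).
Proof.
apply/measurable_EFinP; apply: measurable_funM; first exact: measurable_cst.
by apply: measurable_indic; exact: fattened_measurable.
Qed.

Lemma weighted_dilates_measurable alpha a l : 0 < l ->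
  measurable_fun [set: lebesgue_type R d] (weighted_dilates alpha a l).
Proof.
move=> l0; apply: ge0_emeasurable_sum => [k y _ _|k _].
  exact: weighted_term_ge0.
exact: weighted_term_measurable.
Qed.

Lemma weighted_dilates_ge0 alpha a l y : 0 < l ->
  (0 <= weighted_dilates alpha a l y)%E.
Proof. by move=> l0; apply: nneseries_ge0 => k _ _; exact: weighted_term_ge0. Qed.

(** The lower bound, where [alpha <= 1] enters, lets the size bound of a
    kernel replace its Hoelder bound at the first few scales in
    [kernel_oscillation]. *)
Lemma decay_bounds alpha : 0 < alpha <= 1 -> 2^-1 <= decay alpha < 1.
Proof.
move=> /andP[a0 a1]; rewrite /decay; apply/andP; split.
  rewrite -[leLHS]powR_inv1//; apply: ler_powR; last by rewrite lerN2.
  by rewrite ler1n.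
rewrite powRN invf_lt1 ?powR_gt0//.
have /(_ 1 2) := gt0_ltr_powR a0; rewrite !nnegrE ler01 ler0n => /(_ isT isT).
by rewrite powR1; apply; rewrite ltr1n.
Qed.

Lemma geometric_nneseries_le (q : R) : 0 < q < 1 ->
  (\sum_(k <oo) (q ^+ k)%:E <= ((1 - q)^-1)%:E)%E.
Proof.
move=> /andP[q0 q1]; apply: lime_le.
  by apply: is_cvg_nneseries => k _ _; rewrite lee_fin exprn_ge0// ltW.
apply: nearW => n; rewrite sumEFin lee_fin.
have nq : `|q| < 1 by rewrite ger0_norm// ltW.
have := @geometric_le_lim R n 1 q ler01 q0 nq; rewrite [X in _ <= X]mul1r.
apply: le_trans; rewrite /series /= le_eqVlt; apply/orP; left; apply/eqP.
by apply: eq_bigr => k _; rewrite /= mul1r.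
Qed.

(** The [k]-th dilate has side at most [3 * (2 ^+ k * l)], so the [k]-th term
    integrates to at most [3 ^+ d * decay alpha ^+ k]. *)
Lemma integral_weighted_dilates alpha a l : 0 < alpha <= 1 -> 0 < l ->
  (\int[mu]_y weighted_dilates alpha a l y <= (3 ^+ d * (1 - decay alpha)^-1)%:E)%E.
Proof.
move=> alpha01 l0; have /andP[q2 q1] := decay_bounds alpha01.
have q0 : 0 < decay alpha by apply: lt_le_trans q2; rewrite invr_gt0.
rewrite integral_nneseries; last 3 first.
- exact: measurableT.
- by move=> k; exact: weighted_term_measurable.
- by move=> k y _; exact: weighted_term_ge0.
apply: (@le_trans _ _ (\sum_(k <oo) ((3 ^+ d)%:E * (decay alpha ^+ k)%:E))%E).
  apply: lee_nneseries => k _.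
    by move=> _; apply: integral_ge0 => y _; exact: weighted_term_ge0.
  under eq_integral do rewrite EFinM.
  rewrite ge0_integralZl_EFin; last 4 first.
  - exact: measurableT.
  - by move=> y _; rewrite lee_fin.
  - by apply/measurable_EFinP; apply: measurable_indic; exact: fattened_measurable.
  - exact: dilate_weight_ge0.
  rewrite integral_indic//; last exact: fattened_measurable.
  rewrite setIT; apply: (@le_trans _ _ ((dilate_weight alpha l k)%:E *
      ((3 * (2 ^+ k * l)) ^+ d)%:E)%E).
    rewrite lee_wpmul2l ?lee_fin ?dilate_weight_ge0//.
    exact: lebesgue_dilate_le.
  rewrite -!EFinM lee_fin /dilate_weight.
  have : 2 ^+ k * l != 0 by rewrite mulf_neq0 ?expf_neq0//= lt0r_neq0.
  move: (2 ^+ k * l) => t t0.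
  by rewrite exprMn mulrCA -mulrA mulVf ?mulr1// expf_neq0.
rewrite nneseriesZl; last by move=> k _; rewrite lee_fin exprn_ge0// ltW.
by rewrite EFinM lee_wpmul2l ?lee_fin ?exprn_ge0// geometric_nneseries_le// q0.
Qed.

End dilates.

(** * Oscillation of a singular kernel *)

Section kernel.
Context (R : realType) (d' : nat) (E : normedModType R).
Local Notation d := d'.+1.
Local Notation pt := 'rV[R]_d.
Implicit Types (a x y : pt) (l : R).

Lemma opnorm_le_norm (A : E -> E) (c : R) : (forall r v, A (r *: v) = r *: A v) ->
  (opnorm A <= c%:E)%E -> forall v, `|A v| <= c * `|v|.
Proof.
move=> Ahom Ac v; have [->|v0] := eqVneq v 0.
  by rewrite -(scale0r 0) Ahom !scale0r !normr0 mulr0.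
have nv : 0 < `|v| by rewrite normr_gt0.
have : (`|A (`|v|^-1 *: v)|%:E <= opnorm A)%E.
  apply: ereal_sup_ubound; exists (`|v|^-1 *: v) => //=.
  by rewrite normrZ normfV normr_id mulVf ?lexx// gt_eqF.
move=> /le_trans/(_ Ac); rewrite Ahom normrZ normfV normr_id lee_fin.
by rewrite mulrC ler_pdivrMr.
Qed.

(** The bounds on a singular kernel that involve variation in the first
    variable only; a singular kernel and its transpose both satisfy them. *)
Definition regular_kernel (alpha c : R) (K : pt -> pt -> E -> E) : Prop :=
  (forall x y v, x != y -> `|K x y v| <= c * enorm (x - y) ^- d * `|v|) /\
  (forall x x' y v, 0 < enorm (x - x') < 2^-1 * enorm (x - y) ->
     `|K x y v - K x' y v| <= c * (enorm (x - x') / enorm (x - y)) `^ alpha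
        * enorm (x - y) ^- d * `|v|).

Lemma singular_kernel_regular (alpha CK : R) (K : pt -> pt -> {linear E -> E}) :
  singular_kernel alpha CK K ->
  regular_kernel alpha `|CK| (fun x y => K x y) /\
  regular_kernel alpha `|CK| (fun x y => K y x).
Proof.
move=> [_ Ksize Kx Ky].
have size x y v : x != y -> `|K x y v| <= `|CK| * enorm (x - y) ^- d * `|v|.
  move=> xy; apply: opnorm_le_norm; first by move=> r w; rewrite linearZ.
  apply: (le_trans (Ksize x y xy)); rewrite lee_fin ler_wpM2r ?ler_norm//.
  by rewrite invr_ge0 exprn_ge0// /enorm sqrtr_ge0.
have e0 (z : pt) : 0 <= enorm z ^- d by rewrite invr_ge0 exprn_ge0// /enorm sqrtr_ge0.
split; split => //.
- move=> x x' y v xx'.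
  apply: (opnorm_le_norm (A := fun v => K x y v - K x' y v)).
    by move=> r w; rewrite !linearZZ -scalerDr.
  apply: (le_trans (Kx x x' y xx')); rewrite lee_fin ler_wpM2r//.
  by rewrite ler_wpM2r ?powR_ge0// ler_norm.
- by move=> x y v xy; rewrite enorm_distC; apply: size; rewrite eq_sym.
- move=> x x' y v; rewrite (enorm_distC x y) => xx'.
  apply: (opnorm_le_norm (A := fun v => K y x v - K y x' v)).
    by move=> r w; rewrite !linearZZ -scalerDr.
  apply: (le_trans (Ky y x x' xx')); rewrite lee_fin ler_wpM2r//.
  by rewrite ler_wpM2r ?powR_ge0// ler_norm.
Qed.

(** Between consecutive dilates [y] is at distance about [2 ^ k * l] from the
    cube: the Hoelder bound applies unless [2 ^ k] is at most of order [d], and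
    then the size bound is as good. *)
Lemma kernel_oscillation (alpha c : R) (K : pt -> pt -> E -> E) a l x x' y v :
  0 < alpha <= 1 -> 0 <= c -> regular_kernel alpha c K -> 0 < l ->
  fattened a l 0 x -> fattened a l 0 x' -> ~ dilate a l 0 y ->
  (`|K x y v - K x' y v|%:E <=
   (c * 2 ^+ d * (8 * d%:R))%:E * weighted_dilates alpha a l y * `|v|%:E)%E.
Proof.
move=> alpha01 c0 [Ksize Kreg] l0 Qx Qx' yQ.
have /andP[q2 q1] := decay_bounds alpha01; set q := decay alpha in q2 q1 *.
have q0 : 0 < q by apply: lt_le_trans q2; rewrite invr_gt0.
have d1 : (1 : R) <= d%:R by rewrite ler1n.
have ex : exists k, `[< dilate a l k y >].
  pose M := \sum_i `|y ord0 i - a ord0 i|.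
  pose k := (Num.Def.truncn (M / l)).+1.
  exists k; apply/asboolP => i; have Mk : M < 2 ^+ k * l.
    rewrite -ltr_pdivrMr//; apply: (lt_trans (truncnS_gt _)).
    by rewrite -natrX ltr_nat ltn_expl.
  have yM : `|y ord0 i - a ord0 i| <= M.
    by rewrite /M (bigD1 i)//= lerDl; apply: sumr_ge0.
  move: (le_lt_trans yM Mk); rewrite ltr_norml => /andP[].
  move: l0; move: (2 ^+ k * l) (y ord0 i) (a ord0 i) => u v1 v2; clear.
  by move=> *; apply/andP; split; lra.
(* The dilate of index [j.+1] is the first that contains [y], so
   [rho = 2 ^ j * l] is comparable to the distance from [y] to the cube. *)
case: (ex_minnP ex) => -[|j] /asboolP yj jmin; first by [].
have yNj : ~ dilate a l j y.
  by move=> /asboolP/jmin; rewrite ltnn.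
set rho := 2 ^+ j * l.
have rho0 : 0 < rho by rewrite mulr_gt0// exprn_gt0.
have far z : fattened a l 0 z -> rho <= enorm (z - y).
  move=> Qz; have [i yi] : exists i,
      ~ (a ord0 i - rho <= y ord0 i < a ord0 i + l + rho).
    by apply/existsNP.
  apply: le_trans (enorm_ge_coord (z - y) i); rewrite !mxE.
  have /andP := Qz i; move/negP: yi; rewrite negb_and -ltNge -leNgt subr0 addr0.
  move=> yi [z1 z2]; case/orP : yi => yi; rewrite ler_normr; apply/orP; [left|right]; lra.
have term : ((dilate_weight d' alpha l j.+1)%:E <= weighted_dilates alpha a l y)%E.
  rewrite /weighted_dilates (@nneseriesD1 _ _ j.+1)//; last first.
    by move=> k _; exact: weighted_term_ge0.
  rewrite indicE mem_set// mulr1 leeDl//.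
  by apply: nneseries_ge0 => k _ _; exact: weighted_term_ge0.
have wE : dilate_weight d' alpha l j.+1 = q ^+ j.+1 * 2 ^- d * rho ^- d.
  by rewrite /dilate_weight (exprS 2 j) -(mulrA 2) -/rho exprMn invfM mulrA.
have xne z : fattened a l 0 z -> z != y.
  move=> /far zf; apply/eqP => zy; move: zf; rewrite zy subrr /enorm big1.
    by rewrite sqrtr0 leNgt rho0.
  by move=> i _; rewrite mxE expr0n.
have inv_rho z : fattened a l 0 z -> enorm (z - y) ^- d <= rho ^- d.
  move=> /far zy; have ez0 := lt_le_trans rho0 zy.
  by rewrite lef_pV2 ?posrE ?exprn_gt0// lerXn2r ?nnegrE// ltW.
suff main : `|K x y v - K x' y v| <=
    c * (8 * d%:R) * (q ^+ j.+1 * rho ^- d) * `|v|.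
  apply: (@le_trans _ _ ((c * 2 ^+ d * (8 * d%:R))%:E *
      (dilate_weight d' alpha l j.+1)%:E * `|v|%:E)%E); last first.
    rewrite lee_wpmul2r ?lee_fin// lee_wpmul2l// lee_fin.
    by rewrite mulr_ge0 ?mulr_ge0// exprn_ge0.
  rewrite -!EFinM lee_fin; apply: (le_trans main).
  rewrite wE le_eqVlt; apply/orP; left; apply/eqP; congr (_ * _).
  have : (2 ^+ d : R) != 0 by rewrite expf_neq0.
  move: (2 ^+ d) (rho ^- d) (q ^+ j.+1) (d%:R : R) => u r1 r2 r3 u0.
  by field.
have [->|xx'] := eqVneq x x'.
  rewrite subrr normr0 !mulr_ge0// ?exprn_ge0 ?(ltW q0)//.
  by rewrite invr_ge0 exprn_ge0 ?ltW.
have exx' : enorm (x - x') <= d%:R * l.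
  apply: enorm_le_coord => i; rewrite !mxE.
  move/andP: (Qx i) => []; move/andP: (Qx' i) => [].
  by rewrite subr0 addr0 ler_norml => ? ? ? ?; apply/andP; split; lra.
(* [d * l] bounds the diameter of the cube: the Hoelder bound applies when
   this is below [rho / 2]. *)
have [dj|jd] := ltP (2 * d%:R : R) (2 ^+ j).
  have ey := far x Qx.
  have cond : 0 < enorm (x - x') < 2^-1 * enorm (x - y).
    rewrite enorm_gt0 ?subr_eq0//=; apply: (le_lt_trans exx').
    apply: (@lt_le_trans _ _ (2^-1 * rho)); last by rewrite ler_wpM2l.
    rewrite /rho mulrA ltr_pM2r//; lra.
  apply: (le_trans (Kreg x x' y v cond)); rewrite ler_wpM2r// -!mulrA.
  rewrite ler_wpM2l// mulrA [X in _ <= X](_ : _ = (8 * d%:R * q ^+ j.+1) * rho ^- d);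
    last by rewrite !mulrA.
  apply: ler_pM; rewrite ?powR_ge0//; first by rewrite invr_ge0 exprn_ge0// /enorm sqrtr_ge0.
    have twoE : (2 ^+ j.+1 : R)^-1 `^ alpha = q ^+ j.+1.
      rewrite -decayX -powR_mulrn// -powRN -powRrM; congr (_ `^ _).
      by rewrite mulNr mulrC.
    apply: (@le_trans _ _ (((2 * d%:R) * (2 ^+ j.+1)^-1) `^ alpha)).
      apply: ge0_ler_powR; rewrite ?nnegrE.
      - by case/andP: alpha01 => /ltW.
      - by rewrite divr_ge0// /enorm sqrtr_ge0.
      - by rewrite divr_ge0.
      rewrite ler_pdivrMr; last exact: lt_le_trans ey.
      apply: (le_trans exx').
      apply: (@le_trans _ _ (2 * d%:R * (2 ^+ j.+1)^-1 * rho)); last first.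
        by rewrite ler_wpM2l// divr_ge0.
      rewrite /rho exprS le_eqVlt; apply/orP; left; apply/eqP.
      have : (2 ^+ j : R) != 0 by rewrite expf_neq0.
      by move: (2 ^+ j) => u u0; field.
    rewrite powRM// twoE ler_wpM2r ?exprn_ge0 ?(ltW q0)//.
    apply: (@le_trans _ _ (2 * d%:R)); last by rewrite ler_wpM2r// ler_nat.
    rewrite -[leRHS]powRr1//; apply: ler_powR; last by case/andP: alpha01.
    lra.
  exact: inv_rho.
apply: (le_trans (ler_normB _ _)).
have Kb z : fattened a l 0 z -> `|K z y v| <= c * rho ^- d * `|v|.
  move=> Qz; apply: (le_trans (Ksize z y v (xne z Qz))).
  by rewrite ler_wpM2r// ler_wpM2l// inv_rho.
apply: (le_trans (lerD (Kb _ Qx) (Kb _ Qx'))).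
rewrite -mulrDl ler_wpM2r// -mulrDl [leRHS](_ : _ = (c * (8 * d%:R * q ^+ j.+1)) * rho ^- d);
  last by rewrite !mulrA.
rewrite ler_wpM2r ?invr_ge0 ?exprn_ge0 ?(ltW rho0)//.
have -> : c + c = c * 2 by rewrite mulr2n mulrDr mulr1.
rewrite ler_wpM2l//.
have h2q : 1 <= q ^+ j.+1 * 2 ^+ j.+1.
  by rewrite -exprMn; apply: exprn_ege1; lra.
have := exprS (2 : R) j; move: h2q jd.
have : 0 < q ^+ j.+1 by rewrite exprn_gt0.
move: (q ^+ j.+1) (2 ^+ j.+1) (2 ^+ j) (d%:R : R) => A1 A2 A3 A4.
by clear; move=> ? ? ? ?; subst A2; nra.
Qed.

End kernel.

(** * Chebyshev's inequality for an operator on L^p *)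

Section lebesgue_spaces.
Context (R : realType) (d' : nat) (E : normedModType R).
Local Notation d := d'.+1.
Local Notation pt := 'rV[R]_d.
Local Notation mu := (lebesgue_rV R d).
Local Notation T := (lebesgue_type R d).
Local Notation msets := (measurable : set (set (lebesgue_type R d))).
Implicit Types (f g h : pt -> E) (p : R).

Lemma markov_mu (F : pt -> \bar R) (c : R) : measurable_fun [set: T] F ->
  (forall x, 0 <= F x)%E -> 0 <= c ->
  (c%:E * mu [set x | c%:E < F x] <= \int[mu]_x F x)%E.
Proof.
move=> mF F0 c0; set A := [set x | _].
have mA : msets A.
  by have := emeasurable_fun_o_infty measurableT mF c%:E; rewrite setTI.
rewrite -(integral_cst mu mA).
apply: (@le_trans _ _ (\int[mu]_(x in A) F x)%E).
  apply: (ge0_le_integral mu mA).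
  - by move=> x _ /=; rewrite lee_fin.
  - exact: measurable_cst.
  - exact: measurable_funTS.
  - by move=> x Ax /=; exact: ltW.
apply: (ge0_subset_integral mu mA measurableT mF) => [x _|//]; exact: F0.
Qed.

Definition power_integral p f : \bar R := (\int[mu]_x (`|f x| `^ p)%:E)%E.

Lemma power_integral_ge0 p f : (0 <= power_integral p f)%E.
Proof. by apply: integral_ge0 => x _; rewrite lee_fin powR_ge0. Qed.

Lemma LpnormE p f : Lpnorm p f = (power_integral p f `^ p^-1)%E.
Proof.
rewrite /Lpnorm unlock /=.
suff -> : (\int[mu]_x (`| `|f x|%:E | `^ p) = power_integral p f)%E by [].
by apply: eq_integral => x _; rewrite /= normr_id.
Qed.

Lemma power_integral_lty p f : 0 < p -> Lp p f -> (power_integral p f < +oo)%E.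
Proof.
move=> p0 [_]; rewrite LpnormE; apply: lty_poweRy.
by rewrite invr_eq0 gt_eqF.
Qed.

Lemma Lpnorm_le p f (c : R) : 0 < p -> 0 <= c ->
  (power_integral p f <= (c `^ p)%:E)%E <-> (Lpnorm p f <= c%:E)%E.
Proof.
move=> p0 c0; rewrite LpnormE.
have bnd (x : \bar R) : (0 <= x)%E -> x \in `[0%E, +oo%E].
  by move=> x0; rewrite in_itv/= x0 leey.
split=> H.
  have pV0 : 0 <= p^-1 by rewrite invr_ge0 ltW.
  have := gt0_ler_poweR pV0 (bnd _ (power_integral_ge0 p f)) (bnd (c `^ p)%:E _) H.
  rewrite lee_fin powR_ge0 => /(_ isT) /le_trans; apply.
  by rewrite poweR_EFin -powRrM mulfV ?gt_eqF// powRr1.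
have := gt0_ler_poweR (ltW p0) (bnd _ (poweR_ge0 _ _)) (bnd c%:E _) H.
rewrite lee_fin => /(_ c0); rewrite -poweRrM mulVf ?gt_eqF// poweRe1//.
exact: power_integral_ge0.
Qed.

Lemma measurable_power p f : strongly_measurable f ->
  measurable_fun [set: T] (fun x => (`|f x| `^ p)%:E).
Proof.
move=> mf; apply/measurable_EFinP.
exact: (measurableT_comp (measurable_powR p) (measurable_norm mf)).
Qed.

Lemma power_integral_le p f (A : set pt) (B : R) : 0 < p ->
  strongly_measurable f -> msets A ->
  (forall x, `|f x| <= B) -> (forall x, ~ A x -> f x = 0) ->
  (power_integral p f <= (B `^ p)%:E * mu A)%E.
Proof.
move=> p0 mf mA fB fA.
have -> : ((B `^ p)%:E * mu A = \int[mu]_x ((B `^ p)%:E * (\1_A x)%:E))%E.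
  rewrite ge0_integralZl_EFin; last 4 first.
  - exact: measurableT.
  - by move=> x _; rewrite lee_fin.
  - by apply/measurable_EFinP; exact: measurable_indic.
  - exact: powR_ge0.
  by rewrite integral_indic// setIT.
apply: (ge0_le_integral mu measurableT).
- by move=> x _; rewrite lee_fin powR_ge0.
- exact: measurable_power.
- apply: measurable_funeM; by apply/measurable_EFinP; exact: measurable_indic.
move=> x _; have [Ax|nAx] := pselect (A x).
  rewrite indicE mem_set// mule1 lee_fin; apply: ge0_ler_powR; rewrite ?nnegrE//.
    exact: ltW.
  exact: (le_trans (normr_ge0 _) (fB x)).
by rewrite fA// normr0 powR0 ?gt_eqF// mule_ge0// lee_fin ?powR_ge0.
Qed.

Lemma Lp_bounded p f (A : set pt) (B : R) : 0 < p ->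
  strongly_measurable f -> msets A -> (mu A < +oo)%E ->
  (forall x, `|f x| <= B) -> (forall x, ~ A x -> f x = 0) -> Lp p f.
Proof.
move=> p0 mf mA Afin fB fA; split => //; rewrite LpnormE; apply: poweR_lty.
apply: (le_lt_trans (power_integral_le p0 mf mA fB fA)).
by rewrite lte_mul_pinfty// lee_fin powR_ge0.
Qed.

Lemma Lp_zero p : 0 < p -> Lp p (fun _ : pt => 0 : E).
Proof.
move=> p0; apply: (@Lp_bounded p _ set0 0) => //.
- exact: strongly_measurable_cst.
- by rewrite measure0.
- by move=> x; rewrite normr0.
Qed.

Lemma Lp_scale p (r : R) f : 0 < p -> Lp p f -> Lp p (fun x => r *: f x).
Proof.
move=> p0 Lf; have := power_integral_lty p0 Lf; have [mf _] := Lf.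
split.
  apply: (strongly_measurable_comp (phi := fun w => r *: w)) mf => w.
  exact: scaler_continuous.
rewrite LpnormE; apply: poweR_lty; rewrite /power_integral.
under eq_integral do rewrite normrZ powRM// EFinM.
rewrite ge0_integralZl_EFin; last 4 first.
- exact: measurableT.
- by move=> x _; rewrite lee_fin powR_ge0.
- exact: measurable_power.
- exact: powR_ge0.
by rewrite lte_mul_pinfty// lee_fin powR_ge0.
Qed.

End lebesgue_spaces.

Section operator.
Context (R : realType) (d' : nat) (E : normedModType R).
Local Notation d := d'.+1.
Local Notation pt := 'rV[R]_d.
Local Notation mu := (lebesgue_rV R d).
Context (T : (pt -> E) -> (pt -> E)) (p N : R).
Hypotheses (p0 : 0 < p) (Tlin : Lp_linear p T) (TN : Lp_opnorm p T = N%:E).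
Implicit Types (f g h : pt -> E).

Lemma ae_mu0 (P : pt -> Prop) : {ae mu, forall x, P x} -> mu [set x | ~ P x] = 0%E.
Proof. exact: negligible_mu0. Qed.

Lemma operator_add f g : Lp p f -> Lp p g ->
  mu [set x | T (fun y => f y + g y) x <> T f x + T g x] = 0%E.
Proof.
move=> Lf Lg; have /ae_mu0 := Tlin.2 1 f g Lf Lg.
rewrite (_ : (fun y => 1 *: f y + g y) = (fun y => f y + g y)).
  move=> <-; congr (mu _); apply/seteqP; by split => x /=; rewrite scale1r.
by apply/funext => y; rewrite scale1r.
Qed.

Lemma operator_zero : mu [set x | T (fun=> 0) x <> 0] = 0%E.
Proof.
have := operator_add (Lp_zero d' E p0) (Lp_zero d' E p0).
rewrite (_ : (fun _ : pt => 0 + 0 : E) = (fun=> 0)); last first.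
  by apply/funext => y; rewrite addr0.
move=> <-; congr (mu _); apply/seteqP; split => x /= h.
  by move=> /(congr1 (fun w => w - T (fun=> 0) x)); rewrite subrr addrK => /esym.
by move=> h0; apply: h; rewrite h0 addr0.
Qed.

Lemma operator_scale (r : R) f : Lp p f ->
  mu [set x | T (fun y => r *: f y) x <> r *: T f x] = 0%E.
Proof.
move=> Lf; have /ae_mu0 := Tlin.2 r f _ Lf (Lp_zero d' E p0).
rewrite (_ : (fun y => r *: f y + 0) = (fun y => r *: f y)); last first.
  by apply/funext => y; rewrite addr0.
move=> H; apply/eqP; rewrite eq_le lebesgue_outer_ge0 andbT.
rewrite -[leRHS](adde0 0%E) -[X in (_ <= X + _)%E]H -[X in (_ <= _ + X)%E]operator_zero.
apply: le_trans (muU_le _ _); apply: mu_le => x /= h.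
have [Tx|Tx] := pselect (T (fun=> 0) x = 0); last by right.
by left => h'; apply: h; rewrite h' Tx addr0.
Qed.

Lemma operator_norm_ge0 : 0 <= N.
Proof.
rewrite -lee_fin -TN; apply: le_trans (ereal_sup_ubound _).
  2: exists (fun=> 0) => //; split; first exact: Lp_zero.
  by rewrite LpnormE; exact: poweR_ge0.
apply/(Lpnorm_le _ p0 ler01); rewrite powR1 /power_integral.
under eq_integral do rewrite normr0 powR0 ?gt_eqF//.
by rewrite integral0.
Qed.

(** Boundedness is known on the unit ball only, so [g] is rescaled to norm
    one; the operator commutes with the rescaling up to a null set. *)
Lemma operator_chebyshev g (a t : R) : Lp p g -> 0 < a -> 0 < t ->
  (power_integral p g <= a%:E)%E ->
  (mu [set x | (t < `|T g x|)%R] <= ((N / t) `^ p * a)%:E)%E.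
Proof.
move=> Lg a0 t0 ga; pose s := a `^ p^-1.
have s0 : 0 < s by exact: powR_gt0.
have sp : s `^ p = a by rewrite /s -powRrM mulVf ?gt_eqF// powRr1// ltW.
pose g' x := s^-1 *: g x.
have Lg' : Lp p g' by exact: Lp_scale.
have g'1 : (Lpnorm p g' <= 1%:E)%E.
  apply/(Lpnorm_le _ p0 ler01); rewrite powR1 /power_integral.
  under eq_integral do rewrite normrZ powRM// EFinM.
  rewrite ge0_integralZl_EFin; last 4 first.
  - exact: measurableT.
  - by move=> x _; rewrite lee_fin powR_ge0.
  - by apply: measurable_power; case: Lg.
  - exact: powR_ge0.
  apply: (@le_trans _ _ ((`|s^-1| `^ p)%:E * a%:E)%E).
    by rewrite lee_wpmul2l// lee_fin powR_ge0.
  rewrite -EFinM lee_fin ger0_norm ?invr_ge0 ?(ltW s0)// -sp.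
  rewrite -powRM ?invr_ge0 ?(ltW s0)//.
  by rewrite mulVf ?gt_eqF// powR1.
have Tg'N : (Lpnorm p (T g') <= N%:E)%E.
  by rewrite -TN; apply: ereal_sup_ubound; exists g'.
have {Tg'N} TN' := (Lpnorm_le _ p0 operator_norm_ge0).2 Tg'N.
have [mTg _] := Tlin.1 _ Lg'.
have ts0 : 0 < t / s by rewrite divr_gt0.
have tsp : 0 < (t / s) `^ p by rewrite powR_gt0.
have pw0 x : (0 <= (`|T g' x| `^ p)%:E)%E by rewrite lee_fin powR_ge0.
have := le_trans (markov_mu (measurable_power p mTg) pw0 (ltW tsp)) TN'.
set A := [set x | _] => HA.
have gA : (mu [set x | (t < `|T g x|)%R] <= mu A)%E.
  have Tsc := operator_scale s^-1 Lg.
  rewrite -[leRHS]add0e -Tsc; apply: le_trans (muU_le _ _).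
  apply: mu_le => x /= tx.
  have [Tx|] := pselect (T g' x = s^-1 *: T g x); last by left.
  right; rewrite /A /= lte_fin Tx normrZ ger0_norm ?invr_ge0 ?(ltW s0)//.
  apply: gt0_ltr_powR; rewrite ?nnegrE ?(ltW ts0)//.
    by rewrite mulr_ge0// invr_ge0 ltW.
  by rewrite mulrC ltr_pM2l// invr_gt0.
apply: (le_trans gA).
rewrite -(@lee_pmul2l _ ((t / s) `^ p)%:E)//.
apply: (le_trans HA); rewrite -EFinM lee_fin -sp.
rewrite -!powRM ?mulr_ge0 ?invr_ge0 ?operator_norm_ge0 ?(ltW t0) ?(ltW s0)//.
rewrite le_eqVlt; apply/orP; left; apply/eqP; congr (_ `^ _).
by field; rewrite !gt_eqF.
Qed.

End operator.

(** * Step functions as simple functions *)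

Section subcells.
Context (R : realType) (d' : nat) (E : normedModType R).
Local Notation d := d'.+1.
Local Notation pt := 'rV[R]_d.
Local Notation mu := (lebesgue_rV R d).
Local Notation msets := (measurable : set (set (lebesgue_type R d))).
Implicit Types (f g h : pt -> E) (s : seq (set pt * E)) (L : R).

(** A subcube at generation [k] has the label [2 ^ k * m0 + r] with all
    coordinates of [r] below [2 ^ k]. *)
Lemma finite_subcells L (m0 : 'rV[int]_d) n : 0 < L ->
  finite_set [set t : nat * 'rV[int]_d | (t.1 <= n)%N /\
    cube L t.1 t.2 `<=` cube L 0 m0].
Proof.
move=> L0.
pose F (r : 'I_n.+1 * {ffun 'I_d -> 'I_(2 ^ n)}) : nat * 'rV[int]_d :=
  (r.1 : nat, \row_i ((2 ^ r.1)%N%:Z * m0 ord0 i + (r.2 i : nat)%:Z)).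
apply: (@sub_finite_set _ _ (F @` setT)); last first.
  by apply: finite_image; exact: finite_finset.
move=> [k m] [/= kn kQ].
have /(cubeP _ _ _ L0) cQ := kQ _ (corner_cube k m L0).
have bnd i : ((2 ^ k)%N%:Z * m0 ord0 i <= m ord0 i) /\
    (m ord0 i < (2 ^ k)%N%:Z * m0 ord0 i + (2 ^ k)%N%:Z).
  have := cQ i; rewrite !mxE /side expr0 divr1.
  have p0 : (0 : R) < 2 ^+ k by rewrite exprn_gt0.
  have -> : (m ord0 i)%:~R * (L / 2 ^+ k) = ((m ord0 i)%:~R / 2 ^+ k) * L by rewrite mulrA mulrAC.
  rewrite ler_pM2r// -{3}(mul1r L) -mulrDl ltr_pM2r// ler_pdivlMr// ltr_pdivrMr//.
  rewrite mulrDl mul1r => /andP[h1 h2].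
  rewrite -(ler_int R) -(ltr_int R) !intrD !intrM -!pmulrn !natrX.
  by rewrite ![2 ^+ k * _]mulrC.
have nk i : (absz (m ord0 i - (2 ^ k)%N%:Z * m0 ord0 i)%R < 2 ^ n)%N.
  have [h1 h2] := bnd i.
  have : (absz (m ord0 i - (2 ^ k)%N%:Z * m0 ord0 i)%R < 2 ^ k)%N by lia.
  by move=> /leq_trans; apply; rewrite leq_exp2l.
exists (Ordinal (kn : (k < n.+1)%N), [ffun i => Ordinal (nk i)]) => //.
rewrite /F /=; congr (_, _); apply/rowP => i; rewrite mxE ffunE /=.
have [+ _] := bnd i; move: ((2 ^ k)%N%:Z * m0 ord0 i) (m ord0 i) => u v.
by clear; lia.
Qed.

Definition restrict_simple s (A : set pt) : seq (set pt * E) :=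
  [seq (c.1 `&` A, c.2) | c <- s].

Lemma restrict_simpleE s A x :
  simple_val (restrict_simple s A) x = \1_A x *: simple_val s x.
Proof.
rewrite /simple_val big_map scaler_sumr; apply: eq_bigr => c _ /=.
by rewrite scalerA mulrC indicI.
Qed.

Lemma restrict_is_simple s A : is_simple s -> msets A ->
  is_simple (restrict_simple s A).
Proof.
move=> ss mA _ /mapP[c /ss[mc cfin] ->] /=; split; first exact: measurableI.
exact: mu_lty_sub (@subIsetl _ _ _) cfin.
Qed.

Lemma step_simple L (m0 : 'rV[int]_d) n h : 0 < L -> step L n h ->
  (forall x, ~ cube L 0 m0 x -> h x = 0) ->
  exists2 s, is_simple s & simple_val s = h.
Proof.
move=> L0 sh hQ.
have /finite_seqP[r rE] := finite_subcells m0 n L0.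
have memr t : t \in r <-> (t.1 <= n)%N /\ cube L t.1 t.2 `<=` cube L 0 m0.
  split=> [tr|tQ]; first by have : [set` r] t by []; rewrite -rE.
  by have : [set t | (t.1 <= n)%N /\ cube L t.1 t.2 `<=` cube L 0 m0] t by []; rewrite rE.
pose r' := undup [seq t.2 | t <- r & t.1 == n].
have memr' m : cube L n m `<=` cube L 0 m0 -> m \in r'.
  move=> mQ; rewrite mem_undup; apply/mapP; exists (n, m) => //.
  by rewrite mem_filter eqxx; apply/memr.
exists [seq (cube L n m, h (corner L n m)) | m <- r'].
  move=> _ /mapP[m _ ->] /=; split; first exact: cube_measurable.
  by rewrite lebesgue_cube// ltry.
apply/funext => x; rewrite /simple_val big_map /=.
have [xr|xr] := boolP (idx L n x \in r').
  rewrite (bigD1_seq _ xr (undup_uniq _))/= indicE mem_set//= scale1r.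
  rewrite big1 ?addr0; first by apply: sh; exact: (corner_cube n (idx L n x) L0).
  by move=> m mx; rewrite indicE memNset ?scale0r// => xm; move: mx; rewrite -xm eqxx.
rewrite hQ; last first.
  move=> xQ; move/negP: xr; apply; apply: memr'.
  exact: (cell_in_cube (n := n) L0 xQ).
rewrite big_seq big1// => m mr.
by rewrite indicE memNset ?scale0r// => xm; move: xr; rewrite (xm : idx L n x = m) mr.
Qed.

Lemma integral_cutoff (A : set pt) (F : pt -> \bar R) : msets A ->
  (\int[mu]_(x in A) F x = \int[mu]_x ((\1_A x)%:E * F x))%E.
Proof.
move=> mA; rewrite integral_mkcond; apply: eq_integral => x _.
rewrite patchE indicE; case: ifP => _; first by rewrite mul1e.
by rewrite mul0e.
Qed.

Lemma norm_simple_integral_restrict s A : is_simple s -> msets A ->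
  (`|simple_integral (restrict_simple s A)|%:E <=
     \int[mu]_(x in A) `|simple_val s x|%:E)%E.
Proof.
move=> ss mA; apply: (le_trans (norm_simple_integral (restrict_is_simple ss mA))).
rewrite (integral_cutoff _ mA).
suff -> : (\int[mu]_x `|simple_val (restrict_simple s A) x|%:E =
  \int[mu]_x ((\1_A x)%:E * `|simple_val s x|%:E))%E by exact: lexx.
apply: eq_integral => x _; rewrite restrict_simpleE normrZ EFinM.
by rewrite ger0_norm.
Qed.

End subcells.

(** * The Calderon-Zygmund decomposition *)

Section stopped_at_height.
Context (R : realType) (d' : nat) (E : normedModType R).
Local Notation d := d'.+1.
Local Notation pt := 'rV[R]_d.
Local Notation mu := (lebesgue_rV R d).
Local Notation T := (lebesgue_type R d).
Local Notation msets := (measurable : set (set (lebesgue_type R d))).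
Local Notation label := (nat * 'rV[int]_d)%type.
Implicit Types (f g h : pt -> E) (s : seq (set pt * E)) (L : R) (t : label).

Local Notation tcube L t := (cube L t.1 t.2).

Lemma sum_disjoint_indic L (ts : seq label) x : uniq ts ->
  (forall t t', t \in ts -> t' \in ts -> tcube L t x -> tcube L t' x -> t = t') ->
  forall F : label -> \bar R, (forall t, 0 <= F t)%E ->
  (\sum_(t <- ts) (\1_(tcube L t) x)%:E * F t = 0)%E \/
  exists2 t, t \in ts /\ tcube L t x &
     (\sum_(t <- ts) (\1_(tcube L t) x)%:E * F t = F t)%E.
Proof.
move=> uts dts F F0.
have [[t [tts tx]]|nex] := pselect (exists t, t \in ts /\ tcube L t x); [right|left].
  exists t => //; rewrite (bigD1_seq t)//= indicE mem_set// mul1e.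
  rewrite big_seq_cond big1 ?adde0// => t' /andP[t's t't].
  rewrite indicE memNset ?mul0e// => t'x.
  by move: t't; rewrite (dts _ _ t's tts t'x tx) eqxx.
rewrite big_seq big1// => t tts; rewrite indicE memNset ?mul0e// => tx.
by apply: nex; exists t.
Qed.

Lemma sum_integral_disjoint L (ts : seq label) (F : pt -> \bar R) : 0 < L -> uniq ts ->
  (forall t t' x, t \in ts -> t' \in ts -> tcube L t x -> tcube L t' x -> t = t') ->
  measurable_fun [set: T] F -> (forall x, 0 <= F x)%E ->
  (\sum_(t <- ts) \int[mu]_(x in tcube L t) F x <= \int[mu]_x F x)%E.
Proof.
move=> L0 uts dts mF F0.
have mc t : msets (tcube L t) by exact: cube_measurable.
have m1 t : measurable_fun [set: T] (fun x => (\1_(tcube L t) x)%:E * F x)%E.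
  apply: emeasurable_funM; last exact: mF.
  by apply/measurable_EFinP; exact: measurable_indic.
have p1 t x : [set: T] x -> (0 <= (\1_(tcube L t) x)%:E * F x)%E.
  by move=> _; rewrite mule_ge0// lee_fin.
under eq_bigr do rewrite (integral_cutoff _ (mc _)).
rewrite -(ge0_integral_sum mu measurableT m1 p1).
apply: (ge0_le_integral mu measurableT).
- by move=> x _; apply: sume_ge0 => t _; exact: p1.
- exact: emeasurable_sum.
- exact: mF.
move=> x _.
have [->|[t _ ->]] := sum_disjoint_indic uts (fun t t' => @dts t t' x) (fun _ => F0 x).
  exact: F0.
exact: lexx.
Qed.

(** The bad part is a finite sum of simple functions, one for each maximal
    subcube on which the mean of [|h|] exceeds [lam]: a step function has only
    finitely many subcubes to offer, and its means over them are finite sums. *)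
Lemma calderon_zygmund L (m0 : 'rV[int]_d) n h (lam : R) :
  0 < L -> step L n h -> (forall x, ~ cube L 0 m0 x -> h x = 0) -> 0 < lam ->
  (\int[mu]_x `|h x|%:E <= lam%:E * mu (cube L 0 m0))%E ->
  exists g (ts : seq label) (b : label -> seq (set pt * E)),
    [/\ step L n g /\ (forall x, ~ cube L 0 m0 x -> g x = 0),
      forall x, `|g x| <= 2 ^+ d * lam,
      (forall t, is_simple (b t)) /\
      forall t, t \in ts -> [/\ simple_integral (b t) = 0,
        forall x, ~ tcube L t x -> simple_val (b t) x = 0, (t.1 <= n)%N &
        tcube L t `<=` cube L 0 m0],
      forall x, h x = g x + \sum_(t <- ts) simple_val (b t) x &
      (lam%:E * \sum_(t <- ts) mu (tcube L t) <= \int[mu]_x `|h x|%:E /\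
       \sum_(t <- ts) \int[mu]_x `|simple_val (b t) x|%:E <=
         2%:E * \int[mu]_x `|h x|%:E)%E].
Proof.
move=> L0 sh hQ lam0 hlam; set Q := cube L 0 m0.
have mh := strongly_measurable_step L0 sh.
have mhE := measurable_norm_EFin mh.
have mc t : msets (tcube L t) by exact: cube_measurable.
have [s ss sE] := step_simple L0 sh hQ.
pose I t := (\int[mu]_(x in tcube L t) `|h x|%:E)%E.
pose F := [set t | [/\ (t.1 <= n)%N, tcube L t `<=` Q & (lam%:E * mu (tcube L t) < I t)%E]].
pose M := maximal_cells L F.
have /finite_seqP[ts' ts'E] : finite_set M.
  apply: sub_finite_set (finite_subcells m0 n L0) => t [[]] //.
pose ts := undup ts'.
have tsP t : t \in ts <-> M t.
  rewrite mem_undup; split=> [tr|Mt]; first by have : [set` ts'] t by []; rewrite -ts'E.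
  by move: Mt; rewrite ts'E.
have tsF t : t \in ts -> F t by move=> /tsP[].
have uts : uniq ts by exact: undup_uniq.
have dts t t' x : t \in ts -> t' \in ts -> tcube L t x -> tcube L t' x -> t = t'.
  by move=> /tsP Mt /tsP Mt'; exact: (maximal_cells_disjoint Mt Mt').
pose vol t : R := side L t.1 ^+ d.
have vol0 t : 0 < vol t by rewrite exprn_gt0// side_gt0.
have muE t : mu (tcube L t) = (vol t)%:E by exact: lebesgue_cube.
pose e t : E := (vol t)^-1 *: simple_integral (restrict_simple s (tcube L t)).
have eI t : (`|e t|%:E * mu (tcube L t) <= I t)%E.
  rewrite muE -EFinM normrZ ger0_norm ?invr_ge0 ?(ltW (vol0 _))//.
  rewrite mulrC mulrA mulfV ?gt_eqF// mul1r.
  by rewrite /I -sE; exact: norm_simple_integral_restrict.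
pose b t := (tcube L t, - e t) :: restrict_simple s (tcube L t).
have bs t : is_simple (b t).
  move=> c; rewrite inE => /predU1P[->|].
    by split; [exact: mc|rewrite [mu _](muE t) ltry].
  exact: restrict_is_simple.
have bE t x : simple_val (b t) x = \1_(tcube L t) x *: (h x - e t).
  by rewrite simple_val_cons restrict_simpleE sE -scalerDr addrC.
pose bsum x := \sum_(t <- ts) simple_val (b t) x.
have bin t x : t \in ts -> tcube L t x -> bsum x = h x - e t.
  move=> tts tx; rewrite /bsum (bigD1_seq t)//= bE indicE mem_set// scale1r.
  rewrite big_seq_cond big1 ?addr0// => t' /andP[t's t't].
  rewrite bE indicE memNset ?scale0r// => t'x.
  by move: t't; rewrite (dts _ _ _ t's tts t'x tx) eqxx.
have bout x : (forall t, t \in ts -> ~ tcube L t x) -> bsum x = 0.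
  move=> nx; rewrite /bsum big_seq big1// => t tts.
  by rewrite bE indicE memNset ?scale0r//; exact: nx.
pose g x := h x - bsum x.
have hfin t : (I t <= \int[mu]_x `|h x|%:E)%E.
  apply: (ge0_subset_integral mu (mc t) measurableT mhE) => [x _|//].
  by rewrite lee_fin.
(* The parent of a maximal cube has not been selected and is [2 ^ d] times as
   large, so the mean over the maximal cube is at most [2 ^ d * lam]. Top
   cubes are excluded by the bound on the mean over the whole cube. *)
have gb x : `|g x| <= 2 ^+ d * lam.
  have [[t [tts tx]]|nx] := pselect (exists t, t \in ts /\ tcube L t x).
    rewrite /g (bin _ _ tts tx) subKr.
    have [tn tQ tI] := tsF _ tts; have /tsP[_ tmax] := tts.
    case: t tts tx tn tQ tI tmax => -[|k] m tts tx tn tQ tI tmax.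
      exfalso.
      have mm0 : m = m0 := etrans (esym (tx : idx L 0 x = m)) (tQ _ tx).
      move: tI; rewrite ltNge => /negP; apply; rewrite /= mm0.
      by apply: le_trans hlam; exact: hfin.
    have nF := tmax x k tx (ltnSn k).
    have xQ : Q x by exact: tQ.
    have pI : (I (k, idx L k x) <= lam%:E * mu (cube L k (idx L k x)))%E.
      rewrite leNgt; apply/negP => Ik; apply: nF; split => //=.
        exact: ltnW.
      exact: (cell_in_cube (n := k) L0 xQ).
    have tI' : (I (k.+1, m) <= I (k, idx L k x))%E.
      apply: (ge0_subset_integral mu (mc _) (mc _)) => [|y _|].
      - exact: measurable_funTS.
      - by rewrite lee_fin.
      - by move=> y /= ym; apply: (idx_le L0 (leqnSn k)); rewrite ym (tx : idx L k.+1 x = m).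
    have := le_trans (eI _) (le_trans tI' pI).
    rewrite muE [mu _](muE (k, idx L k x)) -!EFinM lee_fin /vol /=.
    rewrite (sideS L k) [(2 * _) ^+ _]exprMn [lam * _]mulrCA [X in _ <= X]mulrA.
    by rewrite ler_pM2r ?exprn_gt0 ?side_gt0.
  rewrite /g bout; last by move=> t tts tx; apply: nx; exists t.
  rewrite subr0; have [xQ|xQ] := pselect (Q x); last first.
    by rewrite hQ// normr0 mulr_ge0 ?exprn_ge0 ?(ltW lam0).
  apply: (@le_trans _ _ lam); last first.
    by rewrite ler_peMl ?(ltW lam0)// exprn_ege1// ler1n.
  rewrite leNgt; apply/negP => lamh; apply: nx.
  have /(maximal_cells_cover L0)[t Mt tx] : cells_union L F x.
    exists (n, idx L n x) => //; split => //=; first exact: (cell_in_cube (n := n) L0 xQ).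
    have -> : I (n, idx L n x) = (`|h x|%:E * mu (cube L n (idx L n x)))%E.
      rewrite -(integral_cst mu (mc (n, idx L n x))); apply: eq_integral => y.
      by rewrite inE => yx; rewrite /= (sh y x yx).
    by rewrite lte_pmul2r// ?[mu _](muE (n, idx L n x))// lte_fin.
  by exists t; split => //; apply/tsP.
exists g, ts, b; split => //.
- split.
    have sb : step L n bsum.
      move=> x y xy; rewrite /bsum big_seq [RHS]big_seq; apply: eq_bigr => t tts.
      rewrite !bE (sh _ _ xy); congr (_ *: _); rewrite !indicE; congr ((_ : bool)%:R).
      have [tn _ _] := tsF _ tts; have xyt := idx_le L0 tn xy.
      by apply/idP/idP; rewrite !inE /cube /= xyt.
    by move=> x y xy; rewrite /g (sb _ _ xy) (sh _ _ xy).
  move=> x xQ; rewrite /g hQ// bout ?subr0// => t tts tx; apply: xQ.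
  by have [_ tQ _] := tsF _ tts; exact: tQ.
- split=> // t tts; have [tn tQ _] := tsF _ tts; split => //.
  + rewrite /simple_integral big_cons /= -/(simple_integral _) [mu _](muE t) /=.
    by rewrite scalerN /e scalerA mulfV ?gt_eqF// scale1r addNr.
  + by move=> x tx; rewrite bE indicE memNset// scale0r.
- by move=> x; rewrite subrK.
have sumI : (\sum_(t <- ts) I t <= \int[mu]_x `|h x|%:E)%E.
  by apply: sum_integral_disjoint => // x; rewrite lee_fin.
split.
  apply: le_trans sumI; rewrite ge0_sume_distrr//.
  rewrite big_seq [leRHS]big_seq; apply: lee_sum => t /tsF[_ _].
  exact: ltW.
apply: (@le_trans _ _ (\sum_(t <- ts) 2%:E * I t)%E); last first.
  rewrite -ge0_sume_distrr; last by move=> t _; apply: integral_ge0 => x _; rewrite lee_fin.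
  by rewrite lee_wpmul2l// lee_fin.
apply: lee_sum => t _.
have -> : (2%:E * I t = I t + I t)%E by rewrite mule_natl mule2n.
apply: (@le_trans _ _ (I t + `|e t|%:E * mu (tcube L t))%E); last by rewrite leeD2l.
rewrite -(integral_cst mu (mc t)) -(ge0_integralD mu (mc t)); last 4 first.
- by move=> x _; rewrite lee_fin.
- exact: measurable_funTS.
- by move=> x _; rewrite lee_fin.
- exact: measurable_cst.
rewrite (integral_cutoff _ (mc t)); apply: (ge0_le_integral mu measurableT).
- by move=> x _; rewrite lee_fin.
- by apply: measurable_norm_EFin; exact: strongly_measurable_simple.
- apply: emeasurable_funM; first by apply/measurable_EFinP; exact: measurable_indic.
  by apply: emeasurable_funD => //; exact: measurable_cst.
move=> x _; rewrite bE normrZ EFinM [X in (X%:E * _)%E]ger0_norm//.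
by rewrite lee_wpmul2l ?lee_fin//= ler_normB.
Qed.

End stopped_at_height.

(** * Weak type (1, 1) *)

Section supports.
Context (R : realType) (d' : nat) (E : normedModType R).
Local Notation d := d'.+1.
Local Notation pt := 'rV[R]_d.
Implicit Types (f g h : pt -> E) (x y a : pt).

Lemma closure_coord (A : set pt) x (e : R) : closure A x -> 0 < e ->
  exists2 y, A y & forall i, `|x ord0 i - y ord0 i| < e.
Proof.
move=> Ax e0; have [y [Ay xy]] := Ax _ (nbhsx_ballx x e e0).
exists y => // i; case: xy => _ /(_ ord0 i).
by rewrite -ball_normE.
Qed.

Lemma closed_support_sub f g : (forall x, g x = 0 -> f x = 0) ->
  closed_support f `<=` closed_support g.
Proof.
move=> gf; apply: closure_subset => x /=; apply: contra_neq; exact: gf.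
Qed.

Lemma not_closed_support f x (e : R) : 0 < e ->
  (forall y, (forall i, `|x ord0 i - y ord0 i| < e) -> f y = 0) ->
  ~ closed_support f x.
Proof.
by move=> e0 fx /closure_coord/(_ e0)[y /= fy xy]; rewrite fx ?eqxx in fy.
Qed.

Lemma closed_support_compact f a (l r : R) :
  (forall x, ~ fattened a l r x -> f x = 0) -> compact (closed_support f).
Proof.
move=> f0.
pose A (i : 'I_d) : set R := `[a ord0 i - r - 1, a ord0 i + l + r + 1]%classic.
apply: (@subclosed_compact _ _ [set v : pt | forall i, A i (v ord0 i)]).
- exact: closed_closure.
- by apply: rV_compact => i; exact: segment_compact.
move=> x /closure_coord/(_ ltr01)[y /= fy xy] i.
have /(_ i) : fattened a l r y.
  by apply: contrapT => /f0 fy0; move: fy; rewrite fy0 eqxx.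
have := xy i; rewrite /A /= in_itv /= ltr_norml.
by move: (x ord0 i) (y ord0 i) => u v /andP[h1 h2] /andP[h3 h4]; apply/andP; split; lra.
Qed.

End supports.

Section bad_part.
Context (R : realType) (d' : nat) (E : normedModType R).
Local Notation d := d'.+1.
Local Notation pt := 'rV[R]_d.
Local Notation mu := (lebesgue_rV R d).
Local Notation LT := (lebesgue_type R d).
Local Notation label := (nat * 'rV[int]_d)%type.
Local Notation tcube L t := (cube L t.1 t.2).
Context (p alpha N CK : R) (T : (pt -> E) -> (pt -> E)).
Hypotheses (p1 : 1 < p) (alpha01 : 0 < alpha <= 1).
Hypothesis Tcz : cz_operator p alpha N CK T.
Implicit Types (f g h : pt -> E) (s : seq (set pt * E)) (L : R) (t : label).

Definition kernel_const (d : nat) (CK : R) : R := `|CK| * 2 ^+ d * (8 * d%:R).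
Definition weight_const (d : nat) (alpha : R) : R := 3 ^+ d * (1 - decay alpha)^-1.

Lemma kernel_const_ge0 : 0 <= kernel_const d CK.
Proof. by rewrite !mulr_ge0// exprn_ge0. Qed.

Lemma weight_const_ge0 : 0 <= weight_const d alpha.
Proof.
have /andP[_ q1] := decay_bounds alpha01.
by rewrite mulr_ge0 ?exprn_ge0// invr_ge0 subr_ge0 ltW.
Qed.

Local Notation W L t := (weighted_dilates alpha (corner L t.1 t.2) (side L t.1)).
Local Notation tdilate L t := (dilate (corner L t.1 t.2) (side L t.1) 0).

(** Every bad function has integral zero, so subtracting from the kernel its
    value at the corner of the bad cube does not change the integral. The
    subtracted integrand is a simple function with integral zero, and
    [kernel_oscillation] for the transposed kernel bounds what remains. *)
Lemma bad_part_pointwise L (m0 : 'rV[int]_d) n (ts : seq label) (b : label -> seq (set pt * E)) x :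
  0 < L ->
  (forall t, is_simple (b t)) ->
  (forall t, t \in ts -> [/\ simple_integral (b t) = 0,
        forall x, ~ tcube L t x -> simple_val (b t) x = 0, (t.1 <= n)%N &
        tcube L t `<=` cube L 0 m0]) ->
  strongly_measurable (fun x => \sum_(t <- ts) simple_val (b t) x) ->
  bounded_fun (fun x => \sum_(t <- ts) simple_val (b t) x) ->
  (forall t, t \in ts -> ~ tdilate L t x) ->
  (`|T (fun x => \sum_(t <- ts) simple_val (b t) x) x|%:E <=
   \sum_(t <- ts) (kernel_const d CK)%:E * W L t x *
     \int[mu]_y `|simple_val (b t) y|%:E)%E.
Proof.
move=> L0 sb bP mb bb xts.
set bsum := fun x => _ in mb bb *.
have [_ _ [K [sK TK]]] := Tcz.
have [_ regK] := singular_kernel_regular sK.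
have bsum0 y : (forall t, t \in ts -> ~ tcube L t y) -> bsum y = 0.
  move=> nt; rewrite /bsum big_seq big1// => t tts.
  by have [_ h _ _] := bP t tts; apply: h; exact: nt.
have csupp : compact (closed_support bsum).
  apply: (@closed_support_compact _ _ _ _ (corner L 0 m0) (side L 0) 0) => y yQ.
  apply: bsum0 => t tts ty; apply: yQ; rewrite -cube_fattened//.
  by have [_ _ _ h] := bP t tts; exact: h.
have nsupp : ~ closed_support bsum x.
  (* All bad cubes have side at least [side L n], so points within [side L n]
     of [x] are outside them. *)
  apply: (not_closed_support (side_gt0 n L0)) => y xy; apply: bsum0 => t tts.
  have [_ _ tn _] := bP t tts.
  move=> /(cubeP _ _ _ L0) ty; apply: (xts t tts) => i.
  have sn : side L n <= side L t.1.
    rewrite /side ler_pM2l// lef_pV2 ?posrE ?exprn_gt0//.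
    by rewrite ler_eXn2l// ltr1n.
  have := ty i; have := xy i; rewrite ltr_norml expr0 mul1r.
  move: sn; move: (side L n) (side L t.1) (x ord0 i) (y ord0 i) (corner _ _ _ _ _).
  by clear; move=> s1 s2 u v w s12 /andP[? ?] /andP[? ?]; apply/andP; split; lra.
have /bochner_approx_integral TKx := TK _ mb bb csupp x nsupp.
pose c t := corner L t.1 t.2.
(* The bad functions with the kernel frozen at the corners of their cubes, as
   one simple function. *)
pose s := flatten [seq [seq (e.1, K x (c t) e.2) | e <- b t] | t <- ts].
have ss : is_simple s.
  move=> e /flattenP[_ /mapP[t tts ->] /mapP[e' e'b ->]] /=.
  exact: sb e'b.
have sI : simple_integral s = 0.
  rewrite /simple_integral big_flatten /= big_map big_seq big1// => t tts.
  have [bI _ _ _] := bP t tts.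
  transitivity (K x (c t) (simple_integral (b t))); last by rewrite bI linear0.
  rewrite /simple_integral linear_sum big_map; apply: eq_bigr => e _ /=.
  by rewrite linearZZ.
have sv y : simple_val s y = \sum_(t <- ts) K x (c t) (simple_val (b t) y).
  rewrite /simple_val big_flatten /= big_map; apply: eq_bigr => t _.
  rewrite linear_sum big_map; apply: eq_bigr => e _ /=.
  by rewrite linearZZ.
pose G y := (\sum_(t <- ts) (kernel_const d CK)%:E * W L t x * `|simple_val (b t) y|%:E)%E.
have W0 t : (0 <= W L t x)%E by apply: weighted_dilates_ge0; exact: side_gt0.
have Gt0 t y : (0 <= (kernel_const d CK)%:E * W L t x * `|simple_val (b t) y|%:E)%E.
  by rewrite mule_ge0 ?mule_ge0 ?lee_fin ?kernel_const_ge0.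
have mGt t : measurable_fun [set: LT]
    (fun y => (kernel_const d CK)%:E * W L t x * `|simple_val (b t) y|%:E)%E.
  apply: measurable_funeM; apply: measurable_norm_EFin.
  exact: strongly_measurable_simple.
have mG : measurable_fun [set: LT] G by exact: emeasurable_sum.
have := bochner_dist_le TKx (bochner_approx_simple ss) mG _.
rewrite sI subr0; move=> H.
apply: (@le_trans _ _ (\int[mu]_y G y)%E); first apply: H.
  move=> y; rewrite sv /bsum linear_sum -sumrB.
  apply: (@le_trans _ _ (\sum_(t <- ts) `|K x y (simple_val (b t) y) -
     K x (c t) (simple_val (b t) y)|%:E)%E).
    by rewrite sumEFin lee_fin; exact: ler_norm_sum.
  rewrite /G big_seq [leRHS]big_seq; apply: lee_sum => t tts.
  have [ty|ty] := pselect (tcube L t y); last first.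
    have [_ bt0 _ _] := bP t tts.
    by rewrite bt0// !linear0 addr0 !normr0 mule0.
  apply: (kernel_oscillation (K := fun x y => K y x)) => //.
  - exact: side_gt0.
  - by rewrite -cube_fattened.
  - by rewrite -cube_fattened//; exact: corner_cube.
  - exact: xts.
rewrite (ge0_integral_sum mu measurableT mGt (fun t y _ => Gt0 t y)).
apply: lee_sum => t _.
rewrite (ge0_integralZl mu measurableT); first exact: lexx.
- by apply: measurable_norm_EFin; exact: strongly_measurable_simple.
- by move=> y _; rewrite lee_fin.
- by rewrite mule_ge0// lee_fin kernel_const_ge0.
Qed.

End bad_part.

Section weak_type_of_steps.
Context (R : realType) (d' : nat) (E : normedModType R).
Local Notation d := d'.+1.
Local Notation pt := 'rV[R]_d.
Local Notation mu := (lebesgue_rV R d).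
Local Notation LT := (lebesgue_type R d).
Local Notation msets := (measurable : set (set (lebesgue_type R d))).
Local Notation label := (nat * 'rV[int]_d)%type.
Local Notation tcube L t := (cube L t.1 t.2).
Context (p alpha N CK : R) (T : (pt -> E) -> (pt -> E)).
Hypotheses (p1 : 1 < p) (alpha01 : 0 < alpha <= 1).
Hypothesis Tcz : cz_operator p alpha N CK T.
Implicit Types (f g h : pt -> E) (s : seq (set pt * E)) (L : R) (t : label).

Local Notation W L t := (weighted_dilates alpha (corner L t.1 t.2) (side L t.1)).
Local Notation tdilate L t := (dilate (corner L t.1 t.2) (side L t.1) 0).

Lemma bounded_fun_normP f : bounded_fun f <-> exists B, forall x, `|f x| <= B.
Proof.
split=> [[B [_ fB]]|[B fB]].
  by exists (B + 1) => x; apply: fB => //; rewrite ltrDl.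
by exists B; split; [exact: num_real|move=> M' BM x _; exact: le_trans (fB x) (ltW BM)].
Qed.

Lemma mu_seq_union_le (I : eqType) (r : seq I) (A : I -> set pt) :
  (mu [set x | exists2 i, i \in r & A i x] <= \sum_(i <- r) mu (A i))%E.
Proof.
elim: r => [|i r IH].
  rewrite (_ : [set _ | _] = set0) ?big_nil ?measure0//.
  by apply/seteqP; split => x // [].
rewrite big_cons; apply: le_trans (leeD (lexx _) IH).
apply: le_trans (muU_le _ _); apply: mu_le => x [j].
by rewrite inE => /predU1P[-> ?|jr Ajx]; [left|right; exists j].
Qed.

(** Off a null set and the tripled bad cubes, [T h] is large only where the
    image of the good part is, which Chebyshev's inequality in L^p makes
    rare, or where the sum of the majorants of [bad_part_pointwise] is, which
    has small integral. The height [lam] is [kappa^-1] times a bound for the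
    mean of [|h|], whence the factor [kappa] on all contributions of the bad
    part. *)
Lemma weak_type_step L (m0 : 'rV[int]_d) n h (B lam M kappa : R) : 0 < L ->
  step L n h -> (forall x, ~ cube L 0 m0 x -> h x = 0) ->
  (forall x, `|h x| <= B) -> 0 < lam -> 0 < M -> 0 <= kappa -> kappa <= 1 ->
  (\int[mu]_x `|h x|%:E <= (kappa * lam)%:E * mu (cube L 0 m0))%E ->
  (mu [set x | ((M + 1) * lam < `|T h x|)%R] <=
   ((N * 2 ^+ d / M) `^ p + (3 ^+ d + 2 * kernel_const d CK * weight_const d alpha)
      * kappa)%:E * mu (cube L 0 m0))%E.
Proof.
move=> L0 sh hQ hB lam0 M0 k0 k1 hk; set Q := cube L 0 m0.
have p0 : 0 < p by apply: lt_trans p1.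
have [Tlin TN _] := Tcz.
have N0 : 0 <= N := operator_norm_ge0 p0 TN.
have mQ : msets Q by exact: cube_measurable.
have [V [V0 muQ]] : exists V, 0 < V /\ mu Q = V%:E.
  by exists (side L 0 ^+ d); rewrite exprn_gt0 ?side_gt0 ?[mu Q]lebesgue_cube.
have h1 : (\int[mu]_x `|h x|%:E <= lam%:E * mu Q)%E.
  apply: (le_trans hk); rewrite lee_wpmul2r// lee_fin.
  by rewrite ler_piMl// ltW.
have [g [ts [b [[sg gQ] gB [sb bP] hgb [tsV bV]]]]] :=
  calderon_zygmund L0 sh hQ lam0 h1.
set bsum := fun x => \sum_(t <- ts) simple_val (b t) x.
have bsE x : bsum x = h x - g x by rewrite hgb addrC addKr.
have sbs : step L n bsum by move=> x y xy; rewrite !bsE (sh _ _ xy) (sg _ _ xy).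
have mg := strongly_measurable_step L0 sg.
have mb := strongly_measurable_step L0 sbs.
have bB x : `|bsum x| <= B + 2 ^+ d * lam.
  by rewrite bsE; apply: (le_trans (ler_normB _ _)); exact: lerD.
have bQ x : ~ Q x -> bsum x = 0 by move=> nQ; rewrite bsE hQ// gQ// subrr.
have Qfin : (mu Q < +oo)%E by rewrite muQ ltry.
have Lg : Lp p g := Lp_bounded p0 mg mQ Qfin gB gQ.
have Lb : Lp p bsum := Lp_bounded p0 mb mQ Qfin bB bQ.
have Tadd := operator_add Tlin Lg Lb.
rewrite (_ : (fun y => g y + bsum y) = h) in Tadd; last first.
  by apply/funext => x; rewrite hgb.
pose C1 := kernel_const d CK; pose C2 := weight_const d alpha.
pose I t := (\int[mu]_y `|simple_val (b t) y|%:E)%E.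
pose H x := (\sum_(t <- ts) C1%:E * W L t x * I t)%E.
set S0 := [set x | _] in Tadd.
pose S1 := [set x | M * lam < `|T g x|].
pose S2 := [set x | exists2 t, t \in ts & tdilate L t x].
pose S3 := [set x | (lam%:E < H x)%E].
have cover : [set x | (M + 1) * lam < `|T h x|] `<=` S0 `|` (S1 `|` (S2 `|` S3)).
  move=> x /= hx; have [Tx|] := pselect (T h x = T g x + T bsum x); last by left.
  right; have [gx|gx] := ltP (M * lam) `|T g x|; [by left|right].
  have [[t tts tx]|nts] := pselect (exists2 t, t \in ts & tdilate L t x); [left|right].
    by exists t.
  have Hx : (`|T bsum x|%:E <= H x)%E.
    apply: (bad_part_pointwise alpha01 Tcz L0 sb bP mb) => //.
      by apply/bounded_fun_normP; exists (B + 2 ^+ d * lam).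
    by move=> t tts tx; apply: nts; exists t.
  apply: lt_le_trans Hx; rewrite lte_fin.
  have := ler_normD (T g x) (T bsum x); rewrite -Tx; move: hx gx; clear; lra.
have S1V : (mu S1 <= ((N * 2 ^+ d / M) `^ p * V)%:E)%E.
  have l2 : 0 < 2 ^+ d * lam by rewrite mulr_gt0// exprn_gt0.
  have a0 : 0 < (2 ^+ d * lam) `^ p * V by rewrite mulr_gt0// powR_gt0.
  have gI : (power_integral p g <= ((2 ^+ d * lam) `^ p * V)%:E)%E.
    by rewrite EFinM -muQ; exact: power_integral_le.
  have Ml : 0 < M * lam by rewrite mulr_gt0.
  apply: (le_trans (operator_chebyshev p0 Tlin TN Lg a0 Ml gI)).
  rewrite lee_fin mulrA ler_pM2r// -powRM ?divr_ge0 ?(ltW Ml) ?(ltW l2)//.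
  rewrite le_eqVlt; apply/orP; left; apply/eqP; congr (_ `^ _).
  by move: (2 ^+ d) => u; field; rewrite !gt_eqF.
have sumV : (\sum_(t <- ts) mu (tcube L t) <= (kappa * V)%:E)%E.
  rewrite -(@lee_pmul2l _ lam%:E)//; apply: (le_trans tsV).
  by apply: (le_trans hk); rewrite muQ -!EFinM lee_fin mulrCA mulrA.
have S2V : (mu S2 <= (3 ^+ d * kappa * V)%:E)%E.
  apply: (le_trans (mu_seq_union_le _ _)).
  apply: (@le_trans _ _ (\sum_(t <- ts) (3 ^+ d)%:E * mu (tcube L t))%E).
    apply: lee_sum => t _.
    apply: (le_trans (lebesgue_dilate_le _ _ (side_gt0 t.1 L0))).
    by rewrite lebesgue_cube// expr0 mul1r -EFinM lee_fin exprMn.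
  rewrite -ge0_sume_distrr; last by move=> t _; exact: lebesgue_outer_ge0.
  by rewrite -mulrA EFinM lee_wpmul2l// lee_fin exprn_ge0.
have C10 : 0 <= C1 by exact: kernel_const_ge0.
have C20 : 0 <= C2 by exact: weight_const_ge0.
have W0 t x : (0 <= W L t x)%E by apply: weighted_dilates_ge0; exact: side_gt0.
have I0 t : (0 <= I t)%E by apply: integral_ge0 => x _; rewrite lee_fin.
have Ht0 t x : (0 <= C1%:E * W L t x * I t)%E by rewrite mule_ge0// mule_ge0 ?lee_fin.
have mW t : measurable_fun [set: LT] (W L t).
  by apply: weighted_dilates_measurable; exact: side_gt0.
have mHt t : measurable_fun [set: LT] (fun x => C1%:E * W L t x * I t)%E.
  under eq_fun do rewrite muleC.
  by apply: measurable_funeM; apply: measurable_funeM.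
have intH : (\int[mu]_x H x <= (2 * C1 * C2 * kappa * lam * V)%:E)%E.
  rewrite (ge0_integral_sum mu measurableT mHt (fun t y _ => Ht0 t y)).
  apply: (@le_trans _ _ (\sum_(t <- ts) (C1 * C2)%:E * I t)%E).
    apply: lee_sum => t _; under eq_integral do rewrite muleC.
    rewrite (ge0_integralZl mu measurableT _ _ (I0 t)); last 2 first.
    - by apply: measurable_funeM.
    - by move=> x _; rewrite mule_ge0 ?lee_fin.
    rewrite muleC lee_wpmul2r//.
    rewrite (ge0_integralZl mu measurableT (mW t)); last 2 first.
    - by move=> x _; exact: W0.
    - by rewrite lee_fin.
    rewrite (EFinM C1 C2) lee_wpmul2l ?lee_fin//.
    by apply: integral_weighted_dilates => //; exact: side_gt0.
  rewrite -ge0_sume_distrr; last by move=> t _; exact: I0.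
  apply: (@le_trans _ _ ((C1 * C2)%:E * (2%:E * ((kappa * lam)%:E * V%:E)))%E).
    apply: lee_wpmul2l; first by rewrite lee_fin mulr_ge0.
    apply: (le_trans bV); apply: lee_wpmul2l; first by rewrite lee_fin.
    by rewrite -muQ.
  rewrite -!EFinM lee_fin le_eqVlt; apply/orP; left; apply/eqP; ring.
have S3V : (mu S3 <= (2 * C1 * C2 * kappa * V)%:E)%E.
  have mH : measurable_fun [set: LT] H by exact: emeasurable_sum.
  have H0 x : (0 <= H x)%E by apply: sume_ge0 => t _; exact: Ht0.
  rewrite -(@lee_pmul2l _ lam%:E)//.
  apply: (le_trans (markov_mu mH H0 (ltW lam0))); apply: (le_trans intH).
  by rewrite -EFinM lee_fin le_eqVlt; apply/orP; left; apply/eqP; ring.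
apply: (le_trans (mu_le cover)); apply: (le_trans (muU_le _ _)).
rewrite Tadd add0e; apply: (le_trans (muU_le _ _)).
apply: (le_trans (leeD S1V (le_trans (muU_le _ _) (leeD S2V S3V)))).
rewrite muQ -!EFinD -EFinM lee_fin le_eqVlt; apply/orP; left; apply/eqP.
rewrite -/C1 -/C2; ring.
Qed.

End weak_type_of_steps.

Section weak_type_by_density.
Context (R : realType) (d' : nat) (E : normedModType R).
Local Notation d := d'.+1.
Local Notation pt := 'rV[R]_d.
Local Notation mu := (lebesgue_rV R d).
Local Notation LT := (lebesgue_type R d).
Local Notation msets := (measurable : set (set (lebesgue_type R d))).
Local Notation label := (nat * 'rV[int]_d)%type.
Context (p alpha N CK : R) (T : (pt -> E) -> (pt -> E)).
Hypotheses (p1 : 1 < p) (alpha01 : 0 < alpha <= 1).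
Hypothesis Tcz : cz_operator p alpha N CK T.
Implicit Types (f g h : pt -> E) (s : seq (set pt * E)) (L : R) (t : label).

(** For a function that is small on most of a cube and merely bounded on the
    rest. *)
Lemma integral_le_two (F : pt -> \bar R) (A B : set pt) (c1 c2 : R) :
  msets A -> msets B -> measurable_fun [set: LT] F -> (forall x, 0 <= F x)%E ->
  0 <= c1 -> 0 <= c2 ->
  (forall x, F x <= (c1 * \1_A x + c2 * \1_B x)%:E)%E ->
  (\int[mu]_x F x <= c1%:E * mu A + c2%:E * mu B)%E.
Proof.
move=> mA mB mF F0 c10 c20 FAB.
have mi (D : set pt) (c : R) : msets D ->
    measurable_fun [set: LT] (fun x => (c * \1_D x)%:E).
  move=> mD; apply/measurable_EFinP; apply: measurable_funM => //.
have int (D : set pt) (c : R) : msets D -> 0 <= c ->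
    (\int[mu]_x (c * \1_D x)%:E = c%:E * mu D)%E.
  move=> mD c0; under eq_integral do rewrite EFinM.
  rewrite ge0_integralZl_EFin; last 4 first.
  - exact: measurableT.
  - by move=> x _; rewrite lee_fin.
  - by apply/measurable_EFinP; exact: measurable_indic.
  - exact: c0.
  by rewrite integral_indic// setIT.
have pos (D : set pt) (c : R) x : 0 <= c -> [set: LT] x -> (0 <= (c * \1_D x)%:E)%E.
  by move=> c0 _; rewrite lee_fin mulr_ge0.
rewrite -(int A c1)// -(int B c2)//.
rewrite -(ge0_integralD mu measurableT (fun x => @pos A c1 x c10) (mi _ _ mA)
  (fun x => @pos B c2 x c20) (mi _ _ mB)).
apply: (ge0_le_integral mu measurableT) => [x _||| x _].
- exact: F0.
- exact: mF.
- by apply: emeasurable_funD; exact: mi.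
- by rewrite -EFinD; exact: FAB.
Qed.

(** The difference from a step approximation is at most [eta] off a set of
    measure [2 * eta * |Q|] and bounded in any case, so its L^1 and L^p norms
    tend to zero with [eta]. *)
Lemma weak_type_bounded L (m0 : 'rV[int]_d) h (B lam M kappa e : R) : 0 < L ->
  strongly_measurable h -> (forall x, ~ cube L 0 m0 x -> h x = 0) ->
  (forall x, `|h x| <= B) -> 0 < lam -> 0 < M -> 0 < kappa -> 2 * kappa <= 1 ->
  0 < e ->
  (\int[mu]_x `|h x|%:E <= (kappa * lam)%:E * mu (cube L 0 m0))%E ->
  (mu [set x | (2 * (M + 1) * lam < `|T h x|)%R] <=
   ((N * 2 ^+ d / M) `^ p + (3 ^+ d + 2 * kernel_const d CK * weight_const d alpha)
      * (2 * kappa) + e)%:E * mu (cube L 0 m0))%E.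
Proof.
move=> L0 mh hQ hB lam0 M0 k0 k1 e0 hk; set Q := cube L 0 m0.
have p0 : 0 < p by apply: lt_trans p1.
have [Tlin TN _] := Tcz.
have N0 : 0 <= N := operator_norm_ge0 p0 TN.
have mQ : msets Q by exact: cube_measurable.
have [V [V0 muQ]] : exists V, 0 < V /\ mu Q = V%:E.
  by exists (side L 0 ^+ d); rewrite exprn_gt0 ?side_gt0 ?[mu Q]lebesgue_cube.
have B0 : 0 <= B := le_trans (normr_ge0 (h 0)) (hB 0).
pose t := (M + 1) * lam; have t0 : 0 < t by rewrite mulr_gt0// addr_gt0.
pose D := B + B + 1; have D0 : 0 <= D by rewrite !addr_ge0.
pose c1 := 1 + 2 * D; pose c2 := (N / t) `^ p * (1 + 2 * D `^ p) + 1.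
have c10 : 0 < c1 by rewrite /c1; lra.
have Np0 : 0 <= (N / t) `^ p * (1 + 2 * D `^ p).
  by rewrite mulr_ge0 ?powR_ge0// addr_ge0// mulr_ge0// powR_ge0.
have c20 : 0 < c2 by rewrite ltr_wpDl.
(* [eta * c1 * |Q|] bounds the L^1 norm of the error and [eta * c2 * |Q|] the
   measure of the set where its image exceeds [t]; the summand 1 keeps [c2]
   positive. *)
have [eta [eta0 eta1 etak etae]] : exists eta : R, [/\ 0 < eta, eta < 1,
    eta * c1 <= kappa * lam & eta * c2 <= e].
  exists (Num.min 2^-1 (Num.min (kappa * lam / c1) (e / c2))); split.
  - by rewrite !lt_min !divr_gt0 ?mulr_gt0// invr_gt0 ltr0n.
  - by rewrite gt_min invf_lt1// ltr1n.
  - by rewrite -ler_pdivlMr// !ge_min lexx orbT.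
  - by rewrite -ler_pdivlMr// !ge_min lexx !orbT.
have [n [g [sg gQ gB gh]]] := step_approximation m0 L0 mh hB eta0 eta1.
set Z := [set x | _] in gh.
have mg := strongly_measurable_step L0 sg.
pose r x := h x - g x.
have mr : strongly_measurable r.
  apply: (strongly_measurable_step_comb (phi := fun v w => w - v) L0 _ sg mh) => v w.
  by apply: cvgB; [exact: cvg_id|exact: cvg_cst].
have rB x : `|r x| <= D.
  apply: (le_trans (ler_normB _ _)); have := hB x; have := gB x.
  by rewrite /D; move: eta1; lra.
have rQ x : ~ Q x -> r x = 0 by move=> nQ; rewrite /r hQ// gQ// subrr.
have mZ : msets Z.
  have := emeasurable_fun_o_infty mQ (measurable_funTS (measurable_norm_EFin mr)) eta%:E.
  by congr (measurable _); apply/seteqP; split => x [Qx xe]; split => //.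
have muZ : (mu Z <= (2 * eta * V)%:E)%E by rewrite EFinM -muQ.
have two (c c' : R) : 0 <= c' -> (c%:E * mu Q + c'%:E * mu Z <= ((c + 2 * eta * c') * V)%:E)%E.
  move=> c'0; rewrite muQ mulrDl EFinD EFinM leeD2l//.
  apply: (@le_trans _ _ (c'%:E * (2 * eta * V)%:E)%E); first by rewrite lee_wpmul2l.
  by rewrite -EFinM lee_fin le_eqVlt; apply/orP; left; apply/eqP; ring.
have split_r x : r x = 0 \/ (Q x /\ `|r x| <= eta) \/ (Q x /\ Z x).
  have [Qx|nQ] := pselect (Q x); [right|by left; exact: rQ].
  by have [re|re] := leP `|r x| eta; [left|right].
have Qfin : (mu Q < +oo)%E by rewrite muQ ltry.
have Lg : Lp p g := Lp_bounded p0 mg mQ Qfin gB gQ.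
have Lr : Lp p r := Lp_bounded p0 mr mQ Qfin rB rQ.
have intr : (\int[mu]_x `|r x|%:E <= (kappa * lam * V)%:E)%E.
  apply: (le_trans (integral_le_two (c1 := eta) (c2 := D) mQ mZ
    (measurable_norm_EFin mr) _ (ltW eta0) D0 _)).
  - by move=> x; rewrite lee_fin.
  - move=> x; rewrite lee_fin.
    have [->|[[Qx rx]|[Qx Zx]]] := split_r x.
    + by rewrite normr0 addr_ge0// mulr_ge0// ltW.
    + by rewrite indicE mem_set// mulr1 ler_wpDr// mulr_ge0.
    + by rewrite [\1_Z x]indicE mem_set// mulr1 ler_wpDl// mulr_ge0// ltW.
  apply: (le_trans (two _ _ D0)); rewrite lee_fin ler_pM2r//.
  by move: etak; rewrite /c1; lra.
have powr : (power_integral p r <= (eta * (1 + 2 * D `^ p) * V)%:E)%E.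
  apply: (le_trans (integral_le_two (c1 := eta `^ p) (c2 := D `^ p) mQ mZ
    (measurable_power p mr) _ (powR_ge0 _ _) (powR_ge0 _ _) _)).
  - by move=> x; rewrite lee_fin powR_ge0.
  - move=> x; rewrite lee_fin.
    have [->|[[Qx rx]|[Qx Zx]]] := split_r x.
    + by rewrite normr0 powR0 ?gt_eqF// addr_ge0// mulr_ge0// powR_ge0.
    + rewrite indicE mem_set// mulr1 ler_wpDr ?mulr_ge0 ?powR_ge0//.
      by apply: ge0_ler_powR; rewrite ?nnegrE ?(ltW p0) ?(ltW eta0).
    + rewrite [\1_Z x]indicE mem_set// mulr1 ler_wpDl ?mulr_ge0 ?powR_ge0//.
      by apply: ge0_ler_powR; rewrite ?nnegrE ?(ltW p0).
  apply: (le_trans (two _ _ (powR_ge0 _ _))); rewrite lee_fin ler_pM2r//.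
  have : eta `^ p <= eta by apply: ge1r_powR; rewrite ?eta0 ltW.
  by move: (eta `^ p) (D `^ p) => u v; lra.
have intg : (\int[mu]_x `|g x|%:E <= ((2 * kappa) * lam)%:E * mu Q)%E.
  apply: (@le_trans _ _ (\int[mu]_x (`|h x|%:E + `|r x|%:E))%E).
    apply: (ge0_le_integral mu measurableT) => [x _||| x _].
    - by rewrite lee_fin.
    - exact: measurable_norm_EFin.
    - by apply: emeasurable_funD; exact: measurable_norm_EFin.
    - rewrite -EFinD lee_fin (_ : g x = h x - r x); first exact: ler_normB.
      by rewrite /r subKr.
  rewrite (ge0_integralD mu measurableT); last 4 first.
  - by move=> x _; rewrite lee_fin.
  - exact: measurable_norm_EFin.
  - by move=> x _; rewrite lee_fin.
  - exact: measurable_norm_EFin.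
  apply: (le_trans (leeD hk intr)).
  by rewrite -/Q muQ -!EFinM -EFinD lee_fin le_eqVlt; apply/orP; left; apply/eqP; ring.
have k2 : 0 <= 2 * kappa by rewrite mulr_ge0// ltW.
have Tg := weak_type_step p1 alpha01 Tcz L0 sg gQ gB lam0 M0 k2 k1 intg.
have a0 : 0 < eta * (1 + 2 * D `^ p) * V.
  by rewrite !mulr_gt0// ltr_wpDr// mulr_ge0// powR_ge0.
have Tr := operator_chebyshev p0 Tlin TN Lr a0 t0 powr.
have Tadd := operator_add Tlin Lg Lr.
rewrite (_ : (fun y => g y + r y) = h) in Tadd; last first.
  by apply/funext => x; rewrite /r addrC subrK.
set S0 := [set x | _] in Tadd.
set S1 := [set x | _] in Tg; set S2 := [set x | _] in Tr.
have cover : [set x | (2 * (M + 1) * lam < `|T h x|)%R] `<=` S0 `|` (S1 `|` S2).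
  move=> x /= hx; have [Tx|] := pselect (T h x = T g x + T r x); last by left.
  right; have [gx|gx] := ltP t `|T g x|; [by left|right].
  rewrite /S2 /=; have := ler_normD (T g x) (T r x); rewrite -Tx.
  by move: hx gx; rewrite /t; lra.
apply: (le_trans (mu_le cover)); apply: (le_trans (muU_le _ _)).
rewrite Tadd add0e; apply: (le_trans (muU_le _ _)).
apply: (le_trans (leeD Tg Tr)); rewrite -/Q muQ -!EFinM -EFinD lee_fin.
rewrite [leRHS]mulrDl lerD2l !mulrA ler_pM2r//.
move: etae; rewrite /c2; move: ((N / t) `^ p) (D `^ p) Np0 => u v Np0.
by move: eta0; lra.
Qed.

End weak_type_by_density.

Section weak_type_theorem.
Context (R : realType) (d' : nat).
Local Notation d := d'.+1.
Local Notation pt := 'rV[R]_d.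
Local Notation mu := (lebesgue_rV R d).
Local Notation msets := (measurable : set (set (lebesgue_type R d))).

(** The weak-type (1, 1) bound at one height. [M] is chosen first, to make
    the contribution of the good part small, and then [kappa], to make that
    of the bad part small; neither depends on the space or on the operator
    beyond [N] and [CK]. *)
Lemma weak_type (p alpha N CK eps : R) : 1 < p -> 0 < alpha <= 1 -> 0 < eps ->
  exists Lam : R, 0 < Lam /\
  forall (E : normedModType R) (T : (pt -> E) -> (pt -> E)),
    cz_operator p alpha N CK T ->
  forall (L : R) (m0 : 'rV[int]_d) (h : pt -> E) (B tau : R), 0 < L ->
    strongly_measurable h -> (forall x, ~ cube L 0 m0 x -> h x = 0) ->
    (forall x, `|h x| <= B) -> 0 <= tau ->
    (\int[mu]_x `|h x|%:E <= tau%:E * mu (cube L 0 m0))%E ->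
    (mu [set x | (Lam * tau < `|T h x|)%R] <= eps%:E * mu (cube L 0 m0))%E.
Proof.
move=> p1 alpha01 eps0.
have p0 : 0 < p by apply: lt_trans p1.
have e3 : 0 < eps / 3 by rewrite divr_gt0.
pose r := (eps / 3) `^ p^-1; have r0 : 0 < r by rewrite powR_gt0.
pose M := `|N| * 2 ^+ d / r + 1.
have M0 : 0 < M.
  by rewrite ltr_wpDl// divr_ge0 ?(ltW r0)// mulr_ge0// exprn_ge0.
pose c := 2 * (3 ^+ d + 2 * kernel_const d CK * weight_const d alpha).
have c0 : 0 < c.
  rewrite mulr_gt0// ltr_wpDr ?exprn_gt0// mulr_ge0//; last exact: weight_const_ge0.
  by rewrite mulr_ge0// kernel_const_ge0.
pose kappa := Num.min 2^-1 (eps / 3 / c).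
have k0 : 0 < kappa by rewrite lt_min divr_gt0// invr_gt0 ltr0n.
have k1 : 2 * kappa <= 1.
  have : kappa <= 2^-1 by rewrite ge_min lexx.
  by clear; lra.
have kc : c * kappa <= eps / 3.
  by rewrite mulrC -ler_pdivlMr// ge_min lexx orbT.
pose Lam := 2 * (M + 1) / kappa.
have Lam0 : 0 < Lam by rewrite divr_gt0// mulr_gt0// addr_gt0.
exists Lam; split => // E T Tcz L m0 h B tau L0 mh hQ hB tau0 htau.
have [Tlin TN _] := Tcz.
have N0 : 0 <= N := operator_norm_ge0 p0 TN.
have NM : (N * 2 ^+ d / M) `^ p <= eps / 3.
  have -> : eps / 3 = r `^ p by rewrite /r -powRrM mulVf ?gt_eqF// powRr1// ltW.
  have N2 : 0 <= N * 2 ^+ d by rewrite mulr_ge0// exprn_ge0.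
  apply: ge0_ler_powR; rewrite ?nnegrE ?(ltW p0) ?(ltW r0) ?divr_ge0 ?(ltW M0)//.
  rewrite ler_pdivrMr// /M ger0_norm// mulrDr mulr1 [r * (_ / _)]mulrC divfK ?gt_eqF//.
  by rewrite lerDl ltW.
have pos tau' : 0 < tau' -> tau <= tau' ->
    (mu [set x | (Lam * tau' < `|T h x|)%R] <= eps%:E * mu (cube L 0 m0))%E.
  move=> t0 tt'; have lam0 : 0 < tau' / kappa by rewrite divr_gt0.
  have hk : (\int[mu]_x `|h x|%:E <= (kappa * (tau' / kappa))%:E * mu (cube L 0 m0))%E.
    apply: (le_trans htau); rewrite mulrC divfK ?gt_eqF//.
    by rewrite lee_wpmul2r// lee_fin.
  have := weak_type_bounded p1 alpha01 Tcz L0 mh hQ hB lam0 M0 k0 k1 e3 hk.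
  rewrite (_ : 2 * (M + 1) * (tau' / kappa) = Lam * tau'); last first.
    by rewrite /Lam mulrA mulrAC.
  move=> /le_trans; apply; rewrite lee_wpmul2r// lee_fin.
  move: NM kc; rewrite /c; move: (_ `^ p) (3 ^+ d + _) => u v; clear; lra.
have [tau_gt0|] := ltP 0 tau; first exact: pos.
move=> tau_le0; have tauE : tau = 0 by apply/eqP; rewrite eq_le tau_le0.
rewrite tauE mulr0.
(* When the mean of [|h|] is zero, the set where [T h] does not vanish is an
   increasing union of sets with positive height. *)
pose A n := [set x | (Lam * n.+1%:R^-1 < `|T h x|)%R].
have mTh : strongly_measurable (T h).
  apply: (Tlin.1 h _).1; apply: (Lp_bounded p0 mh (cube_measurable 0 m0 L0) _ hB hQ).
  by rewrite lebesgue_cube// ltry.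
have mA n : msets (A n).
  have := emeasurable_fun_o_infty measurableT (measurable_norm_EFin mTh) (Lam * n.+1%:R^-1)%:E.
  by rewrite setTI.
have AE : [set x | (0 < `|T h x|)%R] = \bigcup_n A n.
  apply/seteqP; split => [x /= Tx|x [n _ /=]].
    have [n] := ltr_add_invr (divr_gt0 Tx Lam0); rewrite add0r => nT.
    by exists n => //; rewrite /A /= mulrC -ltr_pdivlMr.
  by apply: le_lt_trans; rewrite mulr_ge0 ?(ltW Lam0).
have cA : mu (A n) @[n --> \oo] --> mu (\bigcup_n A n).
  apply: nondecreasing_cvg_mu => //; first exact: bigcupT_measurable.
  move=> i j ij; apply/subsetPset => x; rewrite /A /=; apply: le_lt_trans.
  by rewrite ler_pM2l// lef_pV2 ?posrE// ler_nat.
rewrite AE -(cvg_lim _ cA)//; apply: lime_le; first by apply/cvg_ex; eexists; exact: cA.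
apply: nearW => n; apply: pos; first by rewrite invr_gt0.
by rewrite tauE invr_ge0.
Qed.

End weak_type_theorem.

(** * Local oscillation *)

Section dilate_means.
Context (R : realType) (d' : nat).
Local Notation d := d'.+1.
Local Notation pt := 'rV[R]_d.
Local Notation mu := (lebesgue_rV R d).
Local Notation msets := (measurable : set (set (lebesgue_type R d))).

(** Makes every cube a top cube, so that estimates on top cubes hold in all
    generations. *)
Lemma cube_rescale (L : R) n (m : 'rV[int]_d) : cube L n m = cube (side L n) 0 m.
Proof.
have sE : side (side L n) 0 = side L n by rewrite /side expr0 divr1.
by rewrite /cube /idx sE.
Qed.

(** Normalised by [(2 ^+ k * l) ^+ d], which is comparable to the measure of
    the dilate: the [k]-th dilate then enters the same way here and in
    [dilate_weight]. *)
Definition dilate_mean (E : normedModType R) (f : pt -> E) (a : pt) (l : R)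
    (k : nat) : \bar R :=
  (((2 ^+ k * l) ^- d)%:E * \int[mu]_(x in dilate a l k) `|f x|%:E)%E.

Definition dilate_mean_sum (E : normedModType R) (alpha : R) (f : pt -> E) (a : pt)
    (l : R) : \bar R :=
  (\sum_(k <oo) (decay alpha ^+ k)%:E * dilate_mean f a l k)%E.

Lemma dilate_mean_ge0 (E : normedModType R) (f : pt -> E) a l k : 0 < l ->
  (0 <= dilate_mean f a l k)%E.
Proof.
move=> l0; rewrite mule_ge0//.
  by rewrite lee_fin invr_ge0 exprn_ge0// mulr_ge0 ?exprn_ge0// ltW.
by apply: integral_ge0 => x _; rewrite lee_fin.
Qed.

Lemma decay_ge0 (alpha : R) k : 0 <= decay alpha ^+ k.
Proof. by rewrite exprn_ge0// powR_ge0. Qed.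

(** Tonelli: this is how the kernel majorant turns into the sum of means that
    the sparse operators will dominate. *)
Lemma integral_weighted_norm (E : normedModType R) (alpha : R) (f : pt -> E) a l :
  0 < l -> strongly_measurable f ->
  (\int[mu]_y (weighted_dilates alpha a l y * `|f y|%:E) = dilate_mean_sum alpha f a l)%E.
Proof.
move=> l0 mf; have mfE := measurable_norm_EFin mf.
have -> : (\int[mu]_y (weighted_dilates alpha a l y * `|f y|%:E) =
    \int[mu]_y \sum_(k <oo) (`|f y|%:E *
      (dilate_weight d' alpha l k * \1_(dilate a l k) y)%:E))%E.
  apply: eq_integral => y _; rewrite muleC nneseriesZl// => k _.
  exact: weighted_term_ge0.
rewrite integral_nneseries; last 3 first.
- exact: measurableT.
- move=> k; apply: emeasurable_funM; first exact: mfE.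
  exact: weighted_term_measurable.
- by move=> k y _; rewrite mule_ge0 ?lee_fin//; exact: weighted_term_ge0.
apply: eq_eseriesr => k _.
have -> : (\int[mu]_y (`|f y|%:E * (dilate_weight d' alpha l k * \1_(dilate a l k) y)%:E) =
    \int[mu]_y ((dilate_weight d' alpha l k)%:E * ((\1_(dilate a l k) y)%:E * `|f y|%:E)))%E.
  by apply: eq_integral => y _; rewrite EFinM muleC -muleA.
have mD : msets (dilate a l k) by exact: fattened_measurable.
rewrite ge0_integralZl_EFin; last 4 first.
- exact: measurableT.
- by move=> y _; rewrite mule_ge0// lee_fin.
- apply: emeasurable_funM; last exact: mfE.
  by apply/measurable_EFinP; exact: measurable_indic.
- exact: dilate_weight_ge0.
by rewrite -(integral_cutoff _ mD) /dilate_weight EFinM -muleA.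
Qed.

Lemma operator_sum (E : normedModType R) (p : R) (T : (pt -> E) -> (pt -> E))
    (I : Type) (r : seq I) (h : I -> pt -> E) : 0 < p -> Lp_linear p T ->
  (forall i, Lp p (h i)) -> (forall r', Lp p (fun x => \sum_(i <- r') h i x)) ->
  mu [set x | T (fun y => \sum_(i <- r) h i y) x <> \sum_(i <- r) T (h i) x] = 0%E.
Proof.
move=> p0 Tlin Lh Ls; elim: r => [|i r IH].
  rewrite (_ : (fun y => _) = (fun=> 0)); last by apply/funext => y; rewrite big_nil.
  rewrite -[RHS](operator_zero p0 Tlin); congr (mu _).
  by apply/seteqP; split => x /=; rewrite big_nil.
have Tadd := operator_add Tlin (Lh i) (Ls r).
apply/eqP; rewrite eq_le lebesgue_outer_ge0 andbT.
rewrite -[leRHS](adde0 0%E) -[X in (_ <= X + _)%E]Tadd -[X in (_ <= _ + X)%E]IH.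
apply: le_trans (muU_le _ _); apply: mu_le => x /=.
rewrite (_ : (fun y => \sum_(j <- i :: r) h j y) =
  (fun y => h i y + \sum_(j <- r) h j y)); last by apply/funext => y; rewrite big_cons.
rewrite big_cons => nx.
have [Tx|] := pselect (T (fun y => h i y + \sum_(j <- r) h j y) x =
  T (h i) x + T (fun y => \sum_(j <- r) h j y) x); last by left.
by right => Sx; apply: nx; rewrite Tx Sx.
Qed.

Lemma neighbour_cubes (L : R) n (m : 'rV[int]_d) : 0 < L ->
  exists r : seq 'rV[int]_d, [/\ uniq r, (size r <= 3 ^ d)%N &
    forall x, dilate (corner L n m) (side L n) 0 x <-> idx L n x \in r].
Proof.
move=> L0.
pose F (r : {ffun 'I_d -> 'I_3}) : 'rV[int]_d := \row_i (m ord0 i + (r i : nat)%:Z - 1).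
exists (undup (codom F)); split.
- exact: undup_uniq.
- apply: (leq_trans (size_undup _)).
  by rewrite size_codom card_ffun !card_ord.
move=> x; rewrite mem_undup.
have s0 := side_gt0 n L0.
have key i : (corner L n m ord0 i - 2 ^+ 0 * side L n <= x ord0 i <
     corner L n m ord0 i + side L n + 2 ^+ 0 * side L n) <->
   (m ord0 i - 1 <= idx L n x ord0 i < m ord0 i + 2).
  rewrite expr0 mul1r !mxE floor_ge_int floor_lt_int.
  rewrite ler_pdivlMr// ltr_pdivrMr// [(_ + 2)%:~R]intrD [(_ - 1)%:~R]intrB mulrBl mulrDl mul1r.
  suff -> : (m ord0 i)%:~R * side L n + side L n + side L n =
    (m ord0 i)%:~R * side L n + 2 * side L n by [].
  by rewrite -addrA mulr_natl mulr2n.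
split.
  move=> xD.
  have bnd i : (absz (idx L n x ord0 i - (m ord0 i - 1))%R < 3)%N.
    have := (key i).1 (xD i); move: (idx L n x ord0 i) (m ord0 i) => u v.
    by clear; lia.
  apply/codomP; exists [ffun i => Ordinal (bnd i)]; apply/rowP => i.
  rewrite [RHS]mxE ffunE /=; have := (key i).1 (xD i).
  move: (idx L n x ord0 i) (m ord0 i) => u v.
  by clear; lia.
move=> /codomP[r xr] i; apply/key; rewrite xr mxE.
have := ltn_ord (r i); move: (nat_of_ord (r i)) (m ord0 i) => u v.
by clear; lia.
Qed.

End dilate_means.

Section oscillation_estimate.
Context (R : realType) (d' : nat).
Local Notation d := d'.+1.
Local Notation pt := 'rV[R]_d.
Local Notation mu := (lebesgue_rV R d).
Local Notation LT := (lebesgue_type R d).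
Local Notation msets := (measurable : set (set (lebesgue_type R d))).

Lemma cutoffE (E : normedModType R) (A : set pt) (f : pt -> E) x :
  cutoff A f x = (\1_A x : R) *: f x.
Proof.
by rewrite /cutoff indicE; case: (x \in A); rewrite ?scale1r ?scale0r.
Qed.

(** The cube lies at distance at least [l] from the support, so [T f] is
    given by the kernel at both points, and the difference of the integrands
    is bounded by [kernel_oscillation]. *)
Lemma far_part_oscillation (E : normedModType R) (p alpha N CK : R)
    (T : (pt -> E) -> (pt -> E)) (f : pt -> E) (B : R) a l x x' :
  0 < alpha <= 1 -> cz_operator p alpha N CK T ->
  strongly_measurable f -> (forall x, `|f x| <= B) -> compact (closed_support f) ->
  0 < l -> (forall y, dilate a l 0 y -> f y = 0) ->
  fattened a l 0 x -> fattened a l 0 x' ->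
  (`|T f x - T f x'|%:E <= (kernel_const d CK)%:E * dilate_mean_sum alpha f a l)%E.
Proof.
move=> alpha01 [_ _ [K [sK TK]]] mf fB cf l0 fD Qx Qx'.
have [regK _] := singular_kernel_regular sK.
have bf : bounded_fun f by apply/bounded_fun_normP; exists B.
have nsupp z : fattened a l 0 z -> ~ closed_support f z.
  move=> Qz; apply: (not_closed_support l0) => y zy; apply: fD => i.
  have := Qz i; have := zy i; rewrite ltr_norml expr0 mul1r subr0 addr0.
  move: (z ord0 i) (y ord0 i) (a ord0 i) l0 => u v w; clear.
  by move=> ? /andP[? ?] /andP[? ?]; apply/andP; split; lra.
have Kf z : fattened a l 0 z -> bochner_approx (fun y => K z y (f y)) (T f z).
  by move=> Qz; apply: bochner_approx_integral; apply: TK => //; exact: nsupp.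
have C10 : 0 <= kernel_const d CK by exact: kernel_const_ge0.
have mW := weighted_dilates_measurable alpha a l0.
have mfE := measurable_norm_EFin mf.
pose G y := ((kernel_const d CK)%:E * (weighted_dilates alpha a l y * `|f y|%:E))%E.
have mWf : measurable_fun [set: LT] (fun y => weighted_dilates alpha a l y * `|f y|%:E)%E.
  by apply: emeasurable_funM; [exact: mW|exact: mfE].
have mG : measurable_fun [set: LT] G by exact: measurable_funeM.
apply: (le_trans (bochner_dist_le (Kf x Qx) (Kf x' Qx') mG _)).
  move=> y; rewrite /G; have [yD|yD] := pselect (dilate a l 0 y).
    by rewrite fD// !linear0 addr0 !normr0 !mule0.
  rewrite muleA.
  exact: (kernel_oscillation (K := fun x y => K x y) (f y) alpha01 _ regK l0 Qx Qx' yD).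
rewrite /G (ge0_integralZl mu measurableT mWf).
- by rewrite integral_weighted_norm.
- by move=> y _; rewrite mule_ge0 ?lee_fin// weighted_dilates_ge0.
- by rewrite lee_fin.
Qed.

Lemma dilate_mean_sum_le (E : normedModType R) (alpha : R) (f g : pt -> E) a l : 0 < l ->
  strongly_measurable f -> strongly_measurable g -> (forall x, `|f x| <= `|g x|) ->
  (dilate_mean_sum alpha f a l <= dilate_mean_sum alpha g a l)%E.
Proof.
move=> l0 mf mg fg; rewrite -!integral_weighted_norm//.
have mW := weighted_dilates_measurable alpha a l0.
apply: (ge0_le_integral mu measurableT) => [y _||| y _].
- by rewrite mule_ge0 ?lee_fin// weighted_dilates_ge0.
- by apply: emeasurable_funM; [exact: mW|exact: measurable_norm_EFin].
- by apply: emeasurable_funM; [exact: mW|exact: measurable_norm_EFin].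
- by rewrite lee_wpmul2l ?weighted_dilates_ge0// lee_fin.
Qed.

(** The constant is the value at the corner of the image of the part of [f]
    off the tripled cube. The part on the tripled cube is cut into its at
    most [3 ^ d] neighbouring cubes of the grid, because [weak_type] wants a
    function carried by one cube; each piece may exceed its bound on a set of
    measure [eps / 3 ^ d * |Q|]. *)
Lemma local_oscillation (p alpha N CK eps : R) : 1 < p -> 0 < alpha <= 1 -> 0 < eps ->
  exists Lam : R, 0 < Lam /\
  forall (E : normedModType R) (T : (pt -> E) -> (pt -> E)),
    cz_operator p alpha N CK T ->
  forall (f : pt -> E) (B : R) (A : set pt),
    strongly_measurable f -> (forall x, `|f x| <= B) -> compact (closed_support f) ->
    msets A -> (mu A < +oo)%E -> (forall x, ~ A x -> f x = 0) ->
  forall (L : R) n (m : 'rV[int]_d), 0 < L -> exists c : E,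
    (mu [set x | cube L n m x /\
        (Lam%:E * dilate_mean_sum alpha f (corner L n m) (side L n) < `|T f x - c|%:E)%E]
      <= eps%:E * mu (cube L n m))%E /\
    ((forall x, ~ dilate (corner L n m) (side L n) 0 x -> f x = 0) -> c = 0).
Proof.
move=> p1 alpha01 eps0.
have p0 : 0 < p by apply: lt_trans p1.
have e3 : 0 < eps / 3 ^+ d by rewrite divr_gt0// exprn_gt0.
have [Lam0 [Lam00 weak]] := @weak_type R d' p alpha N CK _ p1 alpha01 e3.
have C10 : 0 <= kernel_const d CK by exact: kernel_const_ge0.
exists (3 ^+ d * Lam0 + kernel_const d CK); split.
  by rewrite ltr_wpDr// mulr_gt0// exprn_gt0.
move=> E T Tcz f B A mf fB cf mA Afin fA L n m L0.
have [Tlin TN _] := Tcz.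
have B0 : 0 <= B := le_trans (normr_ge0 (f 0)) (fB 0).
set a := corner L n m; set l := side L n.
have l0 : 0 < l by exact: side_gt0.
set D := dilate a l 0; have mD : msets D by exact: fattened_measurable.
set Q := cube L n m.
have QE : Q = fattened a l 0 by exact: cube_fattened.
have mfE := measurable_norm_EFin mf.
pose f2 := cutoff (~` D) f.
have mf2 : strongly_measurable f2.
  by apply: strongly_measurable_cutoff => //; exact: measurableC.
have f2f x : `|f2 x| <= `|f x|.
  by rewrite /f2 /cutoff; case: ifP => // _; rewrite normr0.
have f2B x : `|f2 x| <= B := le_trans (f2f x) (fB x).
have f2f0 x : f x = 0 -> f2 x = 0 by move=> fx; rewrite /f2 cutoffE fx scaler0.
have f2D x : D x -> f2 x = 0.
  by move=> Dx; rewrite /f2 /cutoff memNset// => /(_ Dx).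
have cf2 : compact (closed_support f2).
  by apply: (subclosed_compact _ cf); [exact: closed_closure|exact: closed_support_sub].
have aQ : fattened a l 0 a by rewrite -QE; exact: corner_cube.
exists (T f2 a); split; last first.
  (* A function that vanishes off the tripled cube has zero far part, and the
     image of zero is zero at the corner by the kernel formula, which holds
     there and not only almost everywhere. *)
  move=> f0; have f20 : f2 = fun=> 0.
    apply/funext => x; have [Dx|nDx] := pselect (D x); first exact: f2D.
    by apply: f2f0; exact: f0.
  have [_ _ [K [sK TK]]] := Tcz.
  have bf2 : bounded_fun f2 by apply/bounded_fun_normP; exists B.
  have := TK f2 mf2 bf2 cf2 a.
  have na : ~ closed_support f2 a.
    by apply: (not_closed_support ltr01) => y _; rewrite f20.
  move=> /(_ na)/bochner_approx_integral Kf2.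
  have s0 : @is_simple R d E [::] by [].
  have m0 : measurable_fun [set: LT] (fun=> 0 : \bar R) by exact: measurable_cst.
  have := bochner_dist_le Kf2 (bochner_approx_simple s0) m0 _.
  rewrite /simple_integral big_nil subr0 integral0 => H.
  have : (`|T f2 a|%:E <= 0)%E.
    apply: H => x; rewrite /simple_val big_nil f20 linear0 subr0 normr0.
    exact: lexx.
  by rewrite lee_fin normr_le0 => /eqP.
have [r [ur rsize rD]] := neighbour_cubes n m L0.
pose h i := cutoff (cube L n i) f.
have hE i x : h i x = (\1_(cube L n i) x : R) *: f x by exact: cutoffE.
have sumE (r' : seq 'rV[int]_d) x : \sum_(i <- r') h i x =
    (\sum_(i <- r') \1_(cube L n i) x : R) *: f x.
  by rewrite scaler_suml; apply: eq_bigr => i _.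
have Lsum (r' : seq 'rV[int]_d) : Lp p (fun x => \sum_(i <- r') h i x).
  apply: (@Lp_bounded _ _ _ _ _ A ((size r')%:R * B)) => //.
  - rewrite (_ : (fun x => _) = (fun x => (\sum_(i <- r') \1_(cube L n i) x : R) *: f x)).
      apply: (strongly_measurable_step_comb (n := n) (L := L)
        (phi := fun (k : R) w => k *: w)) => //.
        by move=> k w; exact: scaler_continuous.
      move=> x y xy; apply: eq_bigr => i _; rewrite !indicE; congr ((_ : bool)%:R).
      by apply/idP/idP; rewrite !inE /cube /= xy.
    by apply/funext => x; exact: sumE.
  - move=> x; apply: (le_trans (ler_norm_sum _ _ _)).
    apply: (@le_trans _ _ (\sum_(i <- r') B)); last first.
      by rewrite big_const_seq count_predT iter_addr_0 mulr_natl.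
    apply: ler_sum => i _; rewrite /h /cutoff; case: ifP => _; first exact: fB.
    by rewrite normr0.
  - by move=> x nAx; rewrite sumE fA// scaler0.
have mh i : strongly_measurable (h i).
  by apply: strongly_measurable_cutoff => //; exact: cube_measurable.
have hB i x : `|h i x| <= B.
  by rewrite /h /cutoff; case: ifP => _; rewrite ?normr0//.
have Lh i : Lp p (h i).
  apply: (Lp_bounded p0 (mh i) mA Afin (hB i)) => x nAx.
  by rewrite hE fA// scaler0.
pose f1 x := \sum_(i <- r) h i x.
have f1D x : D x -> f1 x = f x.
  move=> /rD xr; rewrite /f1 (bigD1_seq (idx L n x))//= hE indicE mem_set// scale1r.
  rewrite big1 ?addr0// => i ix; rewrite hE indicE memNset ?scale0r// => xi.
  by move: ix; rewrite -(xi : idx L n x = i) eqxx.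
have f1N x : ~ D x -> f1 x = 0.
  move=> nD; rewrite /f1 big_seq big1// => i ir; rewrite hE indicE memNset ?scale0r//.
  by move=> xi; apply: nD; apply/rD; rewrite (xi : idx L n x = i).
have ff x : f1 x + f2 x = f x.
  have [Dx|nDx] := pselect (D x); first by rewrite f1D// f2D// addr0.
  by rewrite f1N// add0r /f2 /cutoff mem_set.
pose J := (\int[mu]_(x in D) `|f x|%:E)%E.
have J0 : (0 <= J)%E by apply: integral_ge0 => x _; rewrite lee_fin.
have Jfin : J \is a fin_num.
  rewrite ge0_fin_numE//; apply: (@le_lt_trans _ _ (\int[mu]_(x in D) (cst B%:E x))%E).
    apply: (ge0_le_integral mu mD) => [x _||| x _].
    - by rewrite lee_fin.
    - exact: measurable_funTS.
    - exact: measurable_cst.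
    - by rewrite lee_fin; exact: fB.
  rewrite integral_cst// lte_mul_pinfty//.
  by apply: le_lt_trans (lebesgue_dilate_le _ _ l0) _; rewrite ltry.
pose tau := l ^- d * fine J.
have tau0 : 0 <= tau by rewrite mulr_ge0 ?fine_ge0// invr_ge0 exprn_ge0// ltW.
have muE i : mu (cube L n i) = (l ^+ d)%:E by exact: lebesgue_cube.
have hJ i : i \in r -> (\int[mu]_x `|h i x|%:E <= tau%:E * mu (cube L n i))%E.
  move=> ir; rewrite muE /tau -EFinM mulrC mulrA mulfV ?mul1r ?fineK//; last first.
    by rewrite expf_neq0// gt_eqF.
  rewrite /J (integral_cutoff _ mD); apply: (ge0_le_integral mu measurableT) => [x _||| x _].
  - by rewrite lee_fin.
  - exact: measurable_norm_EFin.
  - apply: emeasurable_funM; last exact: mfE.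
    by apply/measurable_EFinP; exact: measurable_indic.
  rewrite -EFinM lee_fin /h /cutoff; case: ifPn => [/set_mem xi|_].
    by rewrite indicE mem_set ?mul1r//; apply/rD; rewrite (xi : idx L n x = i).
  by rewrite normr0 mulr_ge0.
pose X i := [set x | (Lam0 * tau < `|T (h i) x|)%R].
have muX i : i \in r -> (mu (X i) <= (eps / 3 ^+ d)%:E * mu Q)%E.
  move=> ir; have := weak E T Tcz l i (h i) B tau l0 (mh i) _ (hB i) tau0.
  rewrite -(cube_rescale L n i) !muE; apply; last by rewrite -(muE i); exact: hJ.
  by move=> x nx; rewrite hE indicE memNset// scale0r.
have Lf2 : Lp p f2.
  by apply: (Lp_bounded p0 mf2 mA Afin f2B) => x nAx; apply: f2f0; exact: fA.
have Tadd := operator_add Tlin (Lsum r) Lf2.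
rewrite (_ : (fun y => \sum_(i <- r) h i y + f2 y) = f) in Tadd; last first.
  by apply/funext => x; exact: ff.
have Tsum := operator_sum r p0 Tlin Lh Lsum.
set S0 := [set x | _] in Tadd; set S1 := [set x | _] in Tsum.
set bad := [set x | _].
(* The mean over the tripled cube is the first term of the sum. *)
have tau_le : (tau%:E <= dilate_mean_sum alpha f a l)%E.
  rewrite /dilate_mean_sum (@nneseriesD1 _ _ 0)//; last first.
    by move=> k _; rewrite mule_ge0 ?lee_fin ?decay_ge0// dilate_mean_ge0.
  rewrite [X in (_ <= X + _)%E](_ : _ = tau%:E); last first.
    by rewrite expr0 mul1e /dilate_mean expr0 mul1r /tau EFinM fineK.
  rewrite leeDl//; apply: nneseries_ge0 => k _ _.
  by rewrite mule_ge0 ?lee_fin ?decay_ge0// dilate_mean_ge0.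
have cover : bad `<=` S0 `|` (S1 `|` [set x | exists2 i, i \in r & X i x]).
  move=> x [Qx hx].
  have [Tx|] := pselect (T f x = T f1 x + T f2 x); last by left.
  have [Ts|] := pselect (T f1 x = \sum_(i <- r) T (h i) x); last by right; left.
  right; right; apply: contrapT => nX; move: hx; apply/negP; rewrite -leNgt.
  have far : (`|T f2 x - T f2 a|%:E <=
      (kernel_const d CK)%:E * dilate_mean_sum alpha f a l)%E.
    apply: (le_trans (far_part_oscillation alpha01 Tcz mf2 f2B cf2 l0 f2D _ aQ)).
      by rewrite -QE.
    rewrite lee_wpmul2l ?lee_fin//; exact: dilate_mean_sum_le.
  have near_part : `|T f1 x| <= 3 ^+ d * Lam0 * tau.
    rewrite Ts; apply: (le_trans (ler_norm_sum _ _ _)).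
    apply: (@le_trans _ _ (\sum_(i <- r) Lam0 * tau)).
      rewrite big_seq [leRHS]big_seq; apply: ler_sum => i ir.
      by rewrite leNgt; apply/negP => Xi; apply: nX; exists i.
    rewrite big_const_seq count_predT iter_addr_0 -mulrA -[leLHS]mulr_natl.
    apply: ler_wpM2r; first exact: (mulr_ge0 (ltW Lam00) tau0).
    by rewrite -natrX ler_nat.
  have tri : (`|T f x - T f2 a|%:E <= `|T f1 x|%:E + `|T f2 x - T f2 a|%:E)%E.
    by rewrite -EFinD lee_fin Tx -addrA ler_normD.
  apply: (le_trans tri); rewrite EFinD ge0_muleDl ?lee_fin//; last first.
    by rewrite mulr_ge0 ?exprn_ge0 ?(ltW Lam00).
  apply: leeD; last exact: far.
  apply: (@le_trans _ _ ((3 ^+ d * Lam0)%:E * tau%:E)%E).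
    by rewrite -EFinM lee_fin.
  by rewrite lee_wpmul2l// lee_fin mulr_ge0 ?exprn_ge0 ?(ltW Lam00).
apply: (le_trans (mu_le cover)); apply: (le_trans (muU_le _ _)).
rewrite Tadd add0e; apply: (le_trans (muU_le _ _)); rewrite Tsum add0e.
apply: (le_trans (mu_seq_union_le _ _)).
apply: (@le_trans _ _ (\sum_(i <- r) (eps / 3 ^+ d * l ^+ d)%:E)%E).
  rewrite big_seq [leRHS]big_seq; apply: lee_sum => i ir.
  by rewrite EFinM -(muE m); exact: muX.
rewrite sumEFin muE -EFinM lee_fin big_const_seq count_predT iter_addr_0.
rewrite -mulrnAl ler_wpM2r ?exprn_ge0 ?(ltW l0)//.
rewrite -[leLHS]mulr_natr mulrAC ler_pdivrMr ?exprn_gt0// ler_wpM2l ?(ltW eps0)//.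
by rewrite -natrX ler_nat.
Qed.

End oscillation_estimate.

(** * Stopping cubes *)

Lemma quarters_lt (R : realType) (e V : R) : 0 < e -> e <= 4^-1 -> 0 < V ->
  4^-1 * V + e / 2 * V < V.
Proof.
move=> e0 e4 V0; have : e * V <= 4^-1 * V by rewrite ler_wpM2r// ltW.
have := mulr_gt0 e0 V0; lra.
Qed.

Section stopping.
Context (R : realType) (d' : nat) (E : normedModType R).
Local Notation d := d'.+1.
Local Notation pt := 'rV[R]_d.
Local Notation mu := (lebesgue_rV R d).
Local Notation msets := (measurable : set (set (lebesgue_type R d))).
Local Notation label := (nat * 'rV[int]_d)%type.
Local Notation tcube L t := (cube L t.1 t.2).
Context (L : R) (F : pt -> E) (c : label -> E) (b : label -> \bar R).
Hypotheses (L0 : 0 < L) (b0 : forall t, (0 <= b t)%E).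

(** The fraction of a cell that the exceptional set of the last stopping cube
    must exceed for the cell to stop. A child of a cell that did not stop is
    filled to at most [2 ^ d * delta = 1 / 4], which leaves room for a second
    exceptional set in [stopping_value_le]. *)
Definition stop_ratio : R := 2 ^- (d.+2).

Local Notation delta := stop_ratio.

Definition bad_set t : set pt := [set x | tcube L t x /\ (b t < `|F x - c t|%:E)%E].

Hypothesis mbad : forall t, msets (bad_set t).
Hypothesis bad_small : forall t, (mu (bad_set t) <= (delta / 2)%:E * mu (tcube L t))%E.

Local Notation lab n x := (n, idx L n x).

(** The generation of the last stopping cube around [x] that is not later
    than [n]. A recursion on generations replaces the usual recursion on
    families of stopping cubes. *)
Fixpoint last_stop (n : nat) (x : pt) : nat :=
  if n is n'.+1 then
    let q := last_stop n' x in
    if `[< (delta%:E * mu (cell L n x) < mu (bad_set (lab q x) `&` cell L n x))%E >]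
    then n else q
  else 0.

Definition stopping_cubes : set label :=
  [set t | exists2 x, idx L t.1 x = t.2 & last_stop t.1 x = t.1].

(** The points of the cube that lie in no later stopping cube: the disjoint
    major parts that make the stopping cubes nearly disjoint. *)
Definition final_part t : set pt :=
  [set y | tcube L t y /\ forall n, (t.1 <= n)%N -> last_stop n y = t.1].

Lemma stop_ratio_bounds : 0 < delta /\ 2 ^+ d * delta = 4^-1 /\ delta <= 4^-1.
Proof.
have p0 : (0 : R) < 2 ^+ d by rewrite exprn_gt0.
have e : 2 ^+ d * delta = 4^-1.
  have -> : delta = 2 ^- (d + 2) by rewrite /delta addn2.
  rewrite exprD invfM mulrA mulfV ?gt_eqF// mul1r.
  by rewrite expr2 -natrM.
split; first by rewrite invr_gt0 exprn_gt0.
split => //; rewrite -e ler_peMl ?invr_ge0 ?exprn_ge0//.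
by rewrite exprn_ege1// ler1n.
Qed.

Lemma last_stop_le n x : (last_stop n x <= n)%N.
Proof. by elim: n => //= n IH; case: ifP => // _; exact: leqW. Qed.

Lemma last_stop_cell n x y : idx L n x = idx L n y -> last_stop n x = last_stop n y.
Proof.
elim: n => //= n IH xy; have xyn := idx_le L0 (leqnSn n) xy.
rewrite (IH xyn) (idx_le L0 (last_stop_le n y) xyn) /cell.
by rewrite xy.
Qed.

Lemma stopping_cubesP n x : stopping_cubes (lab n x) <-> last_stop n x = n.
Proof.
split=> [[y /= yx ny]|nx]; last by exists x.
by rewrite -[RHS]ny; apply: last_stop_cell.
Qed.

Lemma last_stop_idem n x : last_stop (last_stop n x) x = last_stop n x.
Proof. by elim: n => //= n IH; case: ifPn => //= ->. Qed.

Lemma last_stop_homo n k x : (n <= k)%N -> (last_stop n x <= last_stop k x)%N.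
Proof.
move=> /subnK <-; elim: (k - n)%N => // j IH; rewrite addSn /=.
case: ifP => // _; apply: (leq_trans IH); apply: leqW.
exact: last_stop_le.
Qed.

Lemma last_stop_continue n x : (last_stop n x < n)%N ->
  (mu (bad_set (lab (last_stop n x) x) `&` cell L n x) <= delta%:E * mu (cell L n x))%E.
Proof.
case: n => //= n; case: ifPn => [|/asboolP/negP]; first by rewrite ltnn.
by rewrite -leNgt.
Qed.

Lemma last_stop_stop n x : last_stop n.+1 x = n.+1 ->
  (delta%:E * mu (cell L n.+1 x) < mu (bad_set (lab (last_stop n x) x) `&` cell L n.+1 x))%E.
Proof.
move=> /=; case: ifPn => [/asboolP//|_ h].
by have := last_stop_le n x; rewrite h ltnn.
Qed.

Lemma cell_invariant_measurable n (A : set pt) :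
  (forall x y, idx L n x = idx L n y -> A x -> A y) -> msets A.
Proof.
move=> Ainv; rewrite (_ : A = cells_union L [set t | t.1 = n /\
    exists2 x, A x & idx L n x = t.2]); first exact: cells_union_measurable.
apply/seteqP; split => [x Ax|x [[k m] /= [-> [y Ay yx]] xm]].
  by exists (lab n x) => //; split => //; exists x.
by apply: (Ainv y) => //; rewrite yx -xm.
Qed.

Lemma final_part_measurable t : msets (final_part t).
Proof.
rewrite (_ : final_part t = tcube L t `&` \bigcap_n
    [set y | (t.1 <= n)%N -> last_stop n y = t.1]).
  apply: measurableI; first exact: cube_measurable.
  apply: bigcapT_measurable => n; apply: (@cell_invariant_measurable n) => x y xy /=.
  by rewrite (last_stop_cell xy).
apply/seteqP; split => [y [ty h]|y [ty h]]; first by split => // n _ /=; exact: h.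
by split => // n tn; apply: h.
Qed.

Lemma mu_cube_finite t : (mu (tcube L t) < +oo)%E.
Proof. by rewrite lebesgue_cube// ltry. Qed.

(** The points outside lie in later stopping cubes; the first ones below [t]
    are filled to more than [delta] by the exceptional set of [t], which
    fills at most [delta / 2] of [t]. *)
Lemma mu_outside_final_part t : stopping_cubes t ->
  (mu (tcube L t `\` final_part t) <= 2^-1%:E * mu (tcube L t))%E.
Proof.
move=> [x xt xq]; have [d0 _] := stop_ratio_bounds.
pose G := [set s : label | (delta%:E * mu (tcube L s) <= mu (bad_set t `&` tcube L s))%E].
have cov : tcube L t `\` final_part t `<=` cells_union L G.
  move=> y [ty nF].
  have yq : last_stop t.1 y = t.1 by rewrite -[RHS]xq; apply: last_stop_cell; rewrite xt.
  have ex : exists n, `[< (t.1 <= n)%N /\ last_stop n y <> t.1 >].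
    apply: contrapT => /forallNP nex; apply: nF; split => // n tn.
    by apply: contrapT => ny; apply: (nex n); apply/asboolP.
  case: (ex_minnP ex) => n /asboolP[tn ny] nmin.
  have {tn} tn : (t.1 < n)%N.
    by rewrite ltn_neqAle tn andbT; apply/eqP => tn'; apply: ny; rewrite -tn'.
  case: n tn ny nmin => // n; rewrite ltnS => tn ny nmin.
  have ny' : last_stop n y = t.1.
    apply: contrapT => h; have : (n.+1 <= n)%N by apply: nmin; apply/asboolP.
    by rewrite ltnn.
  have nS : last_stop n.+1 y = n.+1.
    by move: ny => /=; case: ifP => // _; rewrite ny'.
  exists (lab n.+1 y) => //; have := last_stop_stop nS.
  by rewrite ny' (ty : idx L t.1 y = t.2) -surjective_pairing => /ltW.
have : (delta%:E * mu (cells_union L G) <= mu (bad_set t))%E.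
  by apply: mu_cells_union_ge => //; exact: ltW.
move=> /le_trans/(_ (bad_small t)).
rewrite (EFinM delta) -muleA lee_pmul2l ?lte_fin// => h.
exact: le_trans (mu_le cov) h.
Qed.

Lemma mu_final_part t : stopping_cubes t ->
  (2^-1%:E * mu (tcube L t) <= mu (final_part t))%E.
Proof.
move=> St; have := mu_outside_final_part St.
have FQ : final_part t `<=` tcube L t by move=> y [].
have := mu_splitD (tcube L t) (final_part_measurable t).
rewrite (setIidr FQ).
have f1 := mu_fin_num (mu_lty_sub FQ (mu_cube_finite t)).
have f2 := mu_fin_num (mu_lty_sub (@subDsetl _ _ (final_part t)) (mu_cube_finite t)).
rewrite -(fineK f1) -(fineK f2) lebesgue_cube// -EFinD -!EFinM !lee_fin => -[].
by move: (fine _) (fine _) (_ ^+ _) => u v w; lra.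
Qed.

Lemma final_part_disjoint t t' : t <> t' -> final_part t `&` final_part t' = set0.
Proof.
move=> tt'; apply/seteqP; split => // y [[ty h] [ty' h']]; apply: tt'.
have e : t.1 = t'.1.
  by rewrite -(h (maxn t.1 t'.1)) ?leq_maxl// h'// leq_maxr.
rewrite [t]surjective_pairing [t']surjective_pairing -(ty : idx _ _ _ = _).
by rewrite -(ty' : idx _ _ _ = _) e.
Qed.

(** Such a point lies outside the final part of each of its stopping cubes,
    so the set takes at most half of arbitrarily small cells around each of
    its points. *)
Lemma infinitely_many_stops_null :
  mu [set y | forall q, ~ (forall n, (q <= n)%N -> last_stop n y = q)] = 0%E.
Proof.
apply: (@sparse_everywhere_null _ _ L _ 2^-1) => //.
  by rewrite invf_lt1// ltr1n.
move=> y n0 yinf.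
have [n1 [qn1 nq]] : exists n, (last_stop n0 y <= n)%N /\ last_stop n y <> last_stop n0 y.
  apply: contrapT => /forallNP nex; apply: (yinf (last_stop n0 y)) => n qn.
  by apply: contrapT => h; apply: (nex n).
have n01 : (n0 < n1)%N.
  rewrite ltnNge; apply/negP => n10; apply: nq; apply/eqP; rewrite eqn_leq.
  by rewrite last_stop_homo//= -{1}last_stop_idem last_stop_homo.
have qk : (last_stop n0 y < last_stop n1 y)%N.
  by rewrite ltn_neqAle last_stop_homo ?(ltnW n01)// andbT; apply/eqP => /esym.
set k := last_stop n1 y in qk.
have kk : last_stop k y = k by exact: last_stop_idem.
have n0k : (n0 <= k)%N.
  rewrite leqNgt; apply/negP => /ltnW/(last_stop_homo y); rewrite kk.
  by rewrite leqNgt qk.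
exists k => //; have Sk := (stopping_cubesP k y).2 kk.
apply: le_trans (mu_outside_final_part Sk); apply: mu_le => z [zinf yz].
by split => // -[_ /zinf].
Qed.

(** No later cell around a point of the final part stops, so the exceptional
    set takes at most the fraction [delta] of all small cells around it. *)
Lemma final_part_bad_null t : mu (final_part t `&` bad_set t) = 0%E.
Proof.
have [_ [_ d4]] := stop_ratio_bounds.
apply: (@sparse_everywhere_null _ _ L _ delta) => //.
  by apply: (le_lt_trans d4); rewrite invf_lt1// ltr1n.
move=> y n0 [[ty h] _]; exists (maxn n0 t.1.+1); first exact: leq_maxl.
set n := maxn _ _; have tn : (t.1 < n)%N by rewrite leq_maxr.
have hn := h n (ltnW tn).
have := @last_stop_continue n y; rewrite hn => /(_ tn).
rewrite (ty : idx L t.1 y = t.2) -surjective_pairing => H.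
by apply: (le_trans _ H); apply: mu_le => z [[_ ?] ?].
Qed.

(** A common good point of two consecutive stopping cubes compares their
    constants. It exists because the parent of the smaller cube did not stop,
    or is itself the larger one: the exceptional set of the larger cube fills
    at most a quarter of the smaller, whose own exceptional set is smaller
    still. *)
Lemma stopping_value_le n x : last_stop n.+1 x = n.+1 ->
  (`|c (lab n.+1 x) - c (lab (last_stop n x) x)|%:E <=
    b (lab (last_stop n x) x) + b (lab n.+1 x))%E.
Proof.
move=> nS; set q := last_stop n x; set t := lab n.+1 x; set tq := lab q x.
have [d0 [d2 d4]] := stop_ratio_bounds.
pose V := side L n.+1 ^+ d; have V0 : 0 < V by rewrite exprn_gt0// side_gt0.
have muV : mu (tcube L t) = V%:E by exact: lebesgue_cube.
have muP : mu (cell L n x) = (2 ^+ d * V)%:E.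
  rewrite [mu _]lebesgue_cube// (sideS L n); congr (_%:E).
  by rewrite [(2 * _) ^+ _]exprMn.
have parent : (mu (bad_set tq `&` cell L n x) <= (delta * (2 ^+ d * V))%:E)%E.
  have [qn|] := ltnP q n.
    by have := last_stop_continue qn; rewrite muP -EFinM.
  rewrite leq_eqVlt ltnNge last_stop_le orbF => /eqP nq.
  apply: (@le_trans _ _ (mu (bad_set tq))); first by apply: mu_le => z [].
  apply: (le_trans (bad_small _)).
  rewrite /tq -nq [mu _]muP -EFinM lee_fin; apply: ler_wpM2r.
    by apply: mulr_ge0 (ltW V0); exact: exprn_ge0.
  by rewrite ler_pdivrMr// ler_peMr ?(ltW d0)// ler1n.
have [z [tz nz]] : exists z, tcube L t z /\ ~ (bad_set tq z \/ bad_set t z).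
  apply: contrapT => /forallNP nex.
  have cov : tcube L t `<=` (bad_set tq `&` cell L n x) `|` bad_set t.
    move=> z tz; have := nex z => /not_andP[//|/contrapT[bz|bz]]; [left|by right].
    by split => //; apply: (idx_le L0 (leqnSn n)).
  have := le_trans (mu_le cov) (le_trans (muU_le _ _) (leeD parent (bad_small t))).
  rewrite muV -EFinM -EFinD lee_fin leNgt => /negP; apply.
  have : delta * (2 ^+ d * V) = 4^-1 * V by rewrite mulrA [delta * _]mulrC d2.
  by move=> ->; exact: quarters_lt.
have tqz : tcube L tq z.
  have qn1 : (q <= n.+1)%N by apply: leqW; exact: last_stop_le.
  exact: (idx_le L0 qn1 tz).
have zq : (`|F z - c tq|%:E <= b tq)%E.
  by rewrite leNgt; apply/negP => h; apply: nz; left.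
have zt : (`|F z - c t|%:E <= b t)%E.
  by rewrite leNgt; apply/negP => h; apply: nz; right.
apply: le_trans (leeD zq zt); rewrite -EFinD lee_fin.
have -> : c t - c tq = (F z - c tq) - (F z - c t).
  by rewrite opprB [RHS]addrC subrKA.
exact: ler_normB.
Qed.

Definition stopping_sum n x : \bar R :=
  (\sum_(0 <= k < n.+1)
     if `[< stopping_cubes (lab k x) >] then 2%:E * b (lab k x) else 0)%E.

(** Telescoping. Each bound occurs at most twice, once as the larger and once
    as the smaller cube of a pair; keeping [b] of the last cube on the left
    pays for the next pair and for the final comparison with [F]. *)
Lemma stopping_chain n x :
  (`|c (lab (last_stop n x) x)|%:E + b (lab (last_stop n x) x) <=
   `|c (lab 0 x)|%:E + stopping_sum n x)%E.
Proof.
have S0 y : stopping_cubes (lab 0 y) by apply/stopping_cubesP.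
elim: n => [|n IH].
  rewrite /stopping_sum big_nat1 asboolT//= leeD2l//.
  by rewrite mule_natl mule2n leeDl.
have -> : (stopping_sum n.+1 x = stopping_sum n x +
    if `[< stopping_cubes (lab n.+1 x) >] then 2%:E * b (lab n.+1 x) else 0)%E.
  by rewrite /stopping_sum big_nat_recr.
have [nS|nN] := eqVneq (last_stop n.+1 x) n.+1.
  rewrite asboolT; last exact/stopping_cubesP.
  rewrite nS addeA; apply: le_trans (leeD IH (lexx _)).
  rewrite mule_natl mule2n addeA leeD2r//.
  rewrite -addeA; apply: le_trans (leeD (lexx _) (stopping_value_le nS)).
  rewrite -EFinD lee_fin; apply: le_trans (ler_normD _ _).
  by rewrite addrC subrK.
have -> : last_stop n.+1 x = last_stop n x.
  by move: nN => /=; case: ifP => //; rewrite eqxx.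
apply: (le_trans IH); rewrite addeA leeDl//; case: ifP => // _.
by rewrite mule_ge0.
Qed.

Lemma stopping_bound :
  mu [set x | ~ exists n, (`|F x|%:E <= `|c (lab 0 x)|%:E + stopping_sum n x)%E] = 0%E.
Proof.
pose Z1 := [set y | forall q, ~ (forall n, (q <= n)%N -> last_stop n y = q)].
pose Z2 k := if pickle_inv k is Some t then final_part t `&` bad_set t else set0.
have cov : [set x | ~ exists n, (`|F x|%:E <= `|c (lab 0 x)|%:E + stopping_sum n x)%E]
    `<=` Z1 `|` \bigcup_k Z2 k.
  move=> x nx; have [|] := pselect (Z1 x); [by left|move=> /existsNP[q /contrapT qx]].
  right; exists (pickle (lab q x)) => //; rewrite /Z2 pickleK_inv.
  split; [by split|split; [by []|]]; rewrite ltNge; apply/negP => Fx.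
  apply: nx; exists q; apply: le_trans (stopping_chain q x).
  rewrite (qx q (leqnn q)); apply: le_trans (leeD (lexx _) Fx).
  by rewrite -EFinD lee_fin; apply: le_trans (ler_normD _ _); rewrite addrC subrK.
apply/eqP; rewrite eq_le lebesgue_outer_ge0 andbT.
apply: (le_trans (mu_le cov)); apply: (le_trans (muU_le _ _)).
rewrite [X in (X + _)%E]infinitely_many_stops_null add0e.
apply: (le_trans (mu_bigcup_le _)); rewrite eseries0// => k _ _.
by rewrite /Z2; case: pickle_inv => [t|]; [exact: final_part_bad_null|exact: measure0].
Qed.

End stopping.

(** * Translated dyadic systems and the one-third trick *)

Section shifted_grids.
Context (R : realType).

(** [w] is the side of the grid, [s] the sign of its shift, and [t / 3] the
    amount. *)
Definition wall (w s : R) (t : 'I_3) (z : int) : R := w * (z%:~R + s * (t%:R / 3)).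

Definition crossed (w s al be : R) (t : 'I_3) : Prop :=
  exists z, al < wall w s t z < be.

(** The walls of the three shifts together are spaced by [w / 3]. *)
Lemma crossed_unique (w s al be : R) t t' : 0 < w -> s = 1 \/ s = -1 ->
  be - al <= w / 3 -> crossed w s al be t -> crossed w s al be t' -> t = t'.
Proof.
move=> w0 s1 le3 [z /andP[h1 h2]] [z' /andP[h3 h4]].
have s2 : s * s = 1 by case: s1 => ->; rewrite ?mulr1 // mulrNN mulr1.
pose D : int := 3 * (z - z') + (if s == 1 then 1 else -1) * ((t : nat)%:Z - (t' : nat)%:Z).
have DE : wall w s t z - wall w s t' z' = w / 3 * D%:~R.
  rewrite /wall /D intrD !intrM intrB intrB -!pmulrn.
  have -> : ((if s == 1 then 1 else -1 : int)%:~R : R) = s.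
    case: s1 => ->; first by rewrite eqxx.
    by rewrite eqNr oner_eq0 intrN.
  move: (z%:~R : R) (z'%:~R : R) (t%:R : R) (t'%:R : R) => u1 u2 u3 u4.
  have -> : w / 3 * (3 * (u1 - u2) + s * (u3 - u4)) =
      w * (u1 - u2) + w * s * (u3 - u4) / 3 by field.
  by field.
have lt1 : `|D%:~R : R| < 1.
  have w3 : 0 < w / 3 by rewrite divr_gt0.
  rewrite -(ltr_pM2l w3) mulr1 -[X in X * _](gtr0_norm w3) -normrM -DE.
  by apply: lt_le_trans le3; rewrite ltr_norml; apply/andP; split; lra.
have D0 : D = 0.
  apply/eqP; rewrite -normr_le0.
  move: lt1; rewrite -intr_norm -[1]/(1%:~R) ltr_int; lia.
apply: val_inj; have := ltn_ord t; have := ltn_ord t'; move: D0; rewrite /D /=.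
by case: ifP => _; lia.
Qed.

Lemma not_crossed (w s al be : R) t : 0 < w -> ~ crossed w s al be t ->
  exists z, wall w s t z <= al /\ be <= wall w s t z + w.
Proof.
move=> w0 nc; pose z := Num.floor (al / w - s * (t%:R / 3)).
have /andP[f1 f2] := floor_itv (al / w - s * (t%:R / 3)).
exists z; split.
  by rewrite /wall mulrC -ler_pdivlMr// -lerBrDr.
rewrite leNgt; apply/negP => h; apply: nc; exists (z + 1); apply/andP; split.
  by rewrite /wall mulrC -ltr_pdivrMr// -ltrBlDr.
by apply: le_lt_trans h; rewrite /wall intrD; lra.
Qed.

(** Pigeonhole: two scales exclude at most two of the three shifts. *)
Lemma avoid_two (P Q : 'I_3 -> Prop) :
  (forall t t', P t -> P t' -> t = t') -> (forall t t', Q t -> Q t' -> t = t') ->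
  exists t, ~ P t /\ ~ Q t.
Proof.
move=> P1 Q1; apply: contrapT => /forallNP h.
have h' t : P t \/ Q t.
  by have /not_andP[/contrapT|/contrapT] := h t; [left|right].
pose t0 : 'I_3 := @Ordinal 3 0 isT; pose t1 : 'I_3 := @Ordinal 3 1 isT.
pose t2 : 'I_3 := @Ordinal 3 2 isT.
have n01 : t0 <> t1 by move=> /(congr1 val).
have n02 : t0 <> t2 by move=> /(congr1 val).
have n12 : t1 <> t2 by move=> /(congr1 val).
case: (h' t0) => a0; case: (h' t1) => a1; case: (h' t2) => a2.
- exact: n01 (P1 _ _ a0 a1).
- exact: n01 (P1 _ _ a0 a1).
- exact: n02 (P1 _ _ a0 a2).
- exact: n12 (Q1 _ _ a1 a2).
- exact: n12 (P1 _ _ a1 a2).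
- exact: n02 (Q1 _ _ a0 a2).
- exact: n01 (Q1 _ _ a0 a1).
- exact: n01 (Q1 _ _ a0 a1).
Qed.

End shifted_grids.

Section dyadic_cubes.
Context (R : realType) (d' : nat).
Local Notation d := d'.+1.
Local Notation pt := 'rV[R]_d.
Local Notation mu := (lebesgue_rV R d).
Local Notation msets := (measurable : set (set (lebesgue_type R d))).
Local Notation dcube := (@dyadic_cube R d).
Local Notation danc := (@dyadic_ancestor R d).
Implicit Types (u : 'rV['I_3]_d) (j : int) (m : 'rV[int]_d) (a x : pt).

Definition dyadic_side j : R := (2 : R) ^ (- j).
Definition dyadic_sign j : R := (-1 : R) ^ j.

Lemma dyadic_side_gt0 j : 0 < dyadic_side j.
Proof. by rewrite /dyadic_side exprz_gt0. Qed.

Lemma dyadic_signP j : dyadic_sign j = 1 \/ dyadic_sign j = -1.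
Proof.
rewrite /dyadic_sign; case: j => n; rewrite ?NegzE -?exprnN -?exprnP.
  by rewrite -signr_odd; case: (odd n); [right|left].
by rewrite -signr_odd; case: (odd _); [right; rewrite expr1 invrN1|left; rewrite expr0 invr1].
Qed.

Definition dyadic_corner u j m : pt :=
  \row_i wall (dyadic_side j) (dyadic_sign j) (u ord0 i) (m ord0 i).

Lemma dyadic_cube_fattened u j m :
  dcube u j m = fattened (dyadic_corner u j m) (dyadic_side j) 0.
Proof.
have w0 := dyadic_side_gt0 j.
apply/seteqP; split => [_ [y y01 <-] i|x xc].
  have := y01 i; rewrite !mxE /wall -/(dyadic_side j) -/(dyadic_sign j) subr0 addr0.
  move=> /andP[h1 h2].
  have := mulr_ge0 (ltW w0) h1.
  have := h2; rewrite -(ltr_pM2l w0) mulr1.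
  by move=> *; apply/andP; split; lra.
exists (\row_i ((x ord0 i - dyadic_corner u j m ord0 i) / dyadic_side j)).
  move=> i; rewrite mxE; have := xc i; rewrite subr0 addr0 => /andP[h1 h2].
  by rewrite divr_ge0 ?subr_ge0 ?(ltW w0)//= ltr_pdivrMr// mul1r ltrBlDl.
apply/rowP => i; rewrite !mxE /wall -/(dyadic_side j) -/(dyadic_sign j).
by field; rewrite gt_eqF.
Qed.

Lemma dyadic_cube_measurable u j m : msets (dcube u j m).
Proof. by rewrite dyadic_cube_fattened; exact: fattened_measurable. Qed.

Lemma lebesgue_dyadic_cube u j m : mu (dcube u j m) = (dyadic_side j ^+ d)%:E.
Proof.
by rewrite dyadic_cube_fattened lebesgue_fattened !addr0// ltW// dyadic_side_gt0.
Qed.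

Lemma dyadic_cube_nonempty u j m : dcube u j m (dyadic_corner u j m).
Proof.
rewrite dyadic_cube_fattened => i; rewrite subr0 addr0 lexx ltrDl.
exact: dyadic_side_gt0.
Qed.

Lemma dyadic_side_inj : injective dyadic_side.
Proof.
move=> i j /ieexprIz; move=> /(_ _ _)/oppr_inj; apply => //.
by rewrite -[1]/(1%:R) eqr_nat.
Qed.

Lemma dyadic_cube_level u u' j j' m m' :
  dcube u j m = dcube u' j' m' -> j = j'.
Proof.
move=> /(congr1 mu); rewrite [mu _]lebesgue_dyadic_cube [RHS]lebesgue_dyadic_cube => -[] /eqP.
rewrite eqrXn2 ?(ltW (dyadic_side_gt0 _))// => /eqP; exact: dyadic_side_inj.
Qed.

Lemma dyadic_sideB j (k : nat) : dyadic_side (j - k%:Z) = 2 ^+ k * dyadic_side j.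
Proof.
by rewrite /dyadic_side opprB addrC expfzDr// mulrC -exprnP.
Qed.

Lemma dyadic_signB j (k : nat) : dyadic_sign (j - k%:Z) = (-1) ^+ k * dyadic_sign j.
Proof.
rewrite /dyadic_sign expfzDr ?oppr_eq0 ?oner_eq0// mulrC; congr (_ * _).
rewrite -exprnN -exprVn invrN1 //.
Qed.

Lemma neg2_pow (k : nat) : exists q : int, (-2) ^+ k = 1 + 3 * q :> int.
Proof.
elim: k => [|k [q IH]]; first by exists 0; rewrite expr0 mulr0 addr0.
exists (-1 - 2 * q); rewrite exprS IH; lia.
Qed.

(** Walls of the coarser grid are walls of the finer one because
    [(-2) ^ k = 1] modulo 3: this is what the sign in the shift is for. *)
Lemma dyadic_cube_nested u j (k : nat) m m' x :
  dcube u j m x -> dcube u (j - k%:Z) m' x ->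
  dcube u j m `<=` dcube u (j - k%:Z) m'.
Proof.
rewrite !dyadic_cube_fattened => xm xm' y ym i.
have := xm i; have := xm' i; have := ym i; rewrite !mxE !subr0 !addr0.
rewrite dyadic_sideB dyadic_signB.
have [q qE] := neg2_pow k.
have w0 := dyadic_side_gt0 j.
set w := dyadic_side j in w0 *; set s := dyadic_sign j.
have [S SE] : exists S : int, S%:~R = s.
  by case: (dyadic_signP j) => e; [exists 1|exists (-1)]; rewrite /s e ?intrN.
pose M : int := 2 ^+ k * m' ord0 i + S * q * (u ord0 i : nat)%:Z.
have -> : wall (2 ^+ k * w) ((-1) ^+ k * s) (u ord0 i) (m' ord0 i) =
    wall w s (u ord0 i) M.
  rewrite /wall /M intrD !intrM SE -!pmulrn.
  have -> : ((2 ^+ k : int)%:~R : R) = 2 ^+ k by rewrite rmorphXn.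
  have qR : (2 ^+ k : R) * (-1) ^+ k = 1 + 3 * q%:~R.
    rewrite -exprMn mulrN1; have := congr1 (fun n : int => n%:~R : R) qE.
    by rewrite rmorphXn /= intrD intrM intrN.
  have -> : 2 ^+ k * w * ((m' ord0 i)%:~R + (-1) ^+ k * s * ((u ord0 i)%:R / 3)) =
      w * (2 ^+ k * (m' ord0 i)%:~R + (2 ^+ k * (-1) ^+ k) * s * ((u ord0 i)%:R / 3)) by ring.
  by rewrite qR; field.
move=> /andP[y1 y2] /andP[x1 x2] /andP[x3 x4].
have le1 : M <= m ord0 i.
  rewrite -ltzD1 -(ltr_int R) intrD -(ltr_pM2l w0).
  by move: x1 x4; rewrite /wall; clearbody M; rewrite -/w; move: (M%:~R : R) => M1; lra.
have le2 : m ord0 i + 1 <= M + 2 ^+ k.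
  rewrite lezD1 -(ltr_int R) intrD rmorphXn /= -(ltr_pM2l w0).
  by move: x2 x3; rewrite /wall; clearbody M; move: (M%:~R : R) => M1; lra.
apply/andP; split.
  apply: le_trans y1; rewrite /wall ler_pM2l// lerD2r ler_int //.
apply: lt_le_trans y2 _.
have : w * (m ord0 i + 1)%:~R <= w * (M + 2 ^+ k)%:~R by rewrite ler_pM2l// ler_int.
have -> : (M + 2 ^+ k)%:~R = M%:~R + 2 ^+ k :> R by rewrite intrD rmorphXn.
by rewrite intrD /wall; clearbody M; move: (M%:~R : R) => M1; lra.
Qed.

Lemma dyadic_cube_meet u j m m' x :
  dcube u j m x -> dcube u j m' x -> m = m'.
Proof.
rewrite !dyadic_cube_fattened => h h'; apply/rowP => i.
have w0 := dyadic_side_gt0 j.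
have := h i; have := h' i; rewrite !mxE !subr0 !addr0 => /andP[x1 x2] /andP[x3 x4].
have lt_aux (a b : int) : dyadic_side j * a%:~R < dyadic_side j * (b + 1)%:~R -> a <= b.
  by rewrite ltr_pM2l// ltr_int ltzD1.
apply/eqP; rewrite eq_le; apply/andP; split; apply: lt_aux; rewrite intrD.
  by move: x2 x3; rewrite /wall; lra.
by move: x1 x4; rewrite /wall; lra.
Qed.

Lemma dyadic_ancestorE u j (k : nat) m m' :
  dcube u j m `<=` dcube u (j - k%:Z) m' ->
  danc u k (dcube u j m) = dcube u (j - k%:Z) m'.
Proof.
move=> sub; apply: xget_unique; first by exists j, m, m'.
move=> P [j1 [m1 [m1' [e -> sub1]]]].
have ej := dyadic_cube_level e; subst j1.
have x0 := @dyadic_cube_nonempty u j m.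
by rewrite (dyadic_cube_meet (sub _ x0) (sub1 _ x0)).
Qed.

(** Choose the shift in each coordinate separately, away from the walls that
    cut the interval in question at the scales [j - 4] and [j - 4 - k]. By
    [crossed_unique] at most one shift is bad at each scale, since the
    intervals have lengths [l] and [(1 + 2 ^ k.+1) * l], at most a third of
    the grid sides [16 * l] and [2 ^ k * 16 * l]. *)
Lemma shifted_cover j a (k : nat) : exists u m,
  [/\ fattened a (dyadic_side j) 0 `<=` dcube u (j - 4%:Z) m,
      dilate a (dyadic_side j) k `<=` danc u k (dcube u (j - 4%:Z) m) &
      exists m', danc u k (dcube u (j - 4%:Z) m) =
                 dcube u (j - 4%:Z - k%:Z) m'].
Proof.
set j4 := j - 4%:Z; have l0 := dyadic_side_gt0 j.
set l := dyadic_side j in l0 *.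
have w0 := dyadic_side_gt0 j4; have w0' := dyadic_side_gt0 (j4 - k%:Z).
have wE : dyadic_side j4 = 16 * l by rewrite /j4 dyadic_sideB; congr (_ * _); ring.
have wE' : dyadic_side (j4 - k%:Z) = 2 ^+ k * (16 * l) by rewrite dyadic_sideB wE.
have k1 : 1 <= 2 ^+ k :> R by rewrite exprn_ege1// ler1n.
have kl : l <= 2 ^+ k * l by rewrite ler_peMl// ltW.
have good i : exists t, exists z z',
    wall (dyadic_side j4) (dyadic_sign j4) t z <= a ord0 i /\
    a ord0 i + l <= wall (dyadic_side j4) (dyadic_sign j4) t z + dyadic_side j4 /\
    wall (dyadic_side (j4 - k%:Z)) (dyadic_sign (j4 - k%:Z)) t z' <= a ord0 i - 2 ^+ k * l /\
    a ord0 i + l + 2 ^+ k * l <=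
      wall (dyadic_side (j4 - k%:Z)) (dyadic_sign (j4 - k%:Z)) t z' + dyadic_side (j4 - k%:Z).
  have [t [n1 n2]] := @avoid_two
    (crossed (dyadic_side j4) (dyadic_sign j4) (a ord0 i) (a ord0 i + l))
    (crossed (dyadic_side (j4 - k%:Z)) (dyadic_sign (j4 - k%:Z))
       (a ord0 i - 2 ^+ k * l) (a ord0 i + l + 2 ^+ k * l))
    ltac:(move=> t t'; apply: crossed_unique w0 (dyadic_signP _) _; rewrite wE; lra)
    ltac:(move=> t t'; apply: crossed_unique w0' (dyadic_signP _) _; rewrite wE'; lra).
  have [z [z1 z2]] := not_crossed w0 n1; have [z' [z3 z4]] := not_crossed w0' n2.
  by exists t, z, z'.
have [t /choice[z /choice[z' zz]]] := choice good.
pose u : 'rV['I_3]_d := \row_i t i; pose m : 'rV[int]_d := \row_i z i.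
pose m' : 'rV[int]_d := \row_i z' i.
have sub1 : fattened a l 0 `<=` dcube u j4 m.
  rewrite dyadic_cube_fattened => y ya i; have := ya i; have [z1 [z2 _]] := zz i.
  rewrite !mxE !subr0 !addr0 => /andP[y1 y2]; apply/andP; split.
    exact: le_trans y1.
  exact: lt_le_trans y2 z2.
have sub2 : dilate a l k `<=` dcube u (j4 - k%:Z) m'.
  rewrite dyadic_cube_fattened => y ya i; have := ya i; have [_ [_ [z1 z2]]] := zz i.
  rewrite !mxE !subr0 !addr0 => /andP[y1 y2]; apply/andP; split.
    exact: le_trans y1.
  exact: lt_le_trans y2 z2.
have al : fattened a l 0 a.
  by move=> i; rewrite subr0 addr0 lexx ltrDl.
have sub3 : fattened a l 0 `<=` dilate a l k.
  by apply: fattened_sub; apply: le_trans kl; exact: ltW.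
have anc : danc u k (dcube u j4 m) = dcube u (j4 - k%:Z) m'.
  apply: dyadic_ancestorE; apply: (@dyadic_cube_nested _ _ _ _ _ a); first exact: sub1.
  by apply: sub2; apply: sub3.
exists u, m; rewrite anc; split; [exact: sub1|exact: sub2|by exists m'].
Qed.

End dyadic_cubes.

(** * Sparse domination *)

Lemma sum_le_esum (R : realType) (I : choiceType) (S : set I) (a : I -> \bar R)
    (n : nat) (P : pred nat) (e : nat -> I) :
  (forall i, (i < n)%N -> P i -> S (e i)) -> injective e ->
  (\sum_(0 <= i < n | P i) a (e i) <= \esum_(t in S) a t)%E.
Proof.
move=> eS ei; apply: esum_ge; exists [set` [seq e i | i <- index_iota 0 n & P i]].
  split; first exact: finite_seq.
  move=> t /= /mapP[i]; rewrite mem_filter mem_index_iota => /andP[Pi /andP[_ i_n]] ->.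
  exact: eS.
rewrite -fsbig_seq ?map_inj_uniq ?filter_uniq ?iota_uniq//.
by rewrite big_map big_filter.
Qed.

Section sparse_families.
Context (R : realType) (d' : nat).
Local Notation d := d'.+1.
Local Notation pt := 'rV[R]_d.
Local Notation mu := (lebesgue_rV R d).
Local Notation msets := (measurable : set (set (lebesgue_type R d))).
Local Notation dcube := (@dyadic_cube R d).
Local Notation danc := (@dyadic_ancestor R d).
Local Notation label := (nat * 'rV[int]_d)%type.

Lemma side_dyadic j (n : nat) : side (dyadic_side R j) n = dyadic_side R (j + n%:Z).
Proof.
rewrite /side; have := dyadic_sideB R (j + n%:Z) n; rewrite addrK => ->.
by rewrite mulrC mulKf// expf_neq0.
Qed.

(** The covering cube is [16] times as long as [2 ^+ k * l], which is where
    the factor [16 ^+ d] comes from. *)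
Lemma dilate_mean_average (E : normedModType R) (f : pt -> E) (a : pt) (l : R) k
    u j m : 0 < l -> strongly_measurable f -> dyadic_side R j = 2 ^+ k * (16 * l) ->
  dilate a l k `<=` dcube u j m ->
  (dilate_mean f a l k <= (16 ^+ d)%:E * average (dcube u j m) (fun y => `|f y|%R))%E.
Proof.
move=> l0 mf sideE sub.
rewrite /average [mu _]lebesgue_dyadic_cube sideE /= muleA -EFinM.
have -> : 16 ^+ d * ((2 ^+ k * (16 * l)) ^+ d)^-1 = (2 ^+ k * l) ^- d :> R.
  rewrite (_ : 2 ^+ k * (16 * l) = 16 * (2 ^+ k * l)); last by ring.
  by rewrite [(16 * _) ^+ d]exprMn invfM mulrA mulfV ?mul1r// expf_neq0.
apply: lee_wpmul2l; first by rewrite lee_fin invr_ge0 exprn_ge0// mulr_ge0 ?exprn_ge0// ltW.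
apply: ge0_subset_integral;
  [exact: fattened_measurable|exact: dyadic_cube_measurable| | |exact: sub].
  apply: (@measurable_funS _ _ _ _ setT); [exact: measurableT|by []|].
  exact: measurable_norm_EFin.
by move=> y _; rewrite lee_fin.
Qed.

Context (j0 : int) (TT : set label) (uu : label -> nat -> 'rV['I_3]_d)
  (mm : label -> nat -> 'rV[int]_d).
Local Notation L := (dyadic_side R j0).

Definition sparse_cube t k : set pt := dcube (uu t k) (j0 + t.1%:Z - 4%:Z) (mm t k).

Definition sparse_family u k : set (set pt) :=
  [set Q | exists2 t, TT t /\ uu t k = u & Q = sparse_cube t k].

Hypothesis cube_sub : forall t k, cube L t.1 t.2 `<=` sparse_cube t k.

Lemma sparse_family_dyadic u k : sparse_family u k `<=` dyadic_system u.
Proof. by move=> Q [t [_ <-] ->]; exists (j0 + t.1%:Z - 4%:Z), (mm t k). Qed.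

(** The major part of one stopping cube that gave rise to a member serves for
    the member, whose measure is [16 ^+ d] times that of the stopping cube. *)
Lemma sparse_family_nearly_disjoint u k (F : label -> set pt) :
  (forall t, msets (F t)) -> (forall t, F t `<=` cube L t.1 t.2) ->
  (forall t, TT t -> (2^-1%:E * mu (cube L t.1 t.2) <= mu (F t))%E) ->
  (forall t t', t <> t' -> F t `&` F t' = set0) ->
  pairwise_nearly_disjoint (sparse_family u k).
Proof.
move=> mF Fsub Fge Fdisj; exists (2^-1 * 16 ^- d); split.
  rewrite mulr_gt0 ?invr_gt0 ?exprn_gt0//=.
  apply: mulr_ilt1; rewrite ?invr_ge0 ?exprn_ge0//.
  - by rewrite invf_lt1// ltr1n.
  - by rewrite invf_lt1 ?exprn_gt0// exprn_egt1// ltr1n.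
split.
  by move=> Q [t _ ->]; exact: dyadic_cube_measurable.
have /choice[tt ttP] Q : exists t, sparse_family u k Q -> TT t /\ Q = sparse_cube t k.
  have [[t [Tt _] Qt]|nQ] := pselect (sparse_family u k Q); first by exists t.
  by exists (0, 0).
exists (F \o tt); split=> [Q SQ|Q Q' SQ SQ' QQ'].
  have [Tt QE] := ttP _ SQ; split; first exact: mF.
    by rewrite [X in _ `<=` X]QE; apply: subset_trans (Fsub _) _; exact: cube_sub.
  apply: le_trans (Fge _ Tt).
  rewrite [X in mu X]QE [mu (sparse_cube _ _)]lebesgue_dyadic_cube.
  rewrite [mu (cube _ _ _)]lebesgue_cube ?dyadic_side_gt0//.
  rewrite side_dyadic dyadic_sideB -!EFinM lee_fin -mulrA.
  rewrite [(_ * dyadic_side _ _) ^+ d]exprMn mulrA -mulrA.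
  rewrite (_ : 2 ^+ 4 = 16 :> R); last by rewrite -natrX.
  by rewrite [16 ^- d * _]mulrA mulVf ?mul1r// expf_neq0.
apply: Fdisj => e; apply: QQ'.
by rewrite (ttP _ SQ).2 (ttP _ SQ').2 -/(tt Q) e.
Qed.

(** The stopping cubes around [x] have different generations, hence give
    different members; those with the shift [u] contribute a part of the sum
    that defines the model operator. *)
Lemma sparse_stopping_sum (P : pred nat) (x : pt) (n : nat) k (g : pt -> R) :
  (forall i, P i -> TT (i, idx L i x)) -> (forall y, 0 <= g y) ->
  (\sum_(0 <= i < n | P i)
     average (danc (uu (i, idx L i x) k) k (sparse_cube (i, idx L i x) k)) g <=
   \sum_(u : 'rV['I_3]_d) model_operator u (sparse_family u k) k g x)%E.
Proof.
move=> PT g0.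
rewrite (eq_bigr (fun i => \sum_(u : 'rV['I_3]_d) if uu (i, idx L i x) k == u then
   average (danc u k (sparse_cube (i, idx L i x) k)) g else 0)%E); last first.
  move=> i _; rewrite (bigD1 (uu (i, idx L i x) k))//= eqxx big1 ?adde0//.
  by move=> u; rewrite eq_sym => /negbTE ->.
rewrite exchange_big /=; apply: lee_sum => u _.
rewrite -big_mkcondr /model_operator.
have x1 i : \1_(sparse_cube (i, idx L i x) k) x = 1 :> R.
  by rewrite indicE mem_set//; apply: cube_sub.
rewrite (eq_bigr (fun i => (\1_(sparse_cube (i, idx L i x) k) x : R)%:E *
   average (danc u k (sparse_cube (i, idx L i x) k)) g)%E); last first.
  by move=> i _; rewrite x1 mul1e.
apply: (@sum_le_esum _ _ _ (fun Q => (\1_Q x : R)%:E * average (danc u k Q) g)%E n _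
   (fun i => sparse_cube (i, idx L i x) k)).
  by move=> i _ /andP[/PT Ti /eqP iu]; exists (i, idx L i x).
by move=> i i' /dyadic_cube_level /addIr /addrI; case.
Qed.

Lemma average_ge0 (Q : set pt) (g : pt -> R) : (forall y, 0 <= g y) ->
  (0 <= average Q g)%E.
Proof.
move=> g0; rewrite mule_ge0//.
  by rewrite lee_fin invr_ge0 fine_ge0// lebesgue_outer_ge0.
by apply: integral_ge0 => y _; rewrite lee_fin.
Qed.

Lemma model_operator_ge0 u S k (g : pt -> R) x : (forall y, 0 <= g y) ->
  (0 <= model_operator u S k g x)%E.
Proof.
move=> g0; apply: esum_ge0 => Q _; rewrite mule_ge0 ?lee_fin//.
exact: average_ge0.
Qed.

(** Exchange the sum over stopping generations with the sum over [k], and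
    collect for each [k] the generations by shift. *)
Lemma weighted_sums_dominated (E : normedModType R) (f : pt -> E) (alpha Lam : R)
    (P : pred nat) (x : pt) (n : nat) : 0 <= Lam ->
  (forall t k, dilate_mean f (corner L t.1 t.2) (side L t.1) k <=
     (16 ^+ d)%:E * average (danc (uu t k) k (sparse_cube t k)) (fun y => `|f y|%R))%E ->
  (forall i, P i -> TT (i, idx L i x)) ->
  (\sum_(0 <= i < n | P i)
     2%:E * (Lam%:E * dilate_mean_sum alpha f (corner L i (idx L i x)) (side L i)) <=
   (2 * Lam * 16 ^+ d)%:E * \sum_(u : 'rV['I_3]_d) \sum_(0 <= k <oo)
     (2 `^ (- (alpha * k%:R)))%:E *
     model_operator u (sparse_family u k) k (fun y => `|f y|%R) x)%E.
Proof.
move=> Lam0 dom PT; set g := fun y => `|f y|%R.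
have g0 y : 0 <= g y by rewrite /g.
pose av i k := average (danc (uu (i, idx L i x) k) k (sparse_cube (i, idx L i x) k)) g.
have av0 i k : (0 <= av i k)%E by exact: average_ge0.
have dav0 i k : (0 <= (decay alpha ^+ k)%:E * av i k)%E by rewrite mule_ge0 ?lee_fin ?decay_ge0.
have C0 : 0 <= 2 * Lam * 16 ^+ d by rewrite !mulr_ge0 ?exprn_ge0.
apply: (@le_trans _ _ (\sum_(0 <= i < n | P i)
    (2 * Lam * 16 ^+ d)%:E * \sum_(0 <= k <oo) (decay alpha ^+ k)%:E * av i k)%E).
  apply: lee_sum => i _; rewrite 2!EFinM -2!muleA.
  do 2 (apply: lee_wpmul2l; first by rewrite lee_fin).
  rewrite -nneseriesZl; last by move=> k _; exact: dav0.
  apply: lee_nneseries => k _.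
    rewrite mule_ge0 ?lee_fin ?decay_ge0//; apply: dilate_mean_ge0.
    by apply: side_gt0; exact: dyadic_side_gt0.
  rewrite [leRHS]muleCA; apply: lee_wpmul2l; first by rewrite lee_fin decay_ge0.
  exact: (dom (i, idx L i x) k).
rewrite -ge0_sume_distrr; last by move=> i _; apply: nneseries_ge0 => k _ _; exact: dav0.
apply: lee_wpmul2l; first by rewrite lee_fin.
rewrite -nneseries_sum; last by move=> i k _; exact: dav0.
rewrite -(@nneseries_sum _ (index_enum _) xpredT); last first.
  by move=> u k _; rewrite mule_ge0 ?lee_fin ?powR_ge0//; exact: model_operator_ge0.
apply: lee_nneseries => k _; first by move=> _; apply: sume_ge0 => i _; exact: dav0.
rewrite -ge0_sume_distrr; last by move=> i _; exact: av0.
rewrite decayX -ge0_sume_distrr; last by move=> u _; exact: model_operator_ge0.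
apply: lee_wpmul2l; first by rewrite lee_fin decay_ge0.
exact: sparse_stopping_sum.
Qed.

End sparse_families.

Lemma is_cube_bounds (R : realType) d (Q : set 'rV[R]_d) : is_cube Q ->
  exists a : 'rV[R]_d, exists l : R, 0 < l /\
    forall x, Q x -> forall i, a ord0 i <= x ord0 i <= a ord0 i + l.
Proof.
move=> [a [l [bl [br [l0 ->]]]]]; exists a, l; split => // x Qx i.
have := Qx i; case: (bl i); case: (br i); rewrite in_itv /= => /andP[h1 h2];
  by apply/andP; split; lra.
Qed.

Lemma dyadic_side_ge (R : realType) (l : R) : exists j, l <= dyadic_side R j.
Proof.
exists (- (Num.Def.archi_bound l)%:Z); rewrite /dyadic_side opprK.
exact/ltW/upper_nthrootP.
Qed.

Lemma closed_support0 (R : realType) d (E : normedModType R) (f : 'rV[R]_d -> E)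
  (Q : set 'rV[R]_d) : closed_support f `<=` Q -> forall x, ~ Q x -> f x = 0.
Proof.
move=> fQ x Qx; apply: contrapT => /eqP fx; apply: Qx; apply: fQ.
exact: subset_closure.
Qed.

Lemma oscillation_set_measurable (R : realType) d' (E : normedModType R)
  (f : 'rV[R]_(d'.+1) -> E) (A : set 'rV[R]_(d'.+1)) (b : \bar R) (c : E) :
  strongly_measurable f ->
  measurable (A : set (lebesgue_type R d'.+1)) ->
  measurable ([set x | A x /\ (b < `|f x - c|%:E)%E] : set (lebesgue_type R d'.+1)).
Proof.
move=> mf mA.
have mg : measurable_fun setT (fun x : lebesgue_type R d'.+1 => `|f x - c|%:E).
  by apply: measurableT_comp; [exact: EFin_measurable|exact: measurable_norm_sub].
have := mg measurableT _ (emeasurable_itv `]b, +oo[).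
rewrite setTI => h; have := measurableI _ _ mA h.
congr (measurable _); apply/seteqP; split => x [Ax bx]; split => //; move: bx => /=;
  by rewrite in_itv /= andbT.
Qed.

Theorem theorem2p9 (R : realType) (d : nat) (p alpha N CK : R) :
  (0 < d)%N -> 1 < p -> 0 < alpha <= 1 ->
  exists C : R,
    forall (E : completeNormedModType R)
           (T : ('rV[R]_d -> E) -> ('rV[R]_d -> E)),
    cz_operator p alpha N CK T ->
    forall (f : 'rV[R]_d -> E) (Q0 : set 'rV[R]_d),
      strongly_measurable f -> bounded_fun f -> compact (closed_support f) ->
      is_cube Q0 -> closed_support f `<=` Q0 ->
      exists S : 'rV['I_3]_d -> nat -> set (set 'rV[R]_d),
        (forall u k, S u k `<=` dyadic_system u /\
                     pairwise_nearly_disjoint (S u k)) /\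
        {ae lebesgue_rV R d, forall x,
          ((\1_Q0 x * `|T f x|)%:E <=
           C%:E * \sum_(u : 'rV['I_3]_d) \sum_(0 <= k <oo)
             (2 `^ (- (alpha * k%:R)))%:E *
             model_operator u (S u k) k (fun y => `|f y|%R) x)%E}.
Proof.
case: d => [//|d'] _ p1 alpha01.
have d0 : 0 < stop_ratio R d' / 2 by rewrite divr_gt0// (stop_ratio_bounds R d').1.
have [Lam [Lam0 osc]] := @local_oscillation R d' p alpha N CK _ p1 alpha01 d0.
exists (2 * Lam * 16 ^+ d'.+1) => E T cz f Q0 mf /bounded_fun_normP[B fB] cpt Qc suppQ.
have [a [l [l0 Qal]]] := is_cube_bounds Qc.
have fQ := closed_support0 suppQ.
have [j0 lj0] := @dyadic_side_ge R l.
set L := dyadic_side R j0 in lj0.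
have L0 : 0 < L := dyadic_side_gt0 R j0.
pose A := fattened a l l.
have mA : measurable (A : set (lebesgue_type R d'.+1)) by exact: fattened_measurable.
have fA x : ~ A x -> f x = 0.
  move=> Ax; apply: fQ => Qx; apply: Ax => i.
  by have /andP[h1 h2] := Qal _ Qx i; apply/andP; split; lra.
have Afin : (lebesgue_rV R d'.+1 A < +oo)%E.
  by rewrite [lebesgue_rV _ _ _]lebesgue_fattened ?ltry// !addr_ge0// ltW.
have := fun t : nat * 'rV[int]_(d'.+1) =>
  osc _ T cz f B A mf fB cpt mA Afin fA L t.1 t.2 L0.
move=> /choice[c /all_and2[c_small c_zero]].
pose b (t : nat * 'rV[int]_(d'.+1)) :=
  (Lam%:E * dilate_mean_sum alpha f (corner L t.1 t.2) (side L t.1))%E.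
have b0 t : (0 <= b t)%E.
  rewrite mule_ge0 ?lee_fin ?(ltW Lam0)//; apply: nneseries_ge0 => k _ _.
  rewrite mule_ge0 ?lee_fin ?decay_ge0//; apply: dilate_mean_ge0; exact: side_gt0.
have LpTf : Lp p (T f).
  have [[LpT _] _ _] := cz; apply: LpT.
  by apply: (Lp_bounded _ mf mA Afin fB fA); apply: lt_trans p1.
have mbad t : measurable (bad_set L (T f) c b t : set (lebesgue_type R d'.+1)).
  by apply: oscillation_set_measurable; [exact: LpTf.1|exact: cube_measurable].
have /choice[w /all_and3[cub dil anc]] : forall tk : (nat * 'rV[int]_(d'.+1)) * nat,
  exists um : 'rV['I_3]_(d'.+1) * 'rV[int]_(d'.+1),
  [/\ cube L tk.1.1 tk.1.2 `<=` dyadic_cube um.1 (j0 + tk.1.1%:Z - 4%:Z) um.2,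
      dilate (corner L tk.1.1 tk.1.2) (side L tk.1.1) tk.2 `<=`
        dyadic_ancestor um.1 tk.2 (dyadic_cube um.1 (j0 + tk.1.1%:Z - 4%:Z) um.2) &
      exists m', dyadic_ancestor (R := R) um.1 tk.2
          (dyadic_cube um.1 (j0 + tk.1.1%:Z - 4%:Z) um.2) =
        dyadic_cube um.1 (j0 + tk.1.1%:Z - 4%:Z - tk.2%:Z) m'].
  move=> [[n m] k] /=.
  have [u [m1 h]] := shifted_cover (j0 + n%:Z) (corner L n m) k.
  by exists (u, m1); rewrite cube_fattened// side_dyadic.
pose TT := stopping_cubes L (T f) c b.
pose uu t k := (w (t, k)).1; pose mm t k := (w (t, k)).2.
have cube_sub t k : cube L t.1 t.2 `<=` sparse_cube j0 uu mm t k by exact: (cub (t, k)).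
exists (sparse_family j0 TT uu mm); split.
  move=> u k; split; first exact: sparse_family_dyadic.
  apply: (@sparse_family_nearly_disjoint _ _ _ _ _ _ cube_sub _ _ (final_part L (T f) c b)).
  - by move=> t; exact: final_part_measurable.
  - by move=> t y [].
  - by move=> t Tt; apply: mu_final_part.
  - exact: final_part_disjoint.
have dom t k : (dilate_mean f (corner L t.1 t.2) (side L t.1) k <=
    (16 ^+ d'.+1)%:E * average (dyadic_ancestor (uu t k) k (sparse_cube j0 uu mm t k))
       (fun y => `|f y|%R))%E.
  have [m' ancE] := anc (t, k).
  rewrite /sparse_cube /uu /mm ancE; apply: dilate_mean_average => //.
  - exact: side_gt0.
  - rewrite !dyadic_sideB -side_dyadic (_ : 2 ^+ 4 = 16 :> R) //.
    by rewrite -natrX.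
  - by rewrite -ancE; exact: (dil (t, k)).
have := mu0_negligible (stopping_bound L0 b0 mbad c_small).
apply: negligibleS => x /= nbound; apply: contra_not nbound => -[n bn].
have rhs0 : (0 <= (2 * Lam * 16 ^+ d'.+1)%:E * \sum_(u : 'rV['I_3]_(d'.+1))
    \sum_(0 <= k <oo) (2 `^ (- (alpha * k%:R)))%:E *
      model_operator u (sparse_family j0 TT uu mm u k) k (fun y => `|f y|%R) x)%E.
  rewrite mule_ge0//; first by rewrite lee_fin !mulr_ge0 ?exprn_ge0// ltW.
  apply: sume_ge0 => u _; apply: nneseries_ge0 => k _ _.
  by rewrite mule_ge0 ?lee_fin ?powR_ge0//; exact: model_operator_ge0.
have [Qx|nQx] := pselect (Q0 x); last first.
  by rewrite indicE memNset// mul0r.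
rewrite indicE mem_set// mul1r; apply: (le_trans bn).
(* The triple of a top cube around a point of [Q0] contains [Q0], and with it
   the support of [f]. *)
have -> : c (0, idx L 0 x) = 0.
  apply: c_zero => y ny; apply: fQ => Qy; apply: ny => i /=.
  have /(cubeP _ _ _ L0)/(_ i) /andP[h1 h2] : cube L 0 (idx L 0 x) x by [].
  have /andP[h3 h4] := Qal _ Qx i; have /andP[h5 h6] := Qal _ Qy i.
  have e : side L 0 = L by rewrite /side expr0 divr1.
  move: h1 h2; rewrite !mxE expr0 mul1r e => h1 h2.
  by apply/andP; split; lra.
rewrite normr0 add0e /stopping_sum -big_mkcond /=.
apply: weighted_sums_dominated => //; first exact: ltW.
by move=> i /asboolP.
Qed.
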